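(* Let $k\geq 2$ and let $M^n\times\mathbb{R}^k$ be a Riemannian product with weight $e^\psi$ such that, for some constant $\lambda\geq 0$, $H_{\psi,r}\geq\lambda$ for any $r>0$. Take a two-sided, compact and connected hypersurface $\Sigma\subset M\times\mathbb{R}^k$ with $\partial\Sigma\neq\emptyset$ and $|H_\psi|\leq\lambda$. If $\partial\Sigma\subset M\times B^k(r_0)$ for some $r_0>0$, then $\Sigma\subseteq M\times B^k(r_0)$. Moreover, if $\Sigma$ intersects $M\times\mathbb{S}^{k-1}(r_0)$ away from $\partial\Sigma$, or $\langle V,\nu\rangle\geq 0$ along $\partial\Sigma$, then $\Sigma\subseteq M\times\mathbb{S}^{k-1}(r)$ for some $r>0$ where $H_{\psi,r}=\lambda$.
   Context: $M^n$ is a connected oriented $n$-dimensional Riemannian manifold, possibly with smooth boundary; $M\times\mathbb{R}^k$ is the Riemannian product with Euclidean space. $B^k(r)$ and $\mathbb{S}^{k-1}(r)$ denote the closed round ball and the round sphere of radius $r>0$ centered at the origin of $\mathbb{R}^k$. A weight $e^\psi$ is a positive $C^1$ function. $V$ is the vector field $V(p,t):=(0,t)$ on $M\times\mathbb{R}^k$. For a two-sided smooth hypersurface $\Sigma$ (possibly with smooth boundary $\partial\Sigma$) with unit normal $N$, the $\psi$-mean curvature is $H_\psi:=-\operatorname{div}_\Sigma N-\langle\nabla\psi,N\rangle$, and $\nu$ denotes the inner unit conormal of $\Sigma$ along $\partial\Sigma$. For $r>0$, $H_{\psi,r}$ denotes the $\psi$-mean curvature function of $M\times\mathbb{S}^{k-1}(r)$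 with respect to the unit normal $(0,-t/r)$ at $(p,t)$; explicitly $H_{\psi,r}=\frac{1}{r}\big(k-1+\langle\nabla\psi,V\rangle\big)$. ''$\Sigma$ intersects $M\times\mathbb{S}^{k-1}(r_0)$ away from $\partial\Sigma$'' means $(\Sigma\setminus\partial\Sigma)\cap(M\times\mathbb{S}^{k-1}(r_0))\neq\emptyset$. *)

(* Defs.v *)
From HB Require Import structures.
From mathcomp Require Import all_boot all_order all_algebra.
From mathcomp Require Import all_classical all_reals all_analysis.
Set Implicit Arguments.
Unset Strict Implicit.
Unset Printing Implicit Defensive.
Import Order.TTheory GRing.Theory Num.Theory.
Import numFieldTopology.Exports numFieldNormedType.Exports.
Local Open Scope classical_set_scope.
Local Open Scope ring_scope.

(* [D] is the model domain in R^n.  Charts of manifolds with boundary take values in a closed half-space (or in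
  the product of a half-space with R^k).  A derivative at x is a limit of
  difference quotients over increments that stay in [D], hence it is two-sided
  in the interior and, at the boundary, one-sided in the transverse direction.
  As [D] is one of these domains, "all iterated partial derivatives in this
  sense exist and are continuous on U" is the usual notion of smoothness up to
  the boundary. *)

Definition pquot (R : realType) n (i : 'I_n)
    (f : 'rV[R]_n -> R) (x : 'rV[R]_n) (h : R) : R :=
  h^-1 * (f (x + h *: delta_mx 0 i) - f x).

Definition padm (R : realType) n (D : set 'rV[R]_n) (i : 'I_n)
    (x : 'rV[R]_n) : set R :=
  [set h | D (x + h *: delta_mx 0 i)].

Definition pd (R : realType) n (D : set 'rV[R]_n) (i : 'I_n)
    (f : 'rV[R]_n -> R) (x : 'rV[R]_n) : R :=
  lim (pquot i f x h @[h --> within (padm D i x) 0^']).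

Definition pderivable (R : realType) n (D : set 'rV[R]_n) (i : 'I_n)
    (f : 'rV[R]_n -> R) (x : 'rV[R]_n) : Prop :=
  cvg (pquot i f x h @[h --> within (padm D i x) 0^']).

Fixpoint Cr (R : realType) n (D : set 'rV[R]_n) (r : nat) (U : set 'rV[R]_n)
    (f : 'rV[R]_n -> R) : Prop :=
  match r with
  | 0 => {within U, continuous f}
  | r'.+1 => {within U, continuous f} /\
      forall i, (forall x, U x -> pderivable D i f x) /\ Cr D r' U (pd D i f)
  end.

(* Tangent vectors are row vectors, so the differential acts by [v *m jac]. *)
Definition jac (R : realType) n d (D : set 'rV[R]_n)
    (f : 'rV[R]_n -> 'rV[R]_d) (x : 'rV[R]_n) : 'M[R]_(n, d) :=
  \matrix_(i, j) pd D i (fun y => f y 0 j) x.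

(* The condition is void if n = 0. *)
Definition halfspace (R : realType) n : set 'rV[R]_n :=
  [set x | forall i : 'I_n, val i = 0%N -> 0 <= x 0 i].
Arguments halfspace : clear implicits.

(* An atlas with one chart selected around each point; [chart_inv A p] is the
   inverse of [chart A p] and is only meaningful on the image of the chart. *)
Record atlas (R : realType) (n : nat) (X : Type) := Atlas {
  model : set 'rV[R]_n;
  dom : X -> set X;
  chart : X -> X -> 'rV[R]_n;
  chart_inv : X -> 'rV[R]_n -> X
}.

Definition Cr_fun (R : realType) n (X : Type) (A : atlas R n X) (r : nat)
    (f : X -> R) : Prop :=
  forall p, Cr (model A) r (chart A p @` dom A p) (f \o chart_inv A p).

Definition smooth_map (R : realType) n d (X Y : Type)
    (A : atlas R n X) (B : atlas R d Y) (F : X -> Y) : Prop :=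
  forall (p : X) (q : Y) (j : 'I_d) (r : nat),
    Cr (model A) r (chart A p @` (dom A p `&` F @^-1` dom B q))
       (fun x => chart B q (F (chart_inv A p x)) 0 j).

Record smooth_manifold (R : realType) n (X : topologicalType)
    (A : atlas R n X) : Prop := SmoothManifold {
  manifold_hausdorff : hausdorff_space X;
  manifold_second_countable : @second_countable X;
  manifold_model : model A = halfspace R n;
  dom_open : forall p, open (dom A p);
  dom_self : forall p, dom A p p;
  chartK : forall p, {in dom A p, cancel (chart A p) (chart_inv A p)};
  chart_continuous : forall p, {within dom A p, continuous (chart A p)};
  chart_inv_continuous :
    forall p, {within chart A p @` dom A p, continuous (chart_inv A p)};
  chart_open : forall p, exists2 O : set 'rV[R]_n, open O &
    chart A p @` dom A p = O `&` model A;
  (* the changes of coordinates are smooth *)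
  transition_smooth : smooth_map A A id
}.

Definition boundary (R : realType) n (X : Type) (A : atlas R n X) : set X :=
  [set p | exists2 i : 'I_n, val i = 0%N & chart A p p 0 i = 0].

(* A tangent vector at p is given by its components in [chart A p].  If these
   are v in the chart at c, they are [v *m chg A c p z] in the chart at p. *)
Definition chg (R : realType) n (X : Type) (A : atlas R n X) (c p z : X) :
    'M[R]_n :=
  jac (model A) (chart A p \o chart_inv A c) (chart A c z).

(* [o q] tells whether the coordinate frame of [chart A q] is positively
   oriented at q; seen in a fixed chart this must be locally constant. *)
Definition orientation (R : realType) n (X : topologicalType)
    (A : atlas R n X) (o : X -> bool) : Prop :=
  forall p q, dom A p q -> \forall q' \near q,
    ((0 < \det (chg A q' p q')) == o q') = ((0 < \det (chg A q p q)) == o q).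

(* [g p] is the Gram matrix at p of the coordinate frame of [chart A p]. *)

Definition inner (R : realType) n (G : 'M[R]_n) (u v : 'rV[R]_n) : R :=
  (u *m G *m v^T) 0 0.

Definition gram (R : realType) n (X : Type) (A : atlas R n X)
    (g : X -> 'M[R]_n) (c : X) (x : 'rV[R]_n) : 'M[R]_n :=
  let z := chart_inv A c x in chg A c z z *m g z *m (chg A c z z)^T.

Record riemannian (R : realType) n (X : Type) (A : atlas R n X)
    (g : X -> 'M[R]_n) : Prop := Riemannian {
  metric_sym : forall p, (g p)^T = g p;
  metric_pos : forall p v, v != 0 -> 0 < inner (g p) v v;
  metric_smooth : forall c i j r,
    Cr (model A) r (chart A c @` dom A c) (fun x => gram A g c x i j)
}.

Definition christoffel (R : realType) n (X : Type) (A : atlas R n X)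
    (g : X -> 'M[R]_n) (c : X) (x : 'rV[R]_n) (l a b : 'I_n) : R :=
  let dG i j e := pd (model A) i (fun y => gram A g c y j e) x in
  2^-1 * \sum_(e < n) invmx (gram A g c x) l e
         * (dG a b e + dG b a e - dG e a b).

Definition grad (R : realType) n (X : Type) (A : atlas R n X)
    (g : X -> 'M[R]_n) (f : X -> R) (p : X) : 'rV[R]_n :=
  (\row_i pd (model A) i (f \o chart_inv A p) (chart A p p)) *m invmx (g p).

Definition diff_at (R : realType) m n (S X : Type) (AS : atlas R m S)
    (A : atlas R n X) (F : S -> X) (s : S) : 'M[R]_(m, n) :=
  jac (model AS) (chart A (F s) \o F \o chart_inv AS s) (chart AS s s).

(* components in [chart A c] of a vector field W along F *)
Definition field_in (R : realType) n (S X : Type) (A : atlas R n X)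
    (F : S -> X) (W : S -> 'rV[R]_n) (c : X) (s : S) : 'rV[R]_n :=
  W s *m chg A (F s) c (F s).

(* Row i is the Levi-Civita covariant derivative of the vector field W along
   F : S -> X in the direction of the i-th coordinate vector of S at s. *)
Definition covd (R : realType) m n (S X : Type) (AS : atlas R m S)
    (A : atlas R n X) (g : X -> 'M[R]_n) (F : S -> X) (W : S -> 'rV[R]_n)
    (s : S) : 'M[R]_(m, n) :=
  let c := F s in
  \matrix_(i, l)
    (pd (model AS) i (fun y => field_in A F W c (chart_inv AS s y) 0 l)
        (chart AS s s)
     + \sum_(a < n) \sum_(b < n)
         diff_at AS A F s i a * W s 0 b * christoffel A g c (chart A c c) l a b).

(* If the rows of E form a basis of the tangent space of Sigma and the rows of
   DW are the covariant derivatives of W in the directions of these rows, this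
   is div_Sigma W, the sum of <D_{e_i} W, e_i> over an orthonormal basis e_i. *)
Definition div_on (R : realType) m n (G : 'M[R]_n) (E DW : 'M[R]_(m, n)) : R :=
  \tr (invmx (E *m G *m E^T) *m (DW *m G *m E^T)).

Definition psi_mean_curvature (R : realType) m n (X : Type) (A : atlas R n X)
    (g : X -> 'M[R]_n) (psi : X -> R) (p : X) (E DN : 'M[R]_(m, n))
    (N : 'rV[R]_n) : R :=
  - div_on (g p) E DN - inner (g p) (grad A g psi p) N.

(* The hypersurface is the image of the embedding F, with unit normal N. *)
Record two_sided_hypersurface (R : realType) m n (S X : topologicalType)
    (AS : atlas R m S) (A : atlas R n X) (g : X -> 'M[R]_n) (F : S -> X)
    (N : S -> 'rV[R]_n) : Prop := TwoSidedHypersurface {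
  hyp_codim : m.+1 = n;
  hyp_manifold : smooth_manifold AS;
  hyp_continuous : continuous F;
  hyp_smooth : smooth_map AS A F;
  hyp_immersion : forall s, row_free (diff_at AS A F s);
  hyp_injective : injective F;
  hyp_homeo : forall U : set S, open U ->
    exists2 O : set X, open O & F @` U = range F `&` O;
  normal_unit : forall s, inner (g (F s)) (N s) (N s) = 1;
  normal_orth : forall s (v : 'rV[R]_m),
    inner (g (F s)) (v *m diff_at AS A F s) (N s) = 0;
  normal_smooth : forall s q j r,
    Cr (model AS) r (chart AS s @` (dom AS s `&` F @^-1` dom A q))
       (fun x => field_in A F N q (chart_inv AS s x) 0 j)
}.

Definition H_psi (R : realType) m n (S X : Type) (AS : atlas R m S)
    (A : atlas R n X) (g : X -> 'M[R]_n) (psi : X -> R) (F : S -> X)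
    (N : S -> 'rV[R]_n) (s : S) : R :=
  psi_mean_curvature A g psi (F s) (diff_at AS A F s) (covd AS A g F N s) (N s).

(* nu is the inner unit conormal of F at the boundary point s: a unit vector
   tangent to the hypersurface, orthogonal to its boundary, pointing inwards. *)
Definition inner_unit_conormal (R : realType) m n (S X : Type)
    (AS : atlas R m S) (A : atlas R n X) (g : X -> 'M[R]_n) (F : S -> X)
    (s : S) (nu : 'rV[R]_n) : Prop :=
  let T := diff_at AS A F s in
  [/\ inner (g (F s)) nu nu = 1,
      exists2 v : 'rV[R]_m, nu = v *m T &
        forall i : 'I_m, val i = 0%N -> 0 < v 0 i
    & forall w : 'rV[R]_m, (forall i : 'I_m, val i = 0%N -> w 0 i = 0) ->
        inner (g (F s)) nu (w *m T) = 0].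

Definition prod_atlas (R : realType) n k (M : Type) (A : atlas R n M) :
    atlas R (n + k) (M * 'rV[R]_k) :=
  @Atlas R (n + k) (M * 'rV[R]_k)%type
    [set x | model A (lsubmx x)]
    (fun c => [set z | dom A c.1 z.1])
    (fun c z => row_mx (chart A c.1 z.1) z.2)
    (fun c x => (chart_inv A c.1 (lsubmx x), rsubmx x)).

Definition prod_metric (R : realType) n k (M : Type) (g : M -> 'M[R]_n) :
    M * 'rV[R]_k -> 'M[R]_(n + k) :=
  fun z => block_mx (g z.1) 0 0 1%:M.

(* The library norm on ['rV_k] is the sup norm, so it is not used here. *)
Definition enorm (R : realType) k (t : 'rV[R]_k) : R :=
  Num.sqrt (\sum_(i < k) t 0 i ^+ 2).

Definition solid_cylinder (R : realType) (M : Type) k (r : R) :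
    set (M * 'rV[R]_k) := [set z | enorm z.2 <= r].
Definition cylinder (R : realType) (M : Type) k (r : R) :
    set (M * 'rV[R]_k) := [set z | enorm z.2 = r].
Arguments solid_cylinder {R} M k r.
Arguments cylinder {R} M k r.

Definition Vfield (R : realType) n k (M : Type) (z : M * 'rV[R]_k) :
    'rV[R]_(n + k) := row_mx 0 z.2.

Definition cylinder_normal (R : realType) n k (M : Type) (r : R)
    (z : M * 'rV[R]_k) : 'rV[R]_(n + k) := row_mx 0 (- (r^-1 *: z.2)).

(* basis of the tangent space {(u, w) | <w, t> = 0} of M x S^{k-1}(r) at (p, t) *)
Definition cylinder_frame (R : realType) n k (M : Type) (z : M * 'rV[R]_k) :=
  row_base (kermx (col_mx (0 : 'cV[R]_n) (z.2)^T)).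

(* H_{psi,r} at a point z of M x S^{k-1}(r); the unit normal extends to the
   ambient space as [cylinder_normal r], so its tangential derivatives are
   those of the extension. *)
Definition H_psi_r (R : realType) n k (M : Type) (A : atlas R n M)
    (g : M -> 'M[R]_n) (psi : M * 'rV[R]_k -> R) (r : R) (z : M * 'rV[R]_k) :
    R :=
  let P := prod_atlas k A in
  let gP := @prod_metric R n k M g in
  let E := cylinder_frame n z in
  let N := @cylinder_normal R n k M r in
  psi_mean_curvature P gP psi z E (E *m covd P P gP id N z) (N z).

(* Main.v *)
(** The function u = |t|^2/2 on Sigma is a subsolution of an elliptic equation.
  Decomposing V into its tangential and normal parts, the drift Laplacian of u
  for the weight e^psi is k - |N_2|^2 + <V,N> H_psi + <grad psi, V>, where N_2 is
  the R^k-component of N.  As r H_{psi,r} = k - 1 + <grad psi, V> >= r lambda at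
  distance r from the axis, while |N_2| <= 1, |<V,N>| <= r and
  |H_psi| <= lambda, this is nonnegative, and it vanishes only if r > 0 and
  H_{psi,r} = lambda.  By Hopf's strong maximum principle the interior of the set
  K = {u = max u} is open and closed, so it is empty or all of Sigma; it contains
  every point of K off the boundary, and also the boundary points of K
  where <V,nu> >= 0, by Hopf's boundary lemma.  If it is empty, the maximum of u
  is only attained on the boundary; if not, u is constant, its drift Laplacian
  vanishes, and this is the case of equality.

  In charts, the Laplacian is written with the Christoffel symbols of the induced
  metric, and the Gauss formula is the Koszul formula applied in the ambient chart;
  the operator has locally bounded coefficients because all the data are C^1. *)

Require Import Defs.
From HB Require Import structures.
From mathcomp Require Import all_boot all_order all_algebra.
From mathcomp Require Import all_classical all_reals all_analysis.
From mathcomp Require Import ring lra.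
Set Implicit Arguments.
Unset Strict Implicit.
Unset Printing Implicit Defensive.
Import Order.TTheory GRing.Theory Num.Theory.
Import numFieldTopology.Exports numFieldNormedType.Exports.
Local Open Scope classical_set_scope.
Local Open Scope ring_scope.

(** * Differentiability on box-like domains *)

(** Derivatives are limits taken inside a half-space or its product with R^k, and tensors at a point
    are read in the chart selected at that very point, so no formula can be differentiated as it
    stands. Two devices answer this: differentiability relative to the model domain ([isdiff]),
    which gives the usual calculus up to the boundary, and transition matrices ([chg]), which bring
    everything into one fixed chart of the hypersurface. Christoffel symbols are never transformed:
    ambient computations at a point use the ambient chart centred at its image.

    The maximum principle evaluates the operator only at interior points and knows its coefficients
    only through bounds. The barrier is not differentiated in several variables: at a maximum, the
    function is compared with a polynomial on each line, and the resulting matrix inequality is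
    contracted with the coefficient matrix through a Cholesky factor. Boundary points are reached
    from inside, since the interior part of a small half-ball is convex.

    On the axis the cylinders give no information; there [k >= 2] makes [k - |N_2|^2] positive. *)

Section Neighbourhoods.
Context {R : realType} {V : normedModType R}.
Implicit Types (x : V) (P : set V).

Lemma near_distP x P : (\forall y \near x, P y) <->
  exists2 d : R, 0 < d & forall y, `|y - x| < d -> P y.
Proof.
rewrite nbhs_normP; split=> -[d d0 dP]; exists d => // y yx; apply: dP.
  by rewrite /= distrC.
by rewrite distrC.
Qed.

Lemma near_dist x (d : R) : 0 < d -> \forall y \near x, `|y - x| < d.
Proof. by move=> d0; apply/near_distP; exists d. Qed.

Lemma near_distW x (d : R) : 0 < d -> \forall y \near x, `|y - x| <= d.
Proof. by move=> d0; apply: filterS (near_dist x d0) => y /ltW. Qed.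

End Neighbourhoods.

Lemma near_all {R : realType} {V : normedModType R} (x : V) (P : set V) :
  (forall y, P y) -> \forall y \near x, P y.
Proof. by move=> Px; apply/near_distP; exists 1. Qed.

Lemma near_forall {R : realType} {V : normedModType R} (I : finType) (x : V)
    (P : I -> V -> Prop) :
  (forall i, \forall y \near x, P i y) -> \forall y \near x, forall i, P i y.
Proof.
move=> Px; have H : \forall y \near x, forall i, i \in enum I -> P i y.
  elim: (enum I) => [|i s IH]; first exact: near_all.
  apply: filterS2 IH (Px i) => y Hs Hi j; rewrite inE => /orP[/eqP -> //|].
  exact: Hs.
by apply: filterS H => y Hy i; apply: Hy; rewrite mem_enum.
Qed.

Lemma near_and {R : realType} {V : normedModType R} (x : V) (P Q : set V) :
  (\forall y \near x, P y) -> (\forall y \near x, Q y) ->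
  \forall y \near x, P y /\ Q y.
Proof. exact: filterI. Qed.

Section RowNorm.
Context {R : realType} {n : nat}.
Implicit Types (v : 'rV[R]_n).

Lemma rV_norm_coord v i : `|v 0 i| <= `|v|.
Proof.
rewrite [leRHS]/Num.Def.normr /= mx_normrE; apply/bigmax_geP; right => /=.
by exists (0, i).
Qed.

Lemma rV_norm_le v (c : R) : 0 <= c -> (forall i, `|v 0 i| <= c) -> `|v| <= c.
Proof.
move=> c0 vc; rewrite /Num.Def.normr /= mx_normrE; apply/bigmax_leP; split => // -[i j] _ /=.
by rewrite (ord1 i).
Qed.

Lemma rV_norm_sum v : `|v| <= \sum_i `|v 0 i|.
Proof.
apply: rV_norm_le => [|i]; first by apply: sumr_ge0.
by rewrite (bigD1 i) //= lerDl sumr_ge0.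
Qed.

Lemma delta_coord i j : (delta_mx 0 i : 'rV[R]_n) 0 j = (j == i)%:R.
Proof. by rewrite mxE eqxx. Qed.

Lemma rV_norm_delta i : `|delta_mx 0 i : 'rV[R]_n| = 1.
Proof.
apply/eqP; rewrite eq_le; apply/andP; split.
  apply: rV_norm_le => // j; rewrite delta_coord.
  by case: (j == i); rewrite ?normr1 ?normr0.
by apply: le_trans (rV_norm_coord _ i); rewrite delta_coord eqxx normr1.
Qed.

End RowNorm.

Section Domains.
Context {R : realType} {n : nat}.
Implicit Types (D S : set 'rV[R]_n).

(* The model domains are boxes with possibly one-sided coordinates; these two
   closure properties are all the calculus below uses. *)
Record boxlike D : Prop := Boxlike {
  box_mid : forall x y z : 'rV[R]_n, D x -> D y ->
    (forall i, x 0 i <= z 0 i <= y 0 i \/ y 0 i <= z 0 i <= x 0 i) -> D z;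
  box_up : forall (x : 'rV[R]_n) i h, D x -> 0 <= h -> D (x + h *: delta_mx 0 i)
}.

(** Near a boundary point, chart images are open only relative to the model domain. *)
Definition ropen D S :=
  S `<=` D /\ forall x, S x -> \forall y \near x, D y -> S y.

Definition isdiff D (f : 'rV[R]_n -> R) x (a : 'I_n -> R) :=
  D x /\ forall e, 0 < e -> \forall y \near x, D y ->
    `|f y - f x - \sum_i (y - x) 0 i * a i| <= e * `|y - x|.

Lemma isdiff_dom D f x a : isdiff D f x a -> D x.
Proof. by case. Qed.

Lemma isdiff_near D f g x a :
  (\forall y \near x, D y -> f y = g y) -> isdiff D f x a -> isdiff D g x a.
Proof.
move=> fg [Dx fa]; split=> // e e0; have fgx := nbhs_singleton fg Dx.
by apply: filterS2 fg (fa e e0) => y fgy + Dy; rewrite -fgx -fgy //; apply.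
Qed.

Lemma eq_isdiff D f x a b : a =1 b -> isdiff D f x a -> isdiff D f x b.
Proof. by move=> ab; rewrite (_ : b = a) //; apply/funext. Qed.

Lemma sum_norm_le (v : 'rV[R]_n) (a : 'I_n -> R) :
  `|\sum_i v 0 i * a i| <= `|v| * \sum_i `|a i|.
Proof.
apply: le_trans (ler_norm_sum _ _ _) _; rewrite mulr_sumr ler_sum // => i _.
by rewrite normrM ler_wpM2r // rV_norm_coord.
Qed.

Lemma isdiff_lip D f x a : isdiff D f x a ->
  \forall y \near x, D y -> `|f y - f x| <= (1 + \sum_i `|a i|) * `|y - x|.
Proof.
case=> Dx /(_ 1 ltr01); apply: filterS => y + Dy => /(_ Dy) fy.
have -> : f y - f x = (f y - f x - \sum_i (y - x) 0 i * a i)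
   + \sum_i (y - x) 0 i * a i by rewrite subrK.
apply: le_trans (ler_normD _ _) _; rewrite mulrDl lerD //.
by rewrite [leRHS]mulrC sum_norm_le.
Qed.

Lemma isdiff_cont D f x a : isdiff D f x a ->
  forall e, 0 < e -> \forall y \near x, D y -> `|f y - f x| <= e.
Proof.
move=> fa e e0; set L := 1 + \sum_i `|a i|.
have L0 : 0 < L by rewrite ltr_wpDr // sumr_ge0.
have := near_distW x (divr_gt0 e0 L0).
apply: filterS2 (isdiff_lip fa) => y fy ye Dy.
by apply: le_trans (fy Dy) _; rewrite mulrC -ler_pdivlMr.
Qed.

Lemma isdiff_cst D x (c : R) : D x -> isdiff D (fun=> c) x (fun=> 0).
Proof.
move=> Dx; split=> // e e0; apply: near_all => y _.
by rewrite big1 ?subrr ?subr0 ?normr0 ?mulr_ge0 ?(ltW e0) // => i _; rewrite mulr0.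
Qed.

Lemma isdiff_coord D x j : D x -> isdiff D (fun y => y 0 j) x (fun i => (i == j)%:R).
Proof.
move=> Dx; split=> // e e0; apply: near_all => y _.
rewrite (bigD1 j) //= eqxx mulr1 big1 => [|i /negbTE ->]; last by rewrite mulr0.
by rewrite !mxE addr0 subrr normr0 mulr_ge0 // ltW.
Qed.

Lemma isdiffD D f g x a b : isdiff D f x a -> isdiff D g x b ->
  isdiff D (fun y => f y + g y) x (fun i => a i + b i).
Proof.
move=> [Dx fa] [_ gb]; split=> // e e0.
have e2 : 0 < e / 2 by rewrite divr_gt0.
apply: filterS2 (fa _ e2) (gb _ e2) => y + + Dy => /(_ Dy) fy /(_ Dy) gy.
under eq_bigr do rewrite mulrDr; rewrite big_split /=.
rewrite (_ : _ - _ = (f y - f x - \sum_i (y - x) 0 i * a i)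
   + (g y - g x - \sum_i (y - x) 0 i * b i)); last by ring.
apply: le_trans (ler_normD _ _) _.
by rewrite (splitr e) mulrDl lerD.
Qed.

Lemma isdiffM D f g x a b : isdiff D f x a -> isdiff D g x b ->
  isdiff D (fun y => f y * g y) x (fun i => a i * g x + f x * b i).
Proof.
move=> fa gb; have [Dx fa'] := fa; have [_ gb'] := gb; split=> // e e0.
(* [K] dominates [g x], [f x] and the local Lipschitz constant [A] of [f], so each of the three
   error terms of the product costs at most a third of [e]. *)
set A := 1 + \sum_i `|a i|; set K := 1 + `|g x| + `|f x| + A.
have A0 : 0 < A by rewrite ltr_wpDr // sumr_ge0.
have K0 : 0 < K by rewrite /K; have := normr_ge0 (g x); have := normr_ge0 (f x); lra.
have e3 : 0 < e / (3 * K) by rewrite divr_gt0 // mulr_gt0.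
near=> y => Dy.
have fy : `|f y - f x - \sum_i (y - x) 0 i * a i| <= e / (3 * K) * `|y - x|.
  by move: Dy; near: y; exact: fa'.
have gy : `|g y - g x - \sum_i (y - x) 0 i * b i| <= e / (3 * K) * `|y - x|.
  by move: Dy; near: y; exact: gb'.
have ly : `|f y - f x| <= A * `|y - x|.
  by move: Dy; near: y; exact: isdiff_lip.
have cy : `|g y - g x| <= e / (3 * K).
  by move: Dy; near: y; exact: isdiff_cont gb _ e3.
rewrite (_ : \sum_i _ = (\sum_i (y - x) 0 i * a i) * g x
    + f x * \sum_i (y - x) 0 i * b i); last first.
  rewrite mulr_suml mulr_sumr -big_split /=; apply: eq_bigr => i _; ring.
rewrite (_ : _ - _ = (f y - f x - \sum_i (y - x) 0 i * a i) * g x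
  + f x * (g y - g x - \sum_i (y - x) 0 i * b i)
  + (f y - f x) * (g y - g x)); last by ring.
apply: le_trans (ler_normD _ _) _; rewrite (normrM (f y - f x)).
apply: le_trans (lerD (ler_normD _ _) (lexx _)) _; rewrite !normrM.
set d := `|y - x| in fy gy ly *; have d0 : 0 <= d by exact: normr_ge0.
have key t : t <= K -> e / (3 * K) * t <= e / 3.
  move=> tK; rewrite invfM mulrA -mulrA ler_piMr ?divr_ge0 ?(ltW e0) //.
  by rewrite mulrC ler_pdivrMr // mul1r.
have t1 : e / (3 * K) * d * `|g x| <= e / 3 * d.
  by rewrite mulrAC ler_wpM2r // key // /K; have := normr_ge0 (f x); lra.
have t2 : `|f x| * (e / (3 * K) * d) <= e / 3 * d.
  rewrite mulrA [`|f x| * _]mulrC ler_wpM2r // key // /K.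
  by have := normr_ge0 (g x); lra.
have t3 : A * d * (e / (3 * K)) <= e / 3 * d.
  rewrite mulrAC [A * _]mulrC ler_wpM2r // key // /K.
  by have := normr_ge0 (f x); have := normr_ge0 (g x); lra.
have e1 : `|f y - f x - \sum_i (y - x) 0 i * a i| * `|g x| <= e / 3 * d.
  by apply: le_trans t1; rewrite ler_wpM2r.
have e2 : `|f x| * `|g y - g x - \sum_i (y - x) 0 i * b i| <= e / 3 * d.
  by apply: le_trans t2; rewrite ler_wpM2l.
have e4 : `|f y - f x| * `|g y - g x| <= e / 3 * d.
  apply: le_trans t3; apply: ler_pM => //.
by apply: le_trans (lerD (lerD e1 e2) e4) _; rewrite -!mulrDl; lra.
Unshelve. all: by end_near. Qed.

Lemma isdiff_sum (I : Type) (r : seq I) D (f : I -> 'rV[R]_n -> R) x a :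
  D x -> (forall i, isdiff D (f i) x (a i)) ->
  isdiff D (fun y => \sum_(i <- r) f i y) x (fun j => \sum_(i <- r) a i j).
Proof.
move=> Dx fa; elim: r => [|i r IH].
  apply: isdiff_near (eq_isdiff _ (isdiff_cst 0 Dx)).
    by apply: near_all => y _; rewrite big_nil.
  by move=> j; rewrite big_nil.
apply: isdiff_near (eq_isdiff _ (isdiffD (fa i) IH)).
  by apply: near_all => y _; rewrite big_cons.
by move=> j; rewrite big_cons.
Qed.

Lemma isdiffZ D f x a (c : R) : isdiff D f x a ->
  isdiff D (fun y => c * f y) x (fun i => c * a i).
Proof.
move=> fa; apply: eq_isdiff (isdiffM (isdiff_cst c (isdiff_dom fa)) fa) => i.
by rewrite mul0r add0r.
Qed.

Lemma near_padmP D i x (P : set R) :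
  (\forall h \near within (padm D i x) (0 : R)^', P h) <->
  exists2 d : R, 0 < d & forall h, h != 0 -> `|h| < d ->
    D (x + h *: delta_mx 0 i) -> P h.
Proof.
have [near1 near2] :=
  near_distP (0 : R) (fun h => h != 0 -> padm D i x h -> P h).
split=> [/near1[d d0 dP]|[d d0 dP]].
  by exists d => // h h0 hd Dh; apply: dP => //; rewrite subr0.
by apply: near2; exists d => // h; rewrite subr0 => hd h0 Dh; apply: dP.
Qed.

Lemma isdiff_cvg D f x a i : isdiff D f x a ->
  pquot i f x h @[h --> within (padm D i x) 0^'] --> a i.
Proof.
move=> [Dx fa]; apply/cvgrPdist_le => e e0.
have /near_distP[d d0 dP] := fa e e0.
apply/near_padmP; exists d => // h h0 hd Dh.
have h0' : `|h| != 0 by rewrite normr_eq0.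
have nh : `|x + h *: delta_mx 0 i - x| = `|h|.
  by rewrite addrAC subrr add0r normrZ rV_norm_delta mulr1.
have := dP (x + h *: delta_mx 0 i); rewrite nh => /(_ hd Dh).
rewrite (bigD1 i) //= big1 => [|j /negbTE ji]; last first.
  by rewrite addrAC subrr add0r mxE delta_coord ji mulr0 mul0r.
rewrite addr0 [x + _]addrC addrK mxE delta_coord eqxx mulr1 [_ + x]addrC => H.
rewrite /pquot distrC -(ler_pM2l (_ : 0 < `|h|)) ?lt_neqAle ?normr_ge0 ?andbT 1?eq_sym //.
rewrite -normrM mulrBr mulrA mulfV //.
by rewrite mul1r [leRHS]mulrC.
Qed.

(** [box_up] provides arbitrarily small positive increments even at a boundary point, so the limit
    that defines [pd] is unique there. *)
Lemma padm_proper D i x : boxlike D -> D x ->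
  ProperFilter (within (padm D i x) (0 : R)^').
Proof.
move=> bD Dx; apply: Build_ProperFilter_ex => A.
move=> /near_padmP[d d0 dP].
exists (d / 2); have d2 : 0 < d / 2 by rewrite divr_gt0.
apply: dP; last by apply: box_up => //; exact: ltW.
- by rewrite gt_eqF.
- by rewrite gtr0_norm // ltr_pdivrMr // ltr_pMr // ltr1n.
Qed.

Lemma isdiff_pd D f x a i : boxlike D -> isdiff D f x a -> pd D i f x = a i.
Proof.
move=> bD fa; have := padm_proper i bD (isdiff_dom fa).
by move=> FF; apply: cvg_lim => //; exact: isdiff_cvg.
Qed.

Lemma isdiff_pderivable D f x a i : isdiff D f x a -> pderivable D i f x.
Proof. by move=> fa; apply/cvgP/(isdiff_cvg (i := i) fa). Qed.

End Domains.

(** * Mean value theorem and differentiability of C^1 functions *)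

Section MeanValue.
Context {R : realType} {n : nat}.
Implicit Types (D S : set 'rV[R]_n) (f : 'rV[R]_n -> R) (x : 'rV[R]_n).

Lemma within_near (S : set 'rV[R]_n) f x : {within S, continuous f} -> S x ->
  forall e, 0 < e -> \forall y \near x, S y -> `|f y - f x| <= e.
Proof.
move=> /subspace_continuousP fc Sx e e0.
have /cvgrPdist_le/(_ e e0) := fc x Sx; rewrite near_withinE.
by apply: filterS => y H Sy; rewrite distrC; exact: H.
Qed.

Lemma pd_cvg D i f x : pderivable D i f x -> forall e, 0 < e ->
  exists2 d : R, 0 < d & forall h, h != 0 -> `|h| < d ->
    D (x + h *: delta_mx 0 i) -> `|pquot i f x h - pd D i f x| <= e.
Proof.
move=> df e e0.
have FF : Filter (within (padm D i x) (0 : R)^') by exact: within_filter.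
have /cvgrPdist_le/(_ e e0)/near_padmP[d d0 dP] :
  pquot i f x h @[h --> within (padm D i x) 0^'] --> pd D i f x by exact: df.
by exists d => // h h0 hd Dh; rewrite distrC; exact: dP.
Qed.

Definition between (a b c : R) := a <= c <= b \/ b <= c <= a.

Lemma between0 (h t : R) : between 0 h t -> `|t| <= `|h|.
Proof.
by case=> /andP[t0 th]; [rewrite !ger0_norm // (le_trans t0)
  | rewrite !ler0_norm // ?lerN2 // (le_trans t0)].
Qed.

Lemma line_cont D S i f x (a b : R) : {within S, continuous f} ->
  (forall t, a <= t <= b -> S (x + t *: delta_mx 0 i)) ->
  {within `[a, b], continuous (fun t => f (x + t *: delta_mx 0 i))}.
Proof.
move=> fc Sab; apply/subspace_continuousP => t /=; rewrite in_itv /= => tab.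
apply/cvgrPdist_le => e e0; rewrite near_withinE.
have /near_distP[d d0 dP] := within_near fc (Sab t tab) e0.
apply: filterS (near_dist t d0) => s st; rewrite /= in_itv /= => sab.
rewrite distrC; apply: dP; last exact: Sab.
by rewrite opprD addrACA subrr add0r -scalerBl normrZ rV_norm_delta mulr1.
Qed.

Lemma line_derive D S i f x (a b t : R) : ropen D S ->
  (forall y, S y -> pderivable D i f y) ->
  (forall t, a <= t <= b -> S (x + t *: delta_mx 0 i)) -> a < t < b ->
  is_derive t (1 : R) (fun t => f (x + t *: delta_mx 0 i))
    (pd D i f (x + t *: delta_mx 0 i)).
Proof.
move=> [SD _] df Sab /andP[at_ tb].
have tab : a <= t <= b by rewrite !ltW.
suff H : h^-1 *: (((fun t => f (x + t *: delta_mx 0 i)) \o shift t) (h *: (1 : R))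
    - f (x + t *: delta_mx 0 i)) @[h --> (0 : R)^']
    --> pd D i f (x + t *: delta_mx 0 i).
  by apply: DeriveDef; [exact/cvgP/H | exact: cvg_lim H].
apply/cvgrPdist_le => e e0.
have [d d0 dP] := pd_cvg (df _ (Sab t tab)) e0.
pose d' := Num.min d (Num.min (t - a) (b - t)).
have d'0 : 0 < d' by rewrite !lt_min d0 !subr_gt0 at_ tb.
rewrite /dnbhs near_withinE; apply: filterS (near_dist (0 : R) d'0) => h.
rewrite subr0 !lt_min => /and3P[hd ha hb] h0.
have hE : x + (h + t) *: delta_mx 0 i = x + t *: delta_mx 0 i + h *: delta_mx 0 i.
  by rewrite scalerDl -addrA [h *: _ + _]addrC.
have := dP h h0 hd; rewrite -hE distrC => H.
rewrite /= [h *: 1]mulr1 /GRing.scale /= {1}/pquot -hE in H *; apply: H.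
apply/SD/Sab; move: ha hb; rewrite !ltr_norml => /andP[? ?] /andP[? ?].
by apply/andP; split; lra.
Qed.

Lemma mvt_coord D S i f x (h : R) : ropen D S -> {within S, continuous f} ->
  (forall y, S y -> pderivable D i f y) ->
  (forall t, between 0 h t -> S (x + t *: delta_mx 0 i)) ->
  exists2 t, between 0 h t &
    f (x + h *: delta_mx 0 i) - f x = h * pd D i f (x + t *: delta_mx 0 i).
Proof.
move=> oS fc df Sh.
have main a b : a <= b -> (forall t, a <= t <= b -> S (x + t *: delta_mx 0 i)) ->
    exists2 t, a <= t <= b & f (x + b *: delta_mx 0 i) - f (x + a *: delta_mx 0 i)
      = pd D i f (x + t *: delta_mx 0 i) * (b - a).
  move=> ab Sab; pose g t := f (x + t *: delta_mx 0 i).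
  have := @MVT_segment R g (fun t => pd D i f (x + t *: delta_mx 0 i)) a b ab.
  case=> [t||t tab ->]; last by exists t => //; rewrite in_itv in tab.
    by rewrite in_itv /= => tab; exact: (line_derive oS df Sab).
  exact: (line_cont D fc).
have [h0|h0] := leP 0 h.
  have [t th] := main 0 h h0 (fun t th => Sh t (or_introl th)).
  by rewrite scale0r addr0 subr0 mulrC => E; exists t => //; left.
have [t th] := main h 0 (ltW h0) (fun t th => Sh t (or_intror th)).
rewrite scale0r addr0 sub0r => E; exists t; first by right.
by rewrite -opprB E mulrN opprK mulrC.
Qed.

Lemma Cr_cont D r S f : Cr D r S f -> {within S, continuous f}.
Proof. by case: r => [|r] // []. Qed.

(** Going from [x] to [y] one coordinate at a time reduces the claim to [mvt_coord]; [box_mid] keeps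
    the intermediate corners and segments inside [D]. *)
Lemma Cr1_isdiff D S f x : boxlike D -> ropen D S -> Cr D 1 S f -> S x ->
  isdiff D f x (fun i => pd D i f x).
Proof.
move=> bD oS [fc f1] Sx; have [SD oSx] := oS; have Dx := SD _ Sx.
(* There are [n] coordinate steps; dividing by [n.+1] also covers [n = 0]. *)
split=> // e e0; have en : 0 < e / n.+1%:R by rewrite divr_gt0.
have near_pd : \forall y \near x, D y -> S y /\
    forall i, `|pd D i f y - pd D i f x| <= e / n.+1%:R.
  have H i := within_near (f1 i).2 Sx en.
  have {}H : \forall y \near x, forall i, S y ->
    `|pd D i f y - pd D i f x| <= e / n.+1%:R by exact: near_forall.
  apply: filterS2 (oSx x Sx) H => y Sy Hy Dy; split=> [|i]; first exact: Sy.
  by apply: Hy; exact: Sy.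
have /near_distP[d d0 dP] := near_pd.
apply/near_distP; exists d => // y yd Dy.
(* [z k] has the first [k] coordinates of [y] and the remaining ones of [x], so the sequence runs
   from [x] to [y]. *)
pose z k : 'rV[R]_n := \row_j (if (j < k)%N then y 0 j else x 0 j).
have zx (t : 'rV[R]_n) : (forall j, between (x 0 j) (y 0 j) (t 0 j)) ->
    D t /\ `|t - x| <= `|y - x|.
  move=> bt; split; first exact: (box_mid bD Dx Dy bt).
  apply: rV_norm_le => // j; apply: le_trans (rV_norm_coord _ j).
  rewrite !mxE; have := bt j; rewrite /between => -[] /andP[? ?].
    by rewrite !ger0_norm ?subr_ge0 ?lerB // (le_trans _ (_ : t 0 j <= _)).
  by rewrite !ler0_norm ?subr_le0 ?lerN2 ?lerB // (le_trans (_ : _ <= t 0 j)).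
have zS k : z k.+1 = z k + \sum_(i | val i == k) (y 0 i - x 0 i) *: delta_mx 0 i.
  apply/rowP => j; rewrite !mxE summxE ltnS leq_eqVlt.
  have [jk|jk] := eqVneq (val j) k.
    rewrite ltn_neqAle jk eqxx /= (bigD1 j) ?jk //= big1 => [|i /andP[ik ij]].
      by rewrite mxE delta_coord eqxx mulr1 addr0 addrC subrK.
    by rewrite mxE delta_coord eq_sym (negbTE ij) mulr0.
  rewrite big1 ?addr0 // => i /eqP ik; rewrite mxE delta_coord.
  by rewrite (_ : j == i = false) ?mulr0 //; apply/negbTE; apply: contraNneq jk => ->; exact/eqP.
have zS' (i : 'I_n) : z i.+1 = z i + (y 0 i - x 0 i) *: delta_mx 0 i.
  by rewrite zS (big_pred1 i) // => j; rewrite -val_eqE.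
have zi (i : 'I_n) t : between 0 (y 0 i - x 0 i) t -> forall j,
    between (x 0 j) (y 0 j) ((z i + t *: delta_mx 0 i) 0 j).
  move=> bt j; rewrite !mxE eqxx /=; have [->|ji] := eqVneq j i.
    by rewrite ltnn mulr1; move: bt; rewrite /between => -[] /andP[? ?]; [left|right]; apply/andP; split; lra.
  rewrite mulr0 addr0; case: ifP => _; rewrite /between.
    by have [?|?] := leP (x 0 j) (y 0 j); [left|right]; rewrite lexx ?andbT // ltW.
  by have [?|?] := leP (x 0 j) (y 0 j); [left|right]; rewrite lexx //= ltW.
have step (i : 'I_n) : `|f (z i.+1) - f (z i) - (y - x) 0 i * pd D i f x|
     <= e / n.+1%:R * `|y - x|.
  have Sz t : between 0 (y 0 i - x 0 i) t -> S (z i + t *: delta_mx 0 i).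
    move=> t0; have [Dt tx] := zx _ (zi i t t0).
    by have [] := dP _ (le_lt_trans tx yd) Dt.
  have [t t0 E] := mvt_coord oS fc (f1 i).1 Sz.
  rewrite zS' E !mxE -mulrBr normrM mulrC.
  have [Dt tx] := zx _ (zi i t t0).
  have [_ Ht] := dP _ (le_lt_trans tx yd) Dt.
  apply: ler_pM => //.
  by have := rV_norm_coord (y - x) i; rewrite !mxE.
have -> : f y - f x = \sum_(i < n) (f (z i.+1) - f (z i)) :> R.
  rewrite -(big_mkord xpredT (fun i => f (z i.+1) - f (z i))) telescope_sumr //.
  by congr (f _ - f _); apply/rowP => j; rewrite mxE ?ltn_ord.
rewrite -sumrB; apply: le_trans (ler_norm_sum _ _ _) _.
apply: le_trans (ler_sum _ (fun i _ => step i)) _.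
rewrite sumr_const card_ord -mulrnAl ler_wpM2r // -mulr_natr mulrAC.
by rewrite ler_pdivrMr // ler_pM2l // ler_nat.
Qed.

End MeanValue.

(** * Chain rule *)

Section ChainRule.
Context {R : realType} {n d : nat}.

Lemma isdiff_comp (D : set 'rV[R]_n) (E : set 'rV[R]_d)
    (c : 'rV[R]_n -> 'rV[R]_d) (f : 'rV[R]_d -> R) x (J : 'I_n -> 'I_d -> R) b :
  D x -> (forall j, isdiff D (fun y => c y 0 j) x (J^~ j)) ->
  (\forall y \near x, D y -> E (c y)) -> isdiff E f (c x) b ->
  isdiff D (f \o c) x (fun i => \sum_j J i j * b j).
Proof.
move=> Dx cJ cE [_ fb]; split=> // e e0.
pose L := \sum_j (1 + \sum_i `|J i j|); pose B := \sum_j `|b j|.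
have L0 : 0 <= L by apply: sumr_ge0 => j _; rewrite addr_ge0 ?sumr_ge0.
have B0 : 0 <= B by apply: sumr_ge0.
have e1 : 0 < e / (2 * (1 + L)) by rewrite divr_gt0 ?mulr_gt0 ?ltr_wpDr.
have e2 : 0 < e / (2 * (1 + B)) by rewrite divr_gt0 ?mulr_gt0 ?ltr_wpDr.
have key K : 0 <= K -> e / (2 * (1 + K)) * K <= e / 2.
  move=> K0; rewrite invfM mulrA -mulrA ler_piMr ?divr_ge0 ?(ltW e0) //.
  by rewrite mulrC ler_pdivrMr ?ltr_wpDr // mul1r lerDr.
have /near_distP[dl dl0 dlP] := fb _ e1.
have clip : \forall y \near x, D y -> `|c y - c x| <= L * `|y - x|.
  have H : \forall y \near x, forall j, D y ->
      `|c y 0 j - c x 0 j| <= (1 + \sum_i `|J i j|) * `|y - x|.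
    by apply: near_forall => j; exact: isdiff_lip (cJ j).
  apply: filterS H => y Hy Dy; apply: le_trans (rV_norm_sum _) _.
  by rewrite mulr_suml ler_sum // => j _; rewrite !mxE; exact: Hy.
have cdiff : \forall y \near x, forall j, D y ->
    `|c y 0 j - c x 0 j - \sum_i (y - x) 0 i * J i j|
      <= e / (2 * (1 + B)) * `|y - x|.
  by apply: near_forall => j; exact: (cJ j).2.
have yn : \forall y \near x, `|y - x| < dl / (1 + L).
  by apply: near_dist; rewrite divr_gt0 // ltr_wpDr.
near=> y => Dy.
have yl : `|c y - c x| <= L * `|y - x| by move: Dy; near: y.
have ydl : `|c y - c x| < dl.
  apply: le_lt_trans yl _; have : `|y - x| < dl / (1 + L) by near: y.
  rewrite ltr_pdivlMr ?ltr_wpDr // => H; apply: le_lt_trans H.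
  by rewrite mulrC ler_wpM2l // lerDr.
have Ey : E (c y) by move: Dy; near: y.
have H1 := dlP _ ydl Ey.
have H2 j : `|c y 0 j - c x 0 j - \sum_i (y - x) 0 i * J i j|
      <= e / (2 * (1 + B)) * `|y - x|.
  by move: Dy; apply: (near cdiff y).
rewrite (_ : _ - _ = (f (c y) - f (c x) - \sum_j (c y - c x) 0 j * b j)
  + \sum_j (c y 0 j - c x 0 j - \sum_i (y - x) 0 i * J i j) * b j); last first.
  have -> : \sum_i (y - x) 0 i * (\sum_j J i j * b j)
      = \sum_j (\sum_i (y - x) 0 i * J i j) * b j.
    under eq_bigr do rewrite mulr_sumr.
    rewrite exchange_big /=; apply: eq_bigr => j _; rewrite mulr_suml.
    by apply: eq_bigr => i _; rewrite mulrA.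
  have -> : \sum_j (c y 0 j - c x 0 j - \sum_i (y - x) 0 i * J i j) * b j
      = \sum_j (c y - c x) 0 j * b j - \sum_j (\sum_i (y - x) 0 i * J i j) * b j.
    by rewrite -sumrB; apply: eq_bigr => j _; rewrite !mxE mulrBl.
  by rewrite /=; ring.
apply: le_trans (ler_normD _ _) _; rewrite [e in leRHS]splitr mulrDl lerD //.
  apply: le_trans H1 _; apply: le_trans (ler_wpM2l (ltW e1) yl) _.
  by rewrite mulrA ler_wpM2r // key.
apply: le_trans (ler_norm_sum _ _ _) _.
apply: le_trans (_ : \sum_j e / (2 * (1 + B)) * `|y - x| * `|b j| <= _).
  by apply: ler_sum => j _; rewrite normrM ler_wpM2r.
by rewrite -mulr_sumr mulrAC ler_wpM2r // key.
Unshelve. all: by end_near. Qed.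

End ChainRule.

(** * Symmetry of second derivatives up to the boundary *)

Section Schwarz.
Context {R : realType} {n : nat}.
Implicit Types (D S : set 'rV[R]_n) (f : 'rV[R]_n -> R) (x : 'rV[R]_n).

Lemma isdiff_within D S f : S `<=` D ->
  (forall y, S y -> exists a, isdiff D f y a) -> {within S, continuous f}.
Proof.
move=> SD fd; apply/subspace_continuousP => y Sy; apply/cvgrPdist_le => e e0.
have [a fa] := fd y Sy.
rewrite near_withinE; apply: filterS (isdiff_cont fa e0) => z fz Sz.
by rewrite distrC; exact/fz/SD.
Qed.

Lemma near_translate (P : set 'rV[R]_n) x (v : 'rV[R]_n) :
  (\forall y \near x + v, P y) -> \forall y \near x, P (y + v).
Proof.
move=> /near_distP[d d0 dP]; apply/near_distP; exists d => // y yd.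
by apply: dP; rewrite opprD addrACA subrr addr0.
Qed.

Lemma isdiff_translate D f x (v : 'rV[R]_n) a : D x ->
  (forall y, D y -> D (y + v)) ->
  isdiff D f (x + v) a -> isdiff D (fun y => f (y + v)) x a.
Proof.
move=> Dx Dv [_ fa]; split=> // e e0.
apply: filterS (near_translate (fa e e0)) => y fy Dy.
have -> : y - x = y + v - (x + v) by rewrite opprD addrACA subrr addr0.
exact/fy/Dv.
Qed.

Lemma Cr_pd_isdiff D S f r i x : boxlike D -> ropen D S -> Cr D r.+2 S f ->
  S x -> isdiff D (pd D i f) x (fun j => pd D j (pd D i f) x).
Proof.
move=> bD oS [_ f1] Sx; apply: Cr1_isdiff (oS) _ Sx => //.
have := (f1 i).2; case: r {f1} => [|r] // [fc f2]; split=> // j.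
by split; [exact: (f2 j).1 | exact: (@Cr_cont _ _ D r.+1 S _ (f2 j).2)].
Qed.

(** The mean value theorem is used twice: in direction [i] for the difference of [f] in direction
    [j], then in direction [j] for [pd D i f]. All increments are nonnegative, so the points stay in
    [D] even at the boundary. *)
Lemma second_difference D S f i j x (h : R) : boxlike D -> ropen D S ->
  Cr D 2 S f -> 0 < h -> D x ->
  (forall y, D y -> `|y - x| <= h + h -> S y) ->
  exists2 y, D y /\ `|y - x| <= h + h &
    f (x + h *: delta_mx 0 i + h *: delta_mx 0 j) - f (x + h *: delta_mx 0 i)
    - f (x + h *: delta_mx 0 j) + f x = h * (h * pd D j (pd D i f) y).
Proof.
move=> bD oS f2 h0 Dx xS; have [SD oSx] := oS.
have [fc f1] := f2; have h0' := ltW h0.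
have fd y : S y -> isdiff D f y (fun i => pd D i f y).
  move=> Sy; apply: (Cr1_isdiff bD oS _ Sy); split=> // l.
  by split; [exact: (f1 l).1 | exact: (@Cr_cont _ _ D 1 S _ (f1 l).2)].
pose v : 'rV[R]_n := h *: delta_mx 0 j.
have Dv y : D y -> D (y + v) by move=> Dy; apply: box_up.
pose S' := [set y | S y /\ S (y + v)].
have oS' : ropen D S'.
  split=> [y [/SD //]|y [Sy Syv]].
  apply: filterS2 (oSx _ Sy) (near_translate (oSx _ Syv)) => z Sz Szv Dz.
  by split; [exact: Sz | exact/Szv/Dv].
pose g y := f (y + v) + -1 * f y.
have gd y : S' y -> isdiff D g y
    (fun i => pd D i f (y + v) + -1 * pd D i f y).
  move=> [Sy Syv]; apply: isdiffD; last exact/isdiffZ/fd.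
  by apply: isdiff_translate => //; [exact: SD | exact: fd].
have S'D : S' `<=` D by move=> y [/SD].
have nle (s t : R) : between 0 h s -> between 0 h t ->
    `|x + s *: delta_mx 0 i + t *: delta_mx 0 j - x| <= h + h.
  move=> /between0 sh /between0 th; rewrite (gtr0_norm h0) in sh th.
  rewrite -[x + _ + _]addrA [x + _]addrC addrK.
  apply: le_trans (ler_normD _ _) _.
  by rewrite !normrZ !rV_norm_delta !mulr1 lerD.
have ge0 (s : R) : between 0 h s -> 0 <= s.
  by case=> /andP[] // H1 H2; apply: le_trans H1.
have Dst (s t : R) : between 0 h s -> between 0 h t ->
    D (x + s *: delta_mx 0 i + t *: delta_mx 0 j).
  by move=> /ge0 ? /ge0 ?; apply: box_up => //; exact: box_up.
have Sst (s t : R) : between 0 h s -> between 0 h t ->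
    S (x + s *: delta_mx 0 i + t *: delta_mx 0 j).
  by move=> ? ?; apply: xS; [exact: Dst | exact: nle].
have b0 : between 0 h 0 by left; rewrite lexx.
have bh : between 0 h h by left; rewrite lexx h0'.
have [s s0 Es] : exists2 s, between 0 h s &
    g (x + h *: delta_mx 0 i) - g x = h * pd D i g (x + s *: delta_mx 0 i).
  apply: (mvt_coord oS'); first by apply: isdiff_within S'D _ => y /gd; eexists; eassumption.
    by move=> y S'y; exact: isdiff_pderivable (gd y S'y).
  move=> s s0; split; last exact: Sst.
  by have := Sst s 0 s0 b0; rewrite scale0r addr0.
have [t t0 Et] : exists2 t, between 0 h t &
    pd D i f (x + s *: delta_mx 0 i + h *: delta_mx 0 j)
    - pd D i f (x + s *: delta_mx 0 i)
    = h * pd D j (pd D i f) (x + s *: delta_mx 0 i + t *: delta_mx 0 j).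
  apply: (mvt_coord oS); first by case: (f1 i).2.
    by case: (f1 i).2 => _ /(_ j)[].
  by move=> t t0; exact: Sst.
exists (x + s *: delta_mx 0 i + t *: delta_mx 0 j); first by split; auto.
have S's : S' (x + s *: delta_mx 0 i).
  split; last exact: Sst.
  by have := Sst s 0 s0 b0; rewrite scale0r addr0.
rewrite -Et; move: Es; rewrite (isdiff_pd i bD (gd _ S's)) mulN1r => <-.
by rewrite /g /v; ring.
Qed.

(** The second difference is symmetric in the two directions, so the two mixed derivatives agree at
    suitable points [y] and [z] near [x]. By continuity a gap [e] at [x] would be at most
    [e / 3 + e / 3]. *)
Lemma schwarz D S f i j x : boxlike D -> ropen D S -> Cr D 2 S f -> S x ->
  pd D i (pd D j f) x = pd D j (pd D i f) x.
Proof.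
move=> bD oS f2 Sx; have [SD oSx] := oS; have Dx := SD _ Sx.
have fpd k l : {within S, continuous (pd D k (pd D l f))}.
  by have [_ /(_ l)[_ [_ /(_ k)[]]]] := f2.
have tog (a b c e : R) : a - b - c + e = a - c - b + e by ring.
have third (a : R) : 0 < a -> a <= a / 3 + a / 3 -> False by lra.
apply/eqP; rewrite -subr_eq0 -normr_eq0; apply/negP => /negP neq.
set e := `|_| in neq; have e0 : 0 < e by rewrite lt_neqAle eq_sym neq normr_ge0.
have e3 : 0 < e / 3 by rewrite divr_gt0.
have := near_and (oSx x Sx)
  (near_and (within_near (fpd i j) Sx e3) (within_near (fpd j i) Sx e3)).
move=> /near_distP[d d0 dP].
have h0 : 0 < d / 4 by rewrite divr_gt0.
have hd : d / 4 + d / 4 < d by lra.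
have xS y : D y -> `|y - x| <= d / 4 + d / 4 -> S y.
  by move=> Dy yd; have [+ _] := dP y (le_lt_trans yd hd); exact.
have [y [Dy yd] Ey] := second_difference i j bD oS f2 h0 Dx xS.
have C : x + d / 4 *: delta_mx 0 j + d / 4 *: delta_mx 0 i
  = x + d / 4 *: delta_mx 0 i + d / 4 *: delta_mx 0 j by exact: addrAC.
have [z [Dz zd]] := second_difference j i bD oS f2 h0 Dx xS; rewrite C => Ez.
have [_ [_ Hy]] := dP y (le_lt_trans yd hd).
have [_ [Hz _]] := dP z (le_lt_trans zd hd).
have {}Hy := Hy (xS y Dy yd); have {}Hz := Hz (xS z Dz zd).
have E : pd D j (pd D i f) y = pd D i (pd D j f) z.
  apply: (mulfI (lt0r_neq0 h0)); apply: (mulfI (lt0r_neq0 h0)).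
  exact: (etrans (esym Ey) (etrans (tog _ _ _ _) Ez)).
apply: (third e e0).
rewrite E in Hy; rewrite distrC in Hz.
apply: le_trans (lerD Hz Hy); rewrite {1}/e.
apply: le_trans (ler_normD _ _).
by rewrite subrKA.
Qed.

Lemma Cr_isdiff D S f r x : boxlike D -> ropen D S -> Cr D r.+1 S f -> S x ->
  isdiff D f x (fun i => pd D i f x).
Proof.
move=> bD oS [fc f1] Sx; apply: (Cr1_isdiff bD oS _ Sx); split=> // i.
by split; [exact: (f1 i).1 | exact (Cr_cont (f1 i).2)].
Qed.

End Schwarz.

(** * Local boundedness *)

Section LocallyBounded.
Context {R : realType} {n : nat}.
Implicit Types (D S : set 'rV[R]_n) (f : 'rV[R]_n -> R) (x : 'rV[R]_n).

(** The maximum principle asks no more of the coefficients than bounds, so continuity of the inverse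
    metric and of the drift is never tracked. *)
Definition locbdd D x f :=
  exists C : R, \forall y \near x, D y -> `|f y| <= C.

Lemma locbdd_near D x f g :
  (\forall y \near x, D y -> f y = g y) -> locbdd D x f -> locbdd D x g.
Proof.
move=> fg [C fC]; exists C; apply: filterS2 fg fC => y fgy fy Dy.
by rewrite -fgy //; exact: fy.
Qed.

Lemma locbdd_cst D x (c : R) : locbdd D x (fun=> c).
Proof. by exists `|c|; apply: near_all. Qed.

Lemma locbddD D x f g : locbdd D x f -> locbdd D x g ->
  locbdd D x (fun y => f y + g y).
Proof.
move=> [A fA] [B gB]; exists (A + B); apply: filterS2 fA gB => y fy gy Dy.
by apply: le_trans (ler_normD _ _) _; rewrite lerD //; [exact: fy | exact: gy].
Qed.

Lemma locbddM D x f g : locbdd D x f -> locbdd D x g ->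
  locbdd D x (fun y => f y * g y).
Proof.
move=> [A fA] [B gB]; exists (A * B); apply: filterS2 fA gB => y fy gy Dy.
by rewrite normrM ler_pM //; [exact: fy | exact: gy].
Qed.

Lemma locbddN D x f : locbdd D x f -> locbdd D x (fun y => - f y).
Proof. by move=> [A fA]; exists A; apply: filterS fA => y; rewrite normrN. Qed.

Lemma locbdd_sum (I : Type) (r : seq I) (P : pred I) D x (f : I -> 'rV[R]_n -> R) :
  (forall i, locbdd D x (f i)) -> locbdd D x (fun y => \sum_(i <- r | P i) f i y).
Proof.
move=> fb; elim: r => [|i r IH].
  by apply: locbdd_near (locbdd_cst D x 0); apply: near_all => y _; rewrite big_nil.
case Pi : (P i); last first.
  by apply: locbdd_near IH; apply: near_all => y _; rewrite big_cons Pi.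
apply: locbdd_near (locbddD (fb i) IH); apply: near_all => y _.
by rewrite big_cons Pi.
Qed.

Lemma locbdd_within D S x f : ropen D S -> S x -> {within S, continuous f} ->
  locbdd D x f.
Proof.
move=> [_ oS] Sx fc; exists (`|f x| + 1).
apply: filterS2 (oS x Sx) (within_near fc Sx ltr01) => y Sy fy Dy.
rewrite -lerBlDl; apply: le_trans (fy (Sy Dy)); exact: lerB_dist.
Qed.

Lemma locbdd_isdiff D f x a : isdiff D f x a -> locbdd D x f.
Proof.
move=> fa; exists (`|f x| + 1); apply: filterS (isdiff_cont fa ltr01) => y fy Dy.
by rewrite -lerBlDl; apply: le_trans (fy Dy); exact: lerB_dist.
Qed.

End LocallyBounded.

(** * Second-order conditions along lines *)

Section Lines.
Context {R : realType} {n : nat}.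
Implicit Types (D S : set 'rV[R]_n) (f : 'rV[R]_n -> R) (x v : 'rV[R]_n).

Lemma isdiff_line D f x v a (t : R) : (\forall y \near x + t *: v, D y) ->
  isdiff D f (x + t *: v) a ->
  is_derive t (1 : R) (fun s => f (x + s *: v)) (\sum_i v 0 i * a i).
Proof.
move=> Dn [_ fa].
suff H : h^-1 *: (((fun s => f (x + s *: v)) \o shift t) (h *: (1 : R))
    - f (x + t *: v)) @[h --> (0 : R)^'] --> \sum_i v 0 i * a i.
  by apply: DeriveDef; [exact/cvgP/H | exact: cvg_lim H].
apply/cvgrPdist_le => e e0.
have v1 : 0 < 1 + `|v| by rewrite ltr_wpDr.
have ev : 0 < e / (1 + `|v|) by rewrite divr_gt0.
have /near_distP[d d0 dP] := near_and Dn (fa _ ev).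
have dv : 0 < d / (1 + `|v|) by rewrite divr_gt0.
rewrite /dnbhs near_withinE; apply: filterS (near_dist (0 : R) dv) => h.
rewrite subr0 => hd h0; have {}h0 : h != 0 by exact: h0.
have hE : x + (h + t) *: v - (x + t *: v) = h *: v.
  by rewrite opprD addrACA subrr add0r -scalerBl addrK.
have hv : `|h *: v| < d.
  rewrite normrZ; apply: le_lt_trans (_ : `|h| * (1 + `|v|) < d).
    by rewrite ler_wpM2l // lerDr.
  by rewrite -ltr_pdivlMr.
have := dP (x + (h + t) *: v); rewrite hE => /(_ hv)[Dy /(_ Dy)].
rewrite normrZ => H; rewrite /= [h *: 1]mulr1 distrC.
have h0' : 0 < `|h| by rewrite normr_gt0.
rewrite -(ler_pM2l h0') -normrM mulrBr /GRing.scale /= mulrA mulfV // mul1r.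
have -> : h * (\sum_i v 0 i * a i) = \sum_i (h *: v) 0 i * a i.
  by rewrite mulr_sumr; apply: eq_bigr => i _; rewrite mxE mulrA.
apply: le_trans H _; rewrite mulrCA ler_wpM2l // mulrAC -mulrA ler_piMr ?(ltW e0) //.
by rewrite ler_pdivrMr // mul1r lerDr.
Qed.

(** Weaker than C^2: second derivatives exist but need not be continuous. They are only ever
    evaluated at single points. *)
Definition twice_diff D S f := forall x, S x ->
  isdiff D f x (fun i => pd D i f x) /\
  forall i, isdiff D (pd D i f) x (fun j => pd D j (pd D i f) x).

Lemma twice_diff_cont D S f : S `<=` D -> twice_diff D S f ->
  {within S, continuous f}.
Proof. by move=> SD f2; apply: isdiff_within SD _ => x /f2[fx _]; eexists; exact: fx. Qed.

(* Along a line the barrier of [hopf] below is a quartic polynomial. *)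
Lemma touching_quartic (f df : R -> R) (c p q r s : R) :
  (\forall t \near 0, is_derive t (1 : R) f (df t)) ->
  is_derive 0 (1 : R) df c ->
  (\forall t \near 0, f t <= f 0 + p * t + q * t ^+ 2 + r * t ^+ 3 + s * t ^+ 4) ->
  df 0 = p /\ c <= 2 * q.
Proof.
move=> fd dfd fle.
(* [P] has a local maximum at 0, so [dP 0 = 0], which is the first claim. *)
pose P t := f t - (p * t + q * t ^+ 2 + r * t ^+ 3 + s * t ^+ 4).
pose dP t := df t - (p + 2 * q * t + 3 * r * t ^+ 2 + 4 * s * t ^+ 3).
have Pd : \forall t \near 0, is_derive t (1 : R) P (dP t).
  apply: filterS fd => t fdt; apply: is_deriveB.
  apply: is_derive_eq; rewrite /GRing.scale /=; ring.
have dPd : is_derive (0 : R) (1 : R) dP (c - 2 * q).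
  apply: is_deriveB; apply: is_derive_eq; rewrite /GRing.scale /=; ring.
have P0 : P 0 = f 0 by rewrite /P; ring.
have /near_distP[d d0 H] := near_and Pd fle.
have Pmax t : `|t| < d -> P t <= P 0.
  by move=> td; have [] := H t; rewrite ?subr0 // P0 /P => _; lra.
have dP0 : dP 0 = 0.
  have dd : - d < d by lra.
  have Pdd t : t \in `]- d, d[ -> derivable P t 1.
    by rewrite in_itv /= -ltr_norml -[t in `|t|]subr0 => /H[[]].
  have := derive1_at_max (ltW dd) Pdd (c := 0); rewrite in_itv /= oppr_lt0 d0.
  move=> /(_ isT) H0.
  have : is_derive (0 : R) (1 : R) P 0.
    by apply: H0 => t; rewrite in_itv /= -ltr_norml; exact: Pmax.
  have [] := H 0; rewrite ?subrr ?normr0 // => -[_ P1] _ [_ P2].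
  by rewrite -P1 P2.
have dfp : df 0 = p by move: dP0; rewrite /dP; lra.
(* If [c > 2 * q], then [dP] is positive just to the right of 0, and by the mean value theorem [P]
   exceeds its maximum there. *)
split=> //; rewrite leNgt; apply/negP => cq.
have c0 : 0 < c - 2 * q by rewrite subr_gt0.
have [dd1 dd2] := dPd.
have : h^-1 *: ((dP \o shift 0) (h *: (1 : R)) - dP 0) @[h --> (0 : R)^'] --> c - 2 * q.
  by rewrite -dd2; exact: dd1.
move=> /cvgrPdist_lt/(_ _ c0); rewrite /dnbhs near_withinE => /near_distP[d1 d10 H1].
pose t := Num.min d d1 / 2.
have t0 : 0 < t by rewrite divr_gt0 // lt_min d0.
have m0 : 0 < Num.min d d1 by rewrite lt_min d0.
have md : Num.min d d1 <= d by rewrite ge_min lexx.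
have md1 : Num.min d d1 <= d1 by rewrite ge_min lexx orbT.
have td : t < d by rewrite /t; lra.
have td1 : t < d1 by rewrite /t; lra.
have dPpos s' : 0 < s' -> s' <= t -> 0 < dP s'.
  move=> s0 st; have := H1 s'; rewrite subr0 gtr0_norm // => /(_ (le_lt_trans st td1)).
  have -> : (s' != 0) by rewrite gt_eqF.
  move=> /(_ isT); rewrite /= [s' *: 1]mulr1 addr0 dP0 subr0 ltr_norml => /andP[_].
  rewrite ltrBlDl -[ltLHS]add0r ltrD2r /GRing.scale /= pmulr_rgt0 ?invr_gt0 //.
have [s' s'0 E] : exists2 s', s' \in `]0, t[ & P t - P 0 = dP s' * (t - 0).
  apply: MVT => // s'; rewrite ?in_itv /=.
    move=> /andP[s0 st]; have [|//] := H s'.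
    by rewrite subr0 gtr0_norm // (lt_trans st).
  apply: derivable_within_continuous => s1; rewrite in_itv /= => /andP[s0 st].
  by have [|[]//] := H s1; rewrite subr0 ger0_norm // (le_lt_trans st).
move: s'0; rewrite in_itv /= => /andP[s0 st].
have := Pmax t; rewrite gtr0_norm // => /(_ td); rewrite -subr_le0 E subr0.
by rewrite pmulr_lle0 // leNgt dPpos // ltW.
Qed.

(** [touching_quartic] on the line through [x] with direction [v]. The polynomial bound stands for a
    barrier, which thus never has to be differentiated in several variables. *)
Lemma second_order_test D S f x v (p q r s : R) : boxlike D -> ropen D S ->
  twice_diff D S f -> S x -> (\forall y \near x, D y) ->
  (\forall t \near (0 : R),
    f (x + t *: v) <= f x + p * t + q * t ^+ 2 + r * t ^+ 3 + s * t ^+ 4) ->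
  \sum_i v 0 i * pd D i f x = p /\
  \sum_i \sum_j v 0 i * v 0 j * pd D j (pd D i f) x <= 2 * q.
Proof.
move=> bD oS f2 Sx Dn fle; have [SD oSx] := oS.
have near_line P : (\forall y \near x, P y) -> \forall t \near (0 : R), P (x + t *: v).
  move=> /near_distP[d d0 dP].
  have v1 : 0 < 1 + `|v| by rewrite ltr_wpDr.
  apply/near_distP; exists (d / (1 + `|v|)); first by rewrite divr_gt0.
  move=> t; rewrite subr0 ltr_pdivlMr // => td; apply: dP.
  rewrite addrC addKr normrZ; apply: le_lt_trans td.
  by rewrite ler_wpM2l // lerDr.
pose df t := \sum_i v 0 i * pd D i f (x + t *: v).
have x0 : x + 0 *: v = x by rewrite scale0r addr0.
have [] := @touching_quartic (fun t => f (x + t *: v)) df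
  (\sum_i v 0 i * \sum_j v 0 j * pd D j (pd D i f) x) p q r s.
- have SDn : \forall y \near x, S y /\ \forall z \near y, D z.
    move: Dn (oSx x Sx) => /near_distP[d d0 dP] H.
    apply: filterS2 (near_dist x d0) H => y yd Sy.
    have Dn : \forall z \near y, D z.
      apply/near_distP; exists (d - `|y - x|); first by rewrite subr_gt0.
      move=> z; rewrite ltrBrDr => zd; apply: dP.
      by rewrite -(subrKA y); apply: le_lt_trans (ler_normD _ _) zd.
    by split => //; apply: Sy; exact: dP.
  apply: filterS (near_line _ SDn) => t [St Dt].
  by apply: isdiff_line Dt (f2 _ St).1.
- have -> : df = \sum_i (fun t => v 0 i * pd D i f (x + t *: v)).
    by apply/funext => t; rewrite fct_sumE.
  apply: is_derive_sum => i; apply: is_deriveZ.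
  apply: (@isdiff_line D); rewrite x0 //; exact: (f2 _ Sx).2.
- by apply: filterS fle => t; rewrite /= x0.
rewrite /df x0 => <- c2; split=> //; apply: le_trans c2.
rewrite le_eqVlt; apply/orP; left; apply/eqP; apply: eq_bigr => i _.
by rewrite mulr_sumr; apply: eq_bigr => j _; rewrite mulrA.
Qed.

End Lines.
(** * Quadratic forms *)

Section QuadraticForms.
Context {R : realType}.

Definition posdef n (a : 'M[R]_n) := forall v, v != 0 -> 0 < inner a v v.

Lemma innerE n (a : 'M[R]_n) u v :
  inner a u v = \sum_i \sum_j u 0 i * a i j * v 0 j.
Proof.
rewrite /inner mxE exchange_big /=; apply: eq_bigr => j _.
by rewrite !mxE mulr_suml; apply: eq_bigr => i _.
Qed.

Lemma inner_sym n (a : 'M[R]_n) u v : a^T = a -> inner a u v = inner a v u.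
Proof.
move=> aT; rewrite /inner -[in RHS]aT -[u in RHS]trmxK -mulmxA.
by rewrite -[v in RHS]trmxK -!trmx_mul trmxK [RHS]mxE mulmxA.
Qed.

Lemma innerDl n (a : 'M[R]_n) u v w : inner a (u + v) w = inner a u w + inner a v w.
Proof. by rewrite /inner !mulmxDl mxE. Qed.

Lemma innerDr n (a : 'M[R]_n) u v w : inner a w (u + v) = inner a w u + inner a w v.
Proof. by rewrite /inner linearD mulmxDr mxE. Qed.

Lemma innerZl n (a : 'M[R]_n) c u v : inner a (c *: u) v = c * inner a u v.
Proof. by rewrite /inner -!scalemxAl mxE. Qed.

Lemma innerZr n (a : 'M[R]_n) c u v : inner a u (c *: v) = c * inner a u v.
Proof. by rewrite /inner linearZ /= -scalemxAr mxE. Qed.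

Lemma inner_suml n (a : 'M[R]_n) I (r : seq I) (u : I -> 'rV_n) v :
  inner a (\sum_(i <- r) u i) v = \sum_(i <- r) inner a (u i) v.
Proof. by rewrite /inner !mulmx_suml summxE. Qed.

Lemma inner_sumr n (a : 'M[R]_n) I (r : seq I) (u : I -> 'rV_n) v :
  inner a v (\sum_(i <- r) u i) = \sum_(i <- r) inner a v (u i).
Proof. by rewrite /inner linear_sum mulmx_sumr summxE. Qed.

Lemma inner_delta n (a : 'M[R]_n) i j :
  inner a (delta_mx 0 i) (delta_mx 0 j) = a i j.
Proof. by rewrite /inner -rowE trmx_delta -colE !mxE. Qed.

Lemma posdef_ge0 n (a : 'M[R]_n) v : posdef a -> 0 <= inner a v v.
Proof.
move=> pa; have [->|/pa/ltW //] := eqVneq v 0.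
by rewrite /inner !mul0mx mxE.
Qed.

Lemma posdef_unit n (a : 'M[R]_n) : posdef a -> a \in unitmx.
Proof.
move=> pa; rewrite -row_free_unit -kermx_eq0; apply/eqP/row_matrixP => i.
rewrite row0; apply/eqP; case: eqVneq => // k0; have := pa _ k0.
by rewrite /inner -row_mul mulmx_ker row0 mul0mx mxE ltxx.
Qed.

Lemma posdef_inv n (a : 'M[R]_n) : a^T = a -> posdef a -> posdef (invmx a).
Proof.
move=> aT pa v v0; have ua := posdef_unit pa.
have w0 : v *m invmx a != 0.
  by apply: contraNneq v0 => w0; rewrite -(mulmxKV ua v) w0 mul0mx.
have := pa _ w0; rewrite /inner mulmxKV // trmx_mul trmx_inv aT.
by rewrite mulmxA.
Qed.

Lemma inner_block n m (a : 'M[R]_n) b c (d : 'M[R]_m) x y x' y' :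
  inner (block_mx a b c d) (row_mx x y) (row_mx x' y') =
  (x *m a *m x'^T) 0 0 + (y *m c *m x'^T) 0 0
  + ((x *m b *m y'^T) 0 0 + (y *m d *m y'^T) 0 0).
Proof.
by rewrite /inner tr_row_mx mul_row_block mul_row_col !mulmxDl !mxE.
Qed.

(** Induction on the size through the Schur complement [b - al^-1 *: (v^T *m v)]. It is positive
    definite because its value at [w] is that of [a] at [(c, w)], where [c] minimises the form over
    the first coordinate. *)
Lemma cholesky n (a : 'M[R]_n) : a^T = a -> posdef a ->
  exists q : 'M[R]_n, a = q^T *m q.
Proof.
elim: n a => [|n IH] a aT pa; first by exists 0; apply/matrixP => -[].
pose al := a 0 0; pose v : 'rV[R]_n := ursubmx (a : 'M[R]_(1 + n)).
pose b : 'M[R]_n := drsubmx (a : 'M[R]_(1 + n)).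
have aE : a = block_mx al%:M v v^T b :> 'M[R]_(1 + n).
  apply: (etrans (esym (@submxK R 1 n 1 n a))); congr block_mx.
    by rewrite [LHS]mx11_scalar !mxE lshift0.
  by rewrite /v trmx_ursub aT.
have bT : b^T = b by rewrite /b trmx_drsub aT.
have al0 : 0 < al.
  have e0 : delta_mx 0 0 != 0 :> 'rV[R]_n.+1.
    by apply/eqP => /rowP/(_ 0)/eqP; rewrite !mxE !eqxx oner_eq0.
  by have := pa _ e0; rewrite inner_delta.
have [q Eq] : exists q : 'M[R]_n, b - al^-1 *: (v^T *m v) = q^T *m q.
  apply: IH => [|w w0].
    by rewrite linearB linearZ /= trmx_mul trmxK bT.
  pose g := (w *m v^T) 0 0; pose c := - (al^-1 * g).
  have cw0 : row_mx c%:M w != 0 :> 'rV[R]_(1 + n).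
    apply: contraNneq w0 => /eqP; rewrite -[0]row_mx0 => /eqP/eq_row_mx[_ ->] //.
  have := pa _ cw0; rewrite aE.
  rewrite (@inner_block 1 n) tr_scalar_mx -!scalar_mxM mul_mx_scalar.
  rewrite mul_scalar_mx -scalemxAl.
  have vw : (v *m w^T) 0 0 = g.
    by rewrite -[v *m w^T]trmxK mxE trmx_mul trmxK.
  have -> : inner (b - al^-1 *: (v^T *m v)) w w = inner b w w - al^-1 * (g * g).
    rewrite /inner mulmxBr mulmxBl mxE -scalemxAr -scalemxAl; congr (_ + _).
    rewrite 2!mxE; congr (- (_ * _)).
    by rewrite mulmxA -[_ *m v *m _]mulmxA [LHS]mxE big_ord1 vw.
  rewrite -/(inner b w w) => H; apply: lt_le_trans H _.
  have -> : (c *: (v *m w^T)) 0 0 = c * g by rewrite mxE vw.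
  have -> : (c *: (w *m v^T)) 0 0 = c * g by rewrite mxE.
  rewrite mxE eqxx mulr1n le_eqVlt; apply/orP; left; apply/eqP.
  by rewrite /c; field; rewrite gt_eqF.
pose r := Num.sqrt al; have r0 : r != 0 by rewrite gt_eqF // sqrtr_gt0.
have rr : r * r = al by rewrite -expr2 sqr_sqrtr // ltW.
exists (block_mx r%:M (r^-1 *: v) 0 q : 'M[R]_(1 + n)).
apply: (etrans aE).
rewrite (@tr_block_mx R 1 n 1 n) (@mulmx_block R 1 n 1 n 1 n) !trmx0 !mul0mx !mulmx0 !addr0 tr_scalar_mx.
rewrite -scalar_mxM rr mul_scalar_mx scalerA mulfV // scale1r.
rewrite linearZ /= mul_mx_scalar scalerA mulfV // scale1r.
rewrite -scalemxAl -scalemxAr scalerA -invfM rr -Eq addrC subrK //.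
Qed.

(** With [a = q^T *m q], cyclicity turns the trace into the sum of the values of [b] at the rows of
    [q]. This contracts a nonpositive Hessian with elliptic coefficients. *)
Lemma mxtrace_mul_le0 n (a b : 'M[R]_n) : a^T = a -> posdef a ->
  (forall v, inner b v v <= 0) -> \tr (a *m b) <= 0.
Proof.
move=> aT pa bn; have [q ->] := cholesky aT pa.
rewrite -mulmxA mxtrace_mulC; apply: sumr_le0 => i _.
have -> : (q *m b *m q^T) i i = inner b (row i q) (row i q); last exact: bn.
rewrite innerE exchange_big !mxE; apply: eq_bigr => j _ /=.
by rewrite !mxE mulr_suml; apply: eq_bigr => l _; rewrite !mxE.
Qed.

(** Squared Euclidean norm: the barrier needs round balls, and the library norm is the sup norm. *)
Definition sq n (v : 'rV[R]_n) := \sum_i v 0 i ^+ 2.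

Lemma sq_ge0 n (v : 'rV[R]_n) : 0 <= sq v.
Proof. by apply: sumr_ge0 => i _; exact: sqr_ge0. Qed.

Lemma sq_eq0 n (v : 'rV[R]_n) : sq v = 0 -> v = 0.
Proof.
move=> /eqP; rewrite psumr_eq0 => [/allP v0|i _]; last exact: sqr_ge0.
apply/rowP => i; rewrite mxE; apply/eqP; rewrite -sqrf_eq0.
exact: (v0 i (mem_index_enum i)).
Qed.

Lemma sqE n (v : 'rV[R]_n) : sq v = (v *m v^T) 0 0.
Proof. by rewrite mxE; apply: eq_bigr => i _; rewrite mxE expr2. Qed.

Lemma norm_le_sq n (v : 'rV[R]_n) (r : R) : 0 <= r -> sq v <= r ^+ 2 -> `|v| <= r.
Proof.
move=> r0 vr; apply: rV_norm_le => // i.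
rewrite -(ler_pXn2r (n := 2)) ?nnegrE // real_normK ?num_real //.
apply: le_trans vr; rewrite /sq (bigD1 i) //= lerDl.
by apply: sumr_ge0 => j _; exact: sqr_ge0.
Qed.

Lemma sq_le_norm n (v : 'rV[R]_n) : sq v <= n%:R * `|v| ^+ 2.
Proof.
rewrite /sq; apply: le_trans (_ : \sum_(i < n) `|v| ^+ 2 <= _).
  apply: ler_sum => i _; rewrite -real_normK ?num_real //.
  by rewrite lerXn2r ?nnegrE // rV_norm_coord.
by rewrite sumr_const card_ord mulr_natl.
Qed.

(** Positivity of [h] at [v - L *: (v *m invmx h)] reads [h(v,v) - 2 L |v|^2 + L^2 h^{-1}(v,v) >=
    0]; bound the first term by [L |v|^2] and divide. An upper bound on the metric thus gives the
    ellipticity of its inverse. *)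
Lemma inner_inv_ge n (h : 'M[R]_n) (L : R) v : h^T = h -> posdef h -> 0 < L ->
  (forall w, inner h w w <= L * sq w) -> L^-1 * sq v <= inner (invmx h) v v.
Proof.
move=> hT ph L0 hL; have uh := posdef_unit ph.
have := posdef_ge0 (v - L *: (v *m invmx h)) ph.
have e1 : inner h (v *m invmx h) v = sq v by rewrite /inner mulmxKV // sqE.
have e2 : inner h (v *m invmx h) (v *m invmx h) = inner (invmx h) v v.
  by rewrite /inner mulmxKV // trmx_mul trmx_inv hT mulmxA.
rewrite -scaleNr innerDl !innerDr !innerZl !innerZr.
rewrite (inner_sym v (_ *m _)) // e1 e2 => H.
rewrite mulrC ler_pdivrMr //; have H2 := hL v.
have H3 : L * sq v <= L * (inner (invmx h) v v * L) by nra.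
by rewrite ler_pM2l in H3.
Qed.

End QuadraticForms.
(** * Hopf lemma and strong maximum principle *)

Section MaximumPrinciple.
Context {R : realType} {n : nat}.
Implicit Types (D S : set 'rV[R]_n) (u : 'rV[R]_n -> R) (x y v w z : 'rV[R]_n).

Definition dot v w := \sum_i v 0 i * w 0 i.

Lemma innerDm (a b : 'M[R]_n) v w : inner (a + b) v w = inner a v w + inner b v w.
Proof. by rewrite /inner mulmxDr mulmxDl mxE. Qed.

Lemma innerBm (a b : 'M[R]_n) v w : inner (a - b) v w = inner a v w - inner b v w.
Proof. by rewrite /inner mulmxBr mulmxBl !mxE. Qed.

Lemma innerZm (c : R) (a : 'M[R]_n) v w : inner (c *: a) v w = c * inner a v w.
Proof. by rewrite /inner -scalemxAr -scalemxAl mxE. Qed.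

Lemma dotE v w : dot v w = (v *m w^T) 0 0.
Proof. by rewrite mxE; apply: eq_bigr => i _; rewrite mxE. Qed.

Lemma dotC v w : dot v w = dot w v.
Proof. by apply: eq_bigr => i _; rewrite mulrC. Qed.

Lemma inner_scalar (c : R) v : inner c%:M v v = c * sq v.
Proof. by rewrite /inner mul_mx_scalar -scalemxAl mxE sqE. Qed.

Lemma inner_outer v w : inner (v^T *m v) w w = dot w v ^+ 2.
Proof.
rewrite /inner mulmxA -[_ *m v *m _]mulmxA mxE big_ord1 -!dotE expr2.
by rewrite [dot v w]dotC.
Qed.

Lemma sq_line v w (t : R) : sq (v + t *: w) = sq v + 2 * t * dot w v + t ^+ 2 * sq w.
Proof.
rewrite /sq /dot !mulr_sumr -!big_split /=; apply: eq_bigr => i _.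
by rewrite !mxE; ring.
Qed.

(** From [|v_i| <= 1 + v_i^2], which avoids square roots. *)
Lemma dot_abs_le (b : 'I_n -> R) v (c : R) : (forall i, `|b i| <= c) ->
  `|\sum_i b i * v 0 i| <= c * (n%:R + sq v).
Proof.
move=> bc; apply: le_trans (ler_norm_sum _ _ _) _.
have -> : n%:R + sq v = \sum_i (1 + v 0 i ^+ 2).
  by rewrite big_split /= sumr_const card_ord.
rewrite mulr_sumr ler_sum // => i _; rewrite normrM ler_pM //.
rewrite -real_normK ?num_real //; nra.
Qed.

Lemma isdiff_sq D x y : D x -> exists a, isdiff D (fun z => sq (z - y)) x a.
Proof.
move=> Dx; pose c i z : R := z 0 i + - y 0 i.
have cd i : isdiff D (c i) x (fun j => (j == i)%:R + 0).
  by apply: isdiffD; [exact: isdiff_coord | exact: isdiff_cst].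
eexists; apply: isdiff_near; last first.
  apply: (isdiff_sum (index_enum 'I_n) Dx) => i; exact: isdiffM (cd i) (cd i).
by apply: near_all => z _; apply: eq_bigr => i _; rewrite !mxE expr2.
Qed.

Lemma closed_near (A : set 'rV[R]_n) :
  (forall x, ~ A x -> \forall z \near x, ~ A z) -> closed A.
Proof.
move=> An x Ax; apply: contrapT => /An nA.
by have [z []] := Ax _ nA.
Qed.

(** The case [c = d] covers spheres and [c = 0] closed balls. *)
Lemma compact_annulus y (c d : R) : compact [set x | c <= sq (x - y) <= d].
Proof.
apply: bounded_closed_compact.
  exists (`|y| + (1 + `|d|)); split; first exact: num_real.
  move=> M yM x /= /andP[_ xd]; apply: le_trans (ltW yM).
  rewrite -[x in `|x|](subrK y) addrC; apply: le_trans (ler_normD _ _) _.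
  rewrite lerD2l; apply: norm_le_sq; first by rewrite addr_ge0.
  apply: le_trans xd _; have := ler_norm d; have := normr_ge0 d; nra.
apply: closed_near => x /negP; rewrite negb_and -!ltNge.
have [a /isdiff_cont sc] := @isdiff_sq setT x y I.
move=> /orP[] xc.
  have /sc : 0 < (c - sq (x - y)) / 2 by rewrite divr_gt0 // subr_gt0.
  apply: filterS => z /(_ I) H /andP[zc _]; move: H; rewrite ler_norml => /andP[? ?]; lra.
have /sc : 0 < (sq (x - y) - d) / 2 by rewrite divr_gt0 // subr_gt0.
apply: filterS => z /(_ I) H /andP[_ zd]; move: H; rewrite ler_norml => /andP[? ?]; lra.
Qed.

(** The coefficients may change with [x] without any regularity; only the ellipticity constant [th],
    the trace bound [ta] and the drift bound [be] are meant to be uniform. *)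
Definition subsol D u (th ta be : R) x :=
  exists (a : 'M[R]_n) (b : 'I_n -> R), [/\ a^T = a /\ posdef a,
    forall v, th * sq v <= inner a v v, \tr a <= ta, forall i, `|b i| <= be
    & 0 <= \sum_i \sum_j a i j * pd D j (pd D i u) x + \sum_i b i * pd D i u x].

(* With [s = rho - |x - y|^2], the barrier [s + C s^2] is a strict subsolution in
   a thin shell inside the sphere [s = 0], for [C] large. *)
Lemma hopf D S u y x1 (rho M th ta be : R) :
  boxlike D -> ropen D S -> twice_diff D S u ->
  0 < th -> 0 <= ta -> 0 <= be -> 0 < rho ->
  (forall x, sq (x - y) <= rho -> S x /\ u x <= M) ->
  (forall x, sq (x - y) < rho -> [/\ nbhs x D, subsol D u th ta be x & u x < M]) ->
  sq (x1 - y) = rho -> u x1 = M ->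
  dot (y - x1) (\row_i pd D i u x1) < 0.
Proof.
move=> bD oS u2 th0 ta0 be0 rho0 clS opn x1y ux1; have [SD oSx] := oS.
(* Bounds the trace plus the drift term [\sum_i b i * d 0 i] for [d = x - y] in the ball. *)
pose K := ta + be * (n%:R + rho).
have K0 : 0 <= K by rewrite addr_ge0 // mulr_ge0 // addr_ge0 // ltW.
(* The first summand makes the shell thin, [1 / C <= rho / 2], so that [|x - y|^2 >= rho / 2] in it;
   the second makes ellipticity win over [K], in the form [Cth]. *)
pose C := 2 / rho + (3 * K + 1) / (2 * th * rho).
have C1 : 0 < 2 / rho by rewrite divr_gt0.
have C2 : 0 < (3 * K + 1) / (2 * th * rho).
  by rewrite divr_gt0 ?mulr_gt0 // ltr_wpDl // mulr_ge0.
have C0 : 0 < C by rewrite addr_gt0.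
have Cth : 3 * K < 2 * C * th * rho.
  have -> : 2 * C * th * rho = 4 * th + (3 * K + 1).
    by rewrite /C; field; rewrite !gt_eqF.
  by rewrite ltr_pwDl ?mulr_gt0 // lerDl.
pose sg := C^-1; have sg0 : 0 < sg by rewrite invr_gt0.
have Csg : C * sg = 1 by rewrite mulfV // gt_eqF.
have sgr : 2 * sg <= rho.
  have : 2 / rho <= C by rewrite lerDl ltW.
  rewrite ler_pdivrMr // => H.
  by rewrite -(ler_pM2l C0) mulrCA Csg mulr1.
pose s x := rho - sq (x - y).
pose v x := s x + C * s x * s x.
pose W := [set x | rho - sg <= sq (x - y) <= rho].
pose G := [set x | rho - sg <= sq (x - y) <= rho - sg].
have WS x : W x -> S x by move=> /= /andP[_ /clS[]].
have WD : W `<=` D by move=> x /WS /SD.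
have ud x : W x -> isdiff D u x (fun i => pd D i u x).
  by move=> Wx; exact: (u2 x (WS x Wx)).1.
have [m0 m0M Gm] : exists2 m0, m0 < M & forall x, G x -> u x <= m0.
  have GW : G `<=` W.
    move=> x /andP[H1 H2]; rewrite /W /= H1; apply: le_trans H2 _.
    by rewrite gerBl ltW.
  have [G0|/set0P/negP/negPn/eqP G0] := pselect (G !=set0); last first.
    by exists (M - 1); [rewrite gtrBl | move=> x; rewrite G0].
  have [] := EVT_max_rV (f := u) G0 (@compact_annulus y _ _).
    apply: (@isdiff_within _ _ D); first by move=> x /GW /WD.
    by move=> x /GW /ud; exists (fun i => pd D i u x).
  move=> g; rewrite inE => Gg gmax; exists (u g).
    have [] := opn g; last by [].
    by move: Gg => /= /andP[_ H]; apply: le_lt_trans H _; rewrite gtrBl.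
  by move=> x Gx; apply: gmax; rewrite inE.
(* On the inner sphere [s = sg] and [C * sg = 1], hence [v = 2 * sg]; this [e] is the one with
   [u + e v <= M] there. *)
have [e e0 e2] : exists2 e, 0 < e & e * (2 * sg) = M - m0.
  exists ((M - m0) / (2 * sg)); first by rewrite divr_gt0 ?subr_gt0 // mulr_gt0.
  by rewrite mulfVK // gt_eqF // mulr_gt0.
pose zz x := u x + e * v x.
have x1W : W x1 by rewrite /W /= x1y lexx andbT gerBl ltW.
have zc : {within W, continuous zz}.
  apply: (@isdiff_within _ _ D) => // x Wx; have [a sa] := isdiff_sq y (WD x Wx).
  have sd : isdiff D s x (fun i => 0 + -1 * a i).
    apply: isdiff_near (isdiffD (isdiff_cst rho (WD x Wx)) (isdiffZ (-1) sa)).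
    by apply: near_all => w _; rewrite mulN1r.
  eexists; apply: isdiffD (ud x Wx) (isdiffZ e _).
  apply: isdiffD sd (isdiffM (isdiffZ C sd) sd).
(* On the outer sphere [v = 0], on the inner one [e] was adjusted, so a maximum above [M] would lie
   strictly inside the shell. There the second-order test contradicts the inequality satisfied by
   [u]. *)
have zM x : W x -> zz x <= M.
  have [] := EVT_max_rV _ (@compact_annulus y _ _) zc; first by exists x1.
  move=> x2; rewrite inE => W2 zmax Wx.
  apply: le_trans (zmax x _) _; first by rewrite inE.
  rewrite leNgt; apply/negP => zM2.
  have s2 : 0 <= s x2 <= sg by move: W2 => /= /andP[? ?]; rewrite /s; apply/andP; split; lra.
  have [S2 u2M] : S x2 /\ u x2 <= M by apply: clS; move: W2 => /andP[].
  have s2l : 0 < s x2.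
    move: s2 => /andP[]; rewrite le_eqVlt => /orP[/eqP s20|//] _.
    by move: zM2; rewrite /zz /v -s20 mulr0 addr0 mulr0 addr0 ltNge u2M.
  have s2r : s x2 < sg.
    move: s2 => /andP[_]; rewrite le_eqVlt => /orP[/eqP s20|//].
    have : u x2 <= m0 by apply: Gm; rewrite /G /=; apply/andP; move: s20; rewrite /s; split; lra.
    have vE : v x2 = 2 * sg by rewrite /v s20 Csg mul1r; ring.
    by move: zM2; rewrite /zz vE e2; lra.
  have x2b : sq (x2 - y) < rho by move: s2l; rewrite /s subr_gt0.
  pose d := x2 - y; pose ka := 1 + 2 * C * s x2.
  (* Along [x2 + t w] the function [s] drops by [2 t <w,d> + t^2 |w|^2], so the barrier is a quartic
     in [t]; [ka] is the derivative of [s + C s^2] with respect to [s]. *)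
  have test (w : 'rV[R]_n) :
      \sum_i w 0 i * pd D i u x2 = 2 * e * ka * dot w d /\
      \sum_i \sum_j w 0 i * w 0 j * pd D j (pd D i u) x2 <=
        2 * (e * (ka * sq w - 4 * C * dot w d ^+ 2)).
    have [n2 _ _] := opn x2 x2b.
    apply: (second_order_test (r := - (4 * C * e * dot w d * sq w))
      (s := - (C * e * sq w ^+ 2)) bD oS u2 S2 n2).
    have [a /isdiff_cont sc] := @isdiff_sq setT x2 y I.
    have m1 : 0 < Num.min (s x2) (sg - s x2) by rewrite lt_min s2l subr_gt0.
    have /near_distP[d1 d10 dP] := sc _ m1.
    have w1 : 0 < 1 + `|w| by rewrite ltr_wpDr.
    apply/near_distP; exists (d1 / (1 + `|w|)); first by rewrite divr_gt0.
    move=> t; rewrite subr0 ltr_pdivlMr // => td.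
    have Wt : W (x2 + t *: w).
      have /dP : `|x2 + t *: w - x2| < d1.
        rewrite addrC addKr normrZ; apply: le_lt_trans td.
        by rewrite ler_wpM2l // lerDr.
      move=> /(_ I); rewrite ler_norml => /andP[H1 H2]; rewrite /W /=.
      have m2 : Num.min (s x2) (sg - s x2) <= s x2 by rewrite ge_min lexx.
      have m3 : Num.min (s x2) (sg - s x2) <= sg - s x2 by rewrite ge_min lexx orbT.
      by rewrite /s in m2 m3 H1 H2 *; apply/andP; split; lra.
    have := zmax (x2 + t *: w); rewrite inE => /(_ Wt); rewrite /zz.
    have -> : v (x2 + t *: w) = v x2 + ka * (- (2 * t * dot w d + t ^+ 2 * sq w))
        + C * (2 * t * dot w d + t ^+ 2 * sq w) ^+ 2.
      have sE : s (x2 + t *: w) = s x2 - (2 * t * dot w d + t ^+ 2 * sq w).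
        by rewrite /s addrAC sq_line /d; ring.
      by rewrite /v sE /ka; ring.
    rewrite -subr_ge0 => H; rewrite -subr_ge0; apply: le_trans H _.
    by rewrite le_eqVlt; apply/orP; left; apply/eqP; ring.
  have [_ [a [b [[aT pa] ath atr bbe Lu]]] _] := opn x2 x2b.
  (* The Hessian of [u + e v] at [x2]. *)
  pose B : 'M[R]_n := \matrix_(i, j) pd D i (pd D j u) x2
     - (2 * e * ka)%:M + 8 * e * C *: (d^T *m d).
  have Bn w : inner B w w <= 0.
    have [_ H] := test w.
    have -> : inner B w w = \sum_i \sum_j w 0 i * w 0 j * pd D j (pd D i u) x2
        - 2 * e * ka * sq w + 8 * e * C * dot w d ^+ 2.
      rewrite innerDm innerBm innerZm inner_scalar inner_outer; congr (_ - _ + _).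
      rewrite innerE exchange_big /=; apply: eq_bigr => j _.
      by apply: eq_bigr => i _; rewrite mxE; ring.
    by move: H; lra.
  have trB := mxtrace_mul_le0 aT pa Bn.
  have trE : \tr (a *m B) = \sum_i \sum_j a i j * pd D j (pd D i u) x2
      - 2 * e * ka * \tr a + 8 * e * C * inner a d d.
    have trD (p q : 'M[R]_n) : \tr (p - q) = \tr p - \tr q by rewrite raddfB.
    rewrite /B mulmxDr mulmxBr mxtraceD trD; congr (_ - _ + _).
    - apply: eq_bigr => i _; rewrite mxE; apply: eq_bigr => j _.
      by rewrite mxE.
    - by rewrite mul_mx_scalar mxtraceZ.
    - rewrite -scalemxAr mxtraceZ mulmxA mxtrace_mulC mulmxA; congr (_ * _).
      by rewrite /mxtrace big_ord1.
  have [bE _] := test (\row_i b i).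
  have {}bE : \sum_i b i * pd D i u x2 = 2 * e * ka * \sum_i b i * d 0 i.
    rewrite -[RHS]/(_ * dot (\row_i b i) d) in bE *.
    have -> : \sum_i b i * d 0 i = dot (\row_i b i) d.
      by apply: eq_bigr => i _; rewrite mxE.
    by rewrite -bE; apply: eq_bigr => i _; rewrite mxE.
  have := dot_abs_le d bbe; set bd := \sum_i b i * d 0 i in bE * => bdle.
  have dsq : sq d = rho - s x2 by rewrite /s /d; ring.
  have bd1 : bd <= be * (n%:R + rho).
    apply: le_trans (ler_norm _) (le_trans bdle _).
    by rewrite ler_wpM2l // lerD2l dsq gerBl ltW.
  have ad := ath d.
  have ka1 : 1 <= ka by rewrite lerDl !mulr_ge0 // ltW.
  have ka3 : ka <= 3.
    have : C * s x2 <= 1 by rewrite -Csg ler_wpM2l // ltW.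
    by rewrite /ka; lra.
  have sqd : rho <= 2 * sq d by rewrite dsq; lra.
  rewrite bE in Lu; rewrite trE in trB.
  (* Subtracting the trace inequality from the operator inequality removes the Hessian of [u]. What
     remains gives the absurd chain [3 K < 2 C th rho <= 4 C a(d,d) <= ka (tr a + bd) <= 3 K]. *)
  have H1 : 0 <= 2 * e * (ka * (\tr a + bd) - 4 * C * inner a d d) by lra.
  have {}H1 : 4 * C * inner a d d <= ka * (\tr a + bd).
    by rewrite pmulr_rge0 ?mulr_gt0 // subr_ge0 in H1.
  have H2 : ka * (\tr a + bd) <= 3 * K.
    apply: le_trans (_ : ka * K <= _); last by rewrite ler_wpM2r.
    by rewrite ler_wpM2l ?lerD // (le_trans ler01).
  have H3 : 2 * C * th * rho <= 4 * C * inner a d d.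
    have : 4 * C * (th * sq d) <= 4 * C * inner a d d.
      by rewrite ler_wpM2l // mulr_ge0 // ltW.
    apply: le_trans; have : C * th * rho <= C * th * (2 * sq d).
      by rewrite ler_wpM2l // mulr_ge0 // ltW.
    by lra.
  by have := lt_le_trans Cth (le_trans H3 (le_trans H1 H2)); rewrite ltxx.
(* A fraction [t] of the way from [x1] to [y], the bound [u + e v <= M] forces [u] to have dropped
   by at least [e rho t], whereas a nonnegative slope allows a drop of at most half of that. *)
rewrite ltNge; apply/negP => grad0.
have [_ du] := ud x1 x1W.
pose L := 1 + `|y - x1|; have L0 : 0 < L by rewrite ltr_wpDr.
have er : 0 < e * rho / (2 * L) by rewrite divr_gt0 ?mulr_gt0.
have /near_distP[d d0 dP] := du _ er.
(* [t <= 1] gives [s x >= rho * t]; the second bound keeps [x] where the derivative estimate holds,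
   the third keeps it in the shell. *)
pose t := Num.min (Num.min 1 (d / (2 * L))) (sg / (2 * rho)).
have t0 : 0 < t by rewrite /t !lt_min ltr01 !divr_gt0 ?mulr_gt0.
have t1 : t <= 1 by rewrite /t !ge_min lexx.
have td : t <= d / (2 * L) by rewrite /t !ge_min lexx orbT.
have ts : t <= sg / (2 * rho) by rewrite /t !ge_min lexx !orbT.
rewrite ler_pdivlMr ?mulr_gt0 // in td; rewrite ler_pdivlMr ?mulr_gt0 // in ts.
pose x := x1 + t *: (y - x1).
have sx : s x = rho * (2 * t - t ^+ 2).
  rewrite /s /x; have -> : x1 + t *: (y - x1) - y = (1 - t) *: (x1 - y).
    rewrite -[x1 + _ - y]addrAC scalerBl scale1r -[y - x1]opprB scalerN.
    by [].
  have sqZ (c : R) w : sq (c *: w) = c ^+ 2 * sq w.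
    by rewrite /sq mulr_sumr; apply: eq_bigr => i _; rewrite mxE exprMn.
  by rewrite sqZ x1y; ring.
have tt : t ^+ 2 <= t by rewrite expr2 ler_piMl // ltW.
have sx1 : rho * t <= s x by rewrite sx ler_wpM2l ?(ltW rho0) //; lra.
have sx0 : 0 <= s x by apply: le_trans sx1; rewrite mulr_ge0 // ltW.
have sx2 : s x <= sg.
  rewrite sx; apply: le_trans ts; rewrite mulrA [t * 2]mulrC [rho * _]mulrC ler_wpM2r ?(ltW rho0) //.
  by rewrite gerBl sqr_ge0.
have Wx : W x by rewrite /W /=; move: sx0 sx2; rewrite /s => ? ?; apply/andP; split; lra.
have := zM x Wx; rewrite /zz => ux.
have vx : e * (rho * t) <= e * v x.
  rewrite ler_wpM2l ?(ltW e0) //; apply: le_trans sx1 _.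
  by rewrite lerDl !mulr_ge0 // ltW.
have xx1 : `|x - x1| = t * `|y - x1|.
  by rewrite /x addrC addKr normrZ gtr0_norm.
have tL : t * `|y - x1| <= t * L by rewrite ler_wpM2l ?(ltW t0) // lerDr.
have := dP x; rewrite xx1.
have xd : t * `|y - x1| < d.
  apply: le_lt_trans tL _; have : 0 < t * L by rewrite mulr_gt0.
  lra.
move=> /(_ xd (WD x Wx)); rewrite ux1 ler_norml => /andP[H _].
have gE : \sum_i (x - x1) 0 i * pd D i u x1 = t * dot (y - x1) (\row_i pd D i u x1).
  rewrite /dot mulr_sumr; apply: eq_bigr => i _.
  by rewrite /x addrC addKr !mxE mulrA.
rewrite gE in H.
have tg : 0 <= t * dot (y - x1) (\row_i pd D i u x1) by rewrite mulr_ge0 // ltW.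
have eL : e * rho / (2 * L) * (t * `|y - x1|) <= e * (rho * t) / 2.
  apply: le_trans (ler_wpM2l (ltW er) tL) _; rewrite le_eqVlt; apply/orP; left.
  by apply/eqP; field; rewrite gt_eqF.
have : 0 < e * (rho * t) by rewrite !mulr_gt0.
by lra.
Qed.

End MaximumPrinciple.

(** * Strong maximum principle at interior points *)

Section StrongMaximum.
Context {R : realType} {n : nat}.
Implicit Types (D S : set 'rV[R]_n) (u : 'rV[R]_n -> R) (x y v w z p q : 'rV[R]_n).

Lemma near_in_ball x y (d : R) : `|y - x| < d -> \forall z \near y, `|z - x| < d.
Proof.
move=> yd; apply/near_distP; exists (d - `|y - x|); first by rewrite subr_gt0.
move=> z; rewrite ltrBrDr => zd.
by rewrite -(subrKA y); apply: le_lt_trans (ler_normD _ _) zd.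
Qed.

Lemma near_line x v (P : 'rV[R]_n -> Prop) (t : R) :
  (\forall y \near x + t *: v, P y) -> \forall s \near t, P (x + s *: v).
Proof.
move=> /near_distP[d d0 dP].
have v1 : 0 < 1 + `|v| by rewrite ltr_wpDr.
apply/near_distP; exists (d / (1 + `|v|)); first by rewrite divr_gt0.
move=> s; rewrite ltr_pdivlMr // => sd; apply: dP.
rewrite opprD addrACA subrr add0r -scalerBl normrZ; apply: le_lt_trans sd.
by rewrite ler_wpM2l // lerDr.
Qed.

Lemma max_grad0 D S u x v : boxlike D -> ropen D S -> twice_diff D S u -> S x ->
  (\forall y \near x, D y) -> (\forall y \near x, u y <= u x) ->
  \sum_i v 0 i * pd D i u x = 0.
Proof.
move=> bD oS u2 Sx Dn umax.
have [] // := @second_order_test R n D S u x v 0 0 0 0 bD oS u2 Sx Dn.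
have umax' : \forall y \near x + 0 *: v, u y <= u x by rewrite scale0r addr0.
by apply: filterS (near_line umax') => t ut; rewrite !mul0r !addr0.
Qed.

Definition good D S u (M th ta be : R) x :=
  [/\ S x, u x <= M & subsol D u th ta be x].

Lemma closed_level D S u (T : set 'rV[R]_n) (M : R) :
  ropen D S -> {within S, continuous u} -> T `<=` S -> closed T ->
  closed (T `&` [set x | u x = M]).
Proof.
move=> [SD oS] uc TS Tc; apply: closed_near => x nx.
have [Tx|nTx] := pselect (T x); last first.
  have : \forall z \near x, (~` T) z by apply: open_nbhs_nbhs; split=> //; exact: closed_openC.
  by apply: filterS => z nTz [].
have neq : u x != M by apply/eqP => uM; apply: nx.
have e0 : 0 < `|u x - M| / 2 by rewrite divr_gt0 // normr_gt0 subr_eq0.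
apply: filterS (within_near uc (TS x Tx) e0) => z uz [/TS/uz] + uzM.
rewrite uzM distrC => H.
have := e0; rewrite pmulr_lgt0 // => p0.
by move: H; rewrite leNgt ltr_pdivrMr // ltr_pMr // ltr1n.
Qed.

(* Were the level set not a neighbourhood of [x1], a largest ball around some
   nearby point below the level would touch it, against Hopf's lemma. *)
Lemma max_open D S u (M th ta be : R) x1 : boxlike D -> ropen D S ->
  twice_diff D S u -> 0 < th -> 0 <= ta -> 0 <= be ->
  (\forall x \near x1, D x /\ good D S u M th ta be x) ->
  u x1 = M -> \forall x \near x1, u x = M.
Proof.
move=> bD oS u2 th0 ta0 be0 /near_distP[d d0 dP] ux1.
have n2 : 0 < n%:R + 2 :> R by rewrite ltr_wpDl.
(* The Euclidean ball about [y] through [x1] lies within sup-distance [(n + 1) |x1 - y|] of [y]; the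
   distance from [y] to [x1] accounts for the remaining unit. *)
pose d1 := d / (n%:R + 2); have d10 : 0 < d1 by rewrite divr_gt0.
apply/near_distP; exists d1 => // y yd1; apply: contrapT => uyM.
pose r := sq (x1 - y).
have yx : `|x1 - y| < d1 by rewrite distrC.
have ball x : sq (x - y) <= r -> `|x - x1| < d.
  move=> xr; pose rr := (n%:R + 1) * `|x1 - y|.
  have rr0 : 0 <= rr by rewrite mulr_ge0 // addr_ge0.
  have : `|x - y| <= rr.
    apply: norm_le_sq => //; apply: le_trans xr (le_trans (sq_le_norm _) _).
    rewrite /rr exprMn ler_wpM2r ?sqr_ge0 //.
    by have : 0 <= n%:R :> R := ler0n _ _; nra.
  move=> H; rewrite -(subrKA y); apply: le_lt_trans (ler_normD _ _) _.
  rewrite [`|y - x1|]distrC; apply: le_lt_trans (lerD H (lexx _)) _.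
  have -> : rr + `|x1 - y| = `|x1 - y| * (n%:R + 2) by rewrite /rr; ring.
  by rewrite -ltr_pdivlMr.
have G x : sq (x - y) <= r -> good D S u M th ta be x by move=> /ball/dP[].
pose T := [set x | 0 <= sq (x - y) <= r].
have Tc : compact T by exact: compact_annulus.
have TS : T `<=` S by move=> x /andP[_ /G[]].
have [SD oSx] := oS.
have Kc : compact (T `&` [set x | u x = M]).
  apply: subclosed_compact (Tc) _; last by move=> x [].
  apply: (closed_level oS (twice_diff_cont oS.1 u2) TS); apply: compact_closed Tc.
  exact: norm_hausdorff.
(* [x2] is a point of the level set nearest to [y], so [u < M] in the open ball about [y] through
   [x2], while the gradient vanishes at the interior maximum [x2]. *)
have [] := @compact_EVT_min _ R (fun x => sq (x - y)) _ _ Kc.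
- by exists x1; split => //; rewrite /T /= sq_ge0 lexx.
- apply: (@isdiff_within _ _ setT) => // x _.
  exact: (@isdiff_sq _ _ setT).
move=> x2; rewrite inE => -[Tx2 ux2] x2min.
have r2 : sq (x2 - y) <= r by move: Tx2 => /andP[].
have /ball x2d := r2.
have Dn : \forall z \near x2, D z /\ good D S u M th ta be z.
  by apply: filterS (near_in_ball x2d) => z; exact: dP.
have [S2 _ _] := G _ r2.
have rho0 : 0 < sq (x2 - y).
  rewrite lt_neqAle sq_ge0 andbT eq_sym; apply/eqP => /sq_eq0/subr0_eq x2y.
  by apply: uyM; rewrite -x2y.
have small x : sq (x - y) < sq (x2 - y) -> sq (x - y) <= r.
  by move=> H; apply: le_trans (ltW H) r2.
have g0 : dot (y - x2) (\row_i pd D i u x2) = 0.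
  rewrite -(@max_grad0 D S u x2 (y - x2)) //.
  - by apply: eq_bigr => i _; rewrite !mxE.
  - by apply: filterS Dn => z [].
  - by apply: filterS Dn => z [_ [_ H _]]; rewrite ux2.
suff : dot (y - x2) (\row_i pd D i u x2) < 0 by rewrite g0 ltxx.
apply: (@hopf R n D S u y x2 (sq (x2 - y)) M th ta be bD oS u2 th0 ta0 be0 rho0) => //.
- by move=> x H; have [] := G x (le_trans H r2).
- move=> x H; have [_ uxM sub] := G x (small x H); split=> //.
    by apply: filterS (near_in_ball (ball x (small x H))) => z /dP[].
  rewrite lt_neqAle uxM andbT; apply/eqP => uxM'.
  have := x2min x; rewrite inE leNgt H => /(_ _)/negP; apply=> //.
  by split=> //; rewrite /T /= sq_ge0 small.
Qed.

(** The parameters at which [u = M] form a nonempty subset of [0, 1], relatively open by [max_open]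
    and relatively closed by continuity. *)
Lemma max_segment D S u (M th ta be : R) p q : boxlike D -> ropen D S ->
  twice_diff D S u -> 0 < th -> 0 <= ta -> 0 <= be ->
  (forall t, 0 <= t <= 1 -> \forall x \near p + t *: (q - p),
     D x /\ good D S u M th ta be x) ->
  u p = M -> u q = M.
Proof.
move=> bD oS u2 th0 ta0 be0 seg up.
pose l t := p + t *: (q - p); pose A := [set t : R | 0 <= t <= 1 /\ u (l t) = M].
have itv t : `[0, 1]%classic t = (0 <= t <= 1) :> Prop by rewrite /= in_itv.
suff AE : A = `[0, 1]%classic.
  have : A 1 by rewrite AE /= in_itv /= ler01 lexx.
  by move=> [_]; rewrite /l scale1r addrC subrK.
apply: (@segment_connected R 0 1).
- by exists 0; split; rewrite ?lexx ?ler01 // /l scale0r addr0.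
- exists (interior [set t : R | 0 <= t <= 1 -> u (l t) = M]); first exact: open_interior.
  apply/seteqP; split=> t.
    move=> [t01 ut]; split; first by rewrite itv.
    have := max_open bD oS u2 th0 ta0 be0 (seg t t01) ut => /near_line.
    by apply: filterS => s us _.
  move=> [+ /interior_subset]; rewrite itv => t01 H; split=> //; exact: H.
exists (closure A); first exact: closed_closure.
apply/seteqP; split=> t.
  by move=> At; split; [rewrite itv; case: At | exact: subset_closure].
move=> [+ cA]; rewrite itv => t01; split=> //; apply: contrapT => /eqP neq.
have e0 : 0 < `|u (l t) - M| / 2 by rewrite divr_gt0 // normr_gt0 subr_eq0.
have [_ [St _ _]] := nbhs_singleton (seg t t01).
have uc := within_near (twice_diff_cont oS.1 u2) St e0.
have [s [[s01 us]]] := cA _ (filterI (near_line (seg t t01)) (near_line uc)).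
move=> [[_ [Ss _ _]] /(_ Ss)]; rewrite us distrC leNgt ltr_pdivrMr ?ltr_pMr ?ltr1n //.
by rewrite normr_gt0 subr_eq0.
Qed.

End StrongMaximum.

(** * Maximum principle up to the boundary of the half-space *)

Section HalfSpace.
Context {R : realType} {n : nat}.
Local Notation D := (halfspace R n).
Implicit Types (S : set 'rV[R]_n) (u : 'rV[R]_n -> R) (x y v w z p q : 'rV[R]_n).

Lemma halfspace_boxlike : boxlike D.
Proof.
split=> [x y z Dx Dy xyz i i0|x i h Dx h0 j j0].
  have := Dx i i0; have := Dy i i0.
  by case: (xyz i) => /andP[H _] ? ?; apply: le_trans H.
by rewrite !mxE addr_ge0 ?Dx // mulr_ge0 //; case: eqP.
Qed.

Definition hpos x := forall i : 'I_n, val i = 0%N -> 0 < x 0 i.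

Lemma hpos_dom x : hpos x -> D x.
Proof. by move=> px i i0; exact/ltW/px. Qed.

Lemma near_hpos x : hpos x -> \forall z \near x, hpos z.
Proof.
move=> px; apply: near_forall => i.
have [i0|ni0] := eqVneq (val i) 0%N; last first.
  by apply: near_all => z /eqP; rewrite (negbTE ni0).
apply: filterS (near_dist x (px i i0)) => z zx _.
have := le_lt_trans (rV_norm_coord _ i) zx; rewrite !mxE ltr_norml => /andP[H _].
lra.
Qed.

Lemma hpos_segment p q (t : R) : hpos p -> hpos q -> 0 <= t <= 1 ->
  hpos (p + t *: (q - p)).
Proof.
move=> pp pq /andP[t0 t1] i i0; have := pp i i0; have := pq i i0; rewrite !mxE.
move=> H1 H2.
have -> : p 0 i + t * (q 0 i - p 0 i) = (1 - t) * p 0 i + t * q 0 i by ring.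
have [->|tn] := eqVneq t 1; first by rewrite subrr mul0r mul1r add0r.
have tp : 0 < 1 - t by rewrite subr_gt0 lt_neqAle tn.
by rewrite ltr_pwDl ?mulr_gt0 // mulr_ge0 // ltW.
Qed.

(** The differential inequality is imposed only in the interior of the half-space, since [hopf]
    evaluates the operator only inside open balls. *)
Definition subsolution_near S u (M th ta be : R) x0 :=
  \forall x \near x0, D x ->
    [/\ S x, u x <= M & hpos x -> subsol D u th ta be x].

Lemma interior_max S u (M th ta be : R) x0 : ropen D S -> twice_diff D S u ->
  0 < th -> 0 <= ta -> 0 <= be -> subsolution_near S u M th ta be x0 ->
  hpos x0 -> u x0 = M -> \forall x \near x0, u x = M.
Proof.
move=> oS u2 th0 ta0 be0 sub px0; apply: (max_open halfspace_boxlike oS u2 th0 ta0 be0).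
apply: filterS2 sub (near_hpos px0) => x Hx px.
have [Sx uM H] := Hx (hpos_dom px); split; first exact: hpos_dom.
by split=> //; exact: H.
Qed.

(** The interior part of a ball about [x0] is convex, so segments carry the value [M] from one point
    [p] to all of it; continuity then carries it to the boundary points. *)
Lemma halfspace_max S u (M th ta be : R) x0 : ropen D S -> twice_diff D S u ->
  0 < th -> 0 <= ta -> 0 <= be -> subsolution_near S u M th ta be x0 ->
  (forall d : R, 0 < d -> exists p, [/\ `|p - x0| < d, hpos p & u p = M]) ->
  \forall x \near x0, D x -> u x = M.
Proof.
move=> oS u2 th0 ta0 be0 /near_distP[d d0 sub] pM.
have [p [pd pp up]] := pM d d0.
have pos x : `|x - x0| < d -> hpos x -> u x = M.
  move=> xd px; apply: (max_segment halfspace_boxlike oS u2 th0 ta0 be0 _ up) => t t01.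
  have td : `|p + t *: (x - p) - x0| < d.
    have -> : p + t *: (x - p) - x0 = (1 - t) *: (p - x0) + t *: (x - x0).
      by apply/rowP => i; rewrite !mxE; ring.
    move: t01 => /andP[t0 t1]; apply: le_lt_trans (ler_normD _ _) _.
    rewrite !normrZ (ger0_norm t0) ger0_norm ?subr_ge0 //.
    have [t1'|tn] := eqVneq t 1; first by rewrite t1' subrr mul0r mul1r add0r.
    have tp : 0 < 1 - t by rewrite subr_gt0 lt_neqAle tn.
    have H1 : (1 - t) * `|p - x0| < (1 - t) * d by rewrite ltr_pM2l.
    have H2 : t * `|x - x0| <= t * d by rewrite ler_wpM2l // ltW.
    by lra.
  apply: filterS2 (near_in_ball td) (near_hpos (hpos_segment pp px t01)) => z zd pz.
  have [Sz uz H] := sub z zd (hpos_dom pz); split; first exact: hpos_dom.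
  by split=> //; exact: H.
apply/near_distP; exists d => // x xd Dx.
apply: contrapT => uxM; have e0 : 0 < `|u x - M| / 2.
  by rewrite divr_gt0 // normr_gt0 subr_eq0; apply/eqP.
have [Sx _ _] := sub x xd Dx.
have /near_distP[d1 d10 dP] := near_and (within_near (twice_diff_cont oS.1 u2) Sx e0) (near_in_ball xd).
have d2 : 0 < d1 / 2 by rewrite divr_gt0.
(* [x] pushed into the interior; the sum has at most one term, and is empty when [n = 0]. *)
pose x' := x + \sum_(i | val i == 0%N) (d1 / 2) *: delta_mx 0 i.
have x'E j : x' 0 j = x 0 j + (if val j == 0%N then d1 / 2 else 0).
  rewrite mxE summxE; congr (_ + _); case: ifP => j0.
    rewrite (bigD1 j) //= big1 => [|i /andP[_ /negbTE ij]]; last first.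
      by rewrite mxE delta_coord eq_sym ij mulr0.
    by rewrite mxE delta_coord eqxx mulr1 addr0.
  apply: big1 => i i0; rewrite mxE delta_coord; case: eqP => [ji|]; last by rewrite mulr0.
  by rewrite ji i0 in j0.
have px' : hpos x'.
  by move=> i i0; rewrite x'E i0 eqxx ltr_wpDl // Dx.
have x'x : `|x' - x| < d1.
  apply: le_lt_trans (_ : d1 / 2 < d1); last by lra.
  apply: rV_norm_le => [|i]; first exact: ltW.
  rewrite mxE x'E mxE addrAC subrr add0r; case: ifP => _; last by rewrite normr0 ltW.
  by rewrite ger0_norm // ltW.
have [H x'd] := dP x' x'x.
have [Sx' _ _] := sub x' x'd (hpos_dom px').
have := H Sx'; rewrite (pos x' x'd px') distrC leNgt ltr_pdivrMr ?ltr_pMr ?ltr1n //.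
by rewrite normr_gt0 subr_eq0; apply/eqP.
Qed.

(** If [u < M] at all nearby interior points, [hopf] applies to a small ball inside the half-space
    that touches its boundary at [x0], and makes the inward derivative negative. *)
Lemma boundary_max S u (M th ta be : R) x0 (i0 : 'I_n) : ropen D S -> twice_diff D S u ->
  0 < th -> 0 <= ta -> 0 <= be -> subsolution_near S u M th ta be x0 ->
  val i0 = 0%N -> x0 0 i0 = 0 -> u x0 = M -> 0 <= pd D i0 u x0 ->
  forall d : R, 0 < d -> exists p, [/\ `|p - x0| < d, hpos p & u p = M].
Proof.
move=> oS u2 th0 ta0 be0 /near_distP[d1 d10 sub] i00 x00 ux0 g0 d d0.
apply: contrapT => np.
have hposE x : 0 < x 0 i0 -> hpos x.
  by move=> xi i i0'; rewrite (_ : i = i0) //; apply: val_inj; rewrite i0' i00.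
have DE x : 0 <= x 0 i0 -> D x.
  by move=> xi i i0'; rewrite (_ : i = i0) //; apply: val_inj; rewrite i0' i00.
pose r := Num.min d d1 / 4.
have m0 : 0 < Num.min d d1 by rewrite lt_min d0.
have r0 : 0 < r by rewrite divr_gt0.
have rd : r + r < d.
  have : Num.min d d1 <= d by rewrite ge_min lexx.
  by rewrite /r; lra.
have rd1 : r + r < d1.
  have : Num.min d d1 <= d1 by rewrite ge_min lexx orbT.
  by rewrite /r; lra.
pose y := x0 + r *: delta_mx 0 i0.
have yi : y 0 i0 = r by rewrite !mxE !eqxx x00 mulr1 add0r.
have nb x : sq (x - y) <= r ^+ 2 -> `|x - x0| <= r + r.
  move=> /(norm_le_sq (ltW r0)) xy; rewrite -(subrKA y).
  apply: le_trans (ler_normD _ _) _; apply: lerD => //.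
  by rewrite /y addrC addKr normrZ rV_norm_delta mulr1 gtr0_norm.
have xi x : (x 0 i0 - r) ^+ 2 <= sq (x - y).
  rewrite /sq (bigD1 i0) //= 2!mxE yi lerDl.
  by apply: sumr_ge0 => i _; exact: sqr_ge0.
have cl x : sq (x - y) <= r ^+ 2 -> D x.
  move=> xr; apply: DE; have := le_trans (xi x) xr.
  by nra.
have op x : sq (x - y) < r ^+ 2 -> hpos x.
  move=> xr; apply: hposE; have := le_lt_trans (xi x) xr; nra.
have dot0 : dot (y - x0) (\row_i pd D i u x0) = r * pd D i0 u x0.
  rewrite /dot /y [x0 + _]addrC addrK (bigD1 i0) //= big1 => [|i /negbTE ni].
    by rewrite !mxE !eqxx mulr1 addr0.
  by rewrite !mxE ni andbF mulr0 mul0r.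
have : dot (y - x0) (\row_i pd D i u x0) < 0; last first.
  by rewrite dot0 ltNge mulr_ge0 // ltW.
apply: (@hopf R n D S u y x0 (r ^+ 2) M th ta be halfspace_boxlike oS u2) => //.
- by rewrite exprn_gt0.
- move=> x xr.
  by have [Sx uM _] := sub x (le_lt_trans (nb x xr) rd1) (cl x xr).
- move=> x xr; have px := op x xr; have xr' := ltW xr.
  have [Sx uM H] := sub x (le_lt_trans (nb x xr') rd1) (cl x xr').
  split; first by apply: filterS (near_hpos px) => z; exact: hpos_dom.
    exact: H.
  rewrite lt_neqAle uM andbT; apply/eqP => uxM; apply: np; exists x; split => //.
  exact: le_lt_trans (nb x xr') rd.
- rewrite /y opprD addrA subrr add0r.
  rewrite /sq (bigD1 i0) //= big1 => [|i /negbTE ni]; rewrite !mxE.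
    by rewrite !eqxx mulr1 sqrrN addr0.
  by rewrite ni andbF mulr0 oppr0 expr0n.
Qed.

End HalfSpace.
(** * Charts and hypersurfaces *)

Section VectorCalculus.
Context {R : realType}.

Definition isdiffv n d (D : set 'rV[R]_n) (f : 'rV[R]_n -> 'rV[R]_d) x
    (J : 'M[R]_(n, d)) :=
  forall j, isdiff D (fun y => f y 0 j) x (fun i => J i j).

Lemma isdiffv_jac n d (D : set 'rV[R]_n) (f : 'rV[R]_n -> 'rV[R]_d) x J :
  boxlike D -> isdiffv D f x J -> jac D f x = J.
Proof. by move=> bD fJ; apply/matrixP => i j; rewrite mxE (isdiff_pd i bD (fJ j)). Qed.

Lemma isdiffv_comp n d e (D : set 'rV[R]_n) (E : set 'rV[R]_d)
    (c : 'rV[R]_n -> 'rV[R]_d) (f : 'rV[R]_d -> 'rV[R]_e) x J K :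
  D x -> isdiffv D c x J -> (\forall y \near x, D y -> E (c y)) ->
  isdiffv E f (c x) K -> isdiffv D (f \o c) x (J *m K).
Proof.
move=> Dx cJ cE fK j; apply: eq_isdiff (isdiff_comp Dx cJ cE (fK j)) => i.
by rewrite mxE.
Qed.

Lemma isdiffv_near n d (D : set 'rV[R]_n) (f h : 'rV[R]_n -> 'rV[R]_d) x J :
  (\forall y \near x, D y -> f y = h y) -> isdiffv D f x J -> isdiffv D h x J.
Proof.
move=> fh fJ j; apply: isdiff_near (fJ j).
by apply: filterS fh => y + Dy => ->.
Qed.

Lemma isdiffv_id n (D : set 'rV[R]_n) x : D x -> isdiffv D id x 1%:M.
Proof.
by move=> Dx j; apply: eq_isdiff (isdiff_coord j Dx) => i; rewrite mxE.
Qed.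

Lemma isdiffv_unique n d (D : set 'rV[R]_n) (f : 'rV[R]_n -> 'rV[R]_d) x J K :
  boxlike D -> isdiffv D f x J -> isdiffv D f x K -> J = K.
Proof. by move=> bD /(isdiffv_jac bD) <- /(isdiffv_jac bD). Qed.

Lemma isdiff_unique n (D : set 'rV[R]_n) f x a b i :
  boxlike D -> isdiff D f x a -> isdiff D f x b -> a i = b i.
Proof. by move=> bD /(isdiff_pd i bD) <- /(isdiff_pd i bD). Qed.

Lemma isdiff_refine n (D : set 'rV[R]_n) f x a :
  boxlike D -> isdiff D f x a -> isdiff D f x (fun i => pd D i f x).
Proof. by move=> bD fa; apply: eq_isdiff (fa) => i; rewrite (isdiff_pd i bD fa). Qed.

Lemma isdiffv_refine n d (D : set 'rV[R]_n) (f : 'rV[R]_n -> 'rV[R]_d) x :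
  boxlike D -> (forall j, exists a, isdiff D (fun y => f y 0 j) x a) ->
  isdiffv D f x (jac D f x).
Proof.
move=> bD fa j; have [a /(isdiff_refine bD)] := fa j.
by apply: eq_isdiff => i; rewrite mxE.
Qed.

Lemma isdiff_lsub n k (D : set 'rV[R]_n) f (x : 'rV[R]_(n + k)) a :
  isdiff D f (lsubmx x) a ->
  isdiff [set y | D (lsubmx y)] (f \o lsubmx) x
    (fun i => match fintype.split i with inl i' => a i' | inr _ => 0 end).
Proof.
move=> fa; have Dx := isdiff_dom fa.
pose J (i : 'I_(n + k)) (j : 'I_n) : R := (i == lshift k j)%:R.
apply: eq_isdiff (isdiff_comp (J := J) (c := lsubmx) _ _ _ fa) => //.
- move=> i; rewrite /J; case: (splitP i) => i' ii'.
    rewrite (bigD1 i') //= big1 => [|j /negbTE ji].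
      by rewrite (_ : i = lshift k i') ?eqxx ?mul1r ?addr0 //; apply: val_inj.
    rewrite -val_eqE /= ii' (_ : (val i' == val j) = false) ?mul0r //.
    by rewrite val_eqE eq_sym.
  apply: big1 => j _; rewrite -val_eqE /= ii' (_ : (n + i' == j)%N = false) ?mul0r //.
  by apply/negbTE; rewrite neq_ltn (leq_trans (ltn_ord j)) ?leq_addr ?orbT.
- move=> j; apply: isdiff_near (isdiff_coord (lshift k j) _) => //.
  by apply: near_all => y _; rewrite mxE.
- exact: near_all.
Qed.

End VectorCalculus.

Section Charts.
Context {R : realType} {n : nat} {X : Type} (A : atlas R n X).

(* The part of [smooth_manifold] that also holds for the product M x R^k. *)
Record charted : Prop := Charted {
  charted_box : boxlike (model A);
  charted_self : forall p, dom A p p;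
  charted_K : forall p, {in dom A p, cancel (chart A p) (chart_inv A p)};
  charted_open : forall p q,
    ropen (model A) (chart A p @` (dom A p `&` dom A q));
  charted_diff : forall p q z j, dom A p z -> dom A q z ->
    exists a, isdiff (model A) (fun y => chart A q (chart_inv A p y) 0 j)
      (chart A p z) a
}.

Hypothesis chA : charted.

Lemma charted_invK p z : dom A p z -> chart_inv A p (chart A p z) = z.
Proof. by move=> pz; apply: charted_K => //; rewrite inE. Qed.

Lemma charted_model p z : dom A p z -> model A (chart A p z).
Proof. by move=> pz; apply: (charted_open chA p p).1; exists z. Qed.

Lemma charted_near p q z : dom A p z -> dom A q z ->
  \forall y \near chart A p z, model A y ->
    exists z', [/\ dom A p z', dom A q z' & y = chart A p z'].
Proof.
move=> pz qz; have [_ H] := charted_open chA p q.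
have : (chart A p @` (dom A p `&` dom A q)) (chart A p z) by exists z.
by move=> /H; apply: filterS => y + Dy => /(_ Dy) [z' [pz' qz'] <-]; exists z'.
Qed.

Lemma chg_isdiff p q z : dom A p z -> dom A q z ->
  isdiffv (model A) (chart A q \o chart_inv A p) (chart A p z) (chg A p q z).
Proof.
move=> pz qz; apply: isdiffv_refine; first exact: charted_box.
by move=> j; exact: charted_diff.
Qed.

Lemma chg_comp p q r z : dom A p z -> dom A q z -> dom A r z ->
  chg A p q z *m chg A q r z = chg A p r z.
Proof.
move=> pz qz rz; apply: (isdiffv_unique (charted_box chA)); last exact: chg_isdiff.
apply: (isdiffv_near (f := (chart A r \o chart_inv A q) \o (chart A q \o chart_inv A p))
  _ (isdiffv_comp (E := model A) (charted_model pz) (chg_isdiff pz qz) _ _)).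
- by apply: filterS (charted_near pz qz) => y + Dy => /(_ Dy)[z' [pz' qz' ->]] /=;
    rewrite !charted_invK.
- by apply: filterS (charted_near pz qz) => y + Dy => /(_ Dy)[z' [pz' qz' ->]] /=;
    rewrite charted_invK //; exact: charted_model.
- by rewrite /= charted_invK //; exact: chg_isdiff.
Qed.

Lemma chg_id p z : dom A p z -> chg A p p z = 1%:M.
Proof.
move=> pz; apply: (isdiffv_unique (charted_box chA)); first exact: chg_isdiff.
apply: isdiffv_near (isdiffv_id (charted_model pz)).
by apply: filterS (charted_near pz pz) => y + Dy => /(_ Dy)[z' [pz' qz' ->]] /=;
  rewrite charted_invK.
Qed.

Lemma chg_inv p q z : dom A p z -> dom A q z ->
  chg A p q z *m chg A q p z = 1%:M.
Proof. by move=> pz qz; rewrite chg_comp // chg_id. Qed.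

End Charts.

Section ManifoldCharts.
Context {R : realType} {n : nat} {X : topologicalType} (A : atlas R n X).
Hypothesis mA : smooth_manifold A.

Lemma manifold_box : boxlike (model A).
Proof. by rewrite (manifold_model mA); exact: halfspace_boxlike. Qed.

(** The full chart image is open in the model by [chart_open]; continuity of the inverse chart
    handles the restriction to [W]. *)
Lemma manifold_image_ropen p (W : set X) : open W ->
  ropen (model A) (chart A p @` (dom A p `&` W)).
Proof.
move=> oW; have [U oU UE] := chart_open mA p; split=> [y [z [pz _] <-]|y [z [pz Wz] <-]].
  have : (chart A p @` dom A p) (chart A p z) by exists z.
  by rewrite UE => -[].
have cz : (chart A p @` dom A p) (chart A p z) by exists z.
have zK u : dom A p u -> chart_inv A p (chart A p u) = u.
  by move=> pu; apply: (chartK mA); rewrite inE.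
have /subspace_continuousP/(_ _ cz) := chart_inv_continuous mA (p := p).
have nW : nbhs (chart_inv A p (chart A p z)) W by rewrite zK //; exact: open_nbhs_nbhs.
move=> cvgz; have H : \forall y \near chart A p z, (chart A p @` dom A p) y ->
  W (chart_inv A p y) by exact: (cvgz W nW).
have nO : nbhs (chart A p z) U.
  by apply: open_nbhs_nbhs; split=> //; move: cz; rewrite UE => -[].
apply: filterS2 H nO => y0 Hy Uy Dy.
have cy : (chart A p @` dom A p) y0 by rewrite UE.
by have := Hy cy; case: cy => u pu <-; rewrite zK // => Wu; exists u.
Qed.

Lemma manifold_charted : charted A.
Proof.
split; first exact: manifold_box.
- exact: (dom_self mA).
- by move=> p z pz; apply: (chartK mA).
- by move=> p q; apply: manifold_image_ropen; exact: (dom_open mA).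
- move=> p q z j pz qz; eexists.
  apply: (Cr1_isdiff manifold_box _ (transition_smooth mA p q j 1)); last by exists z.
  by apply: manifold_image_ropen; exact: (dom_open mA).
Qed.

End ManifoldCharts.

(** * Charts of the product with R^k *)

Section ProductCharts.
Context {R : realType} {n k : nat} {M : Type} (A : atlas R n M).
Hypothesis chA : charted A.
Local Notation P := (prod_atlas k A).
Implicit Types (z c q : M * 'rV[R]_k).

Lemma prod_box : boxlike (model P).
Proof.
have bA := charted_box chA; split=> [x y z /= Ax Ay xyz|x i h /= Ax h0].
  by apply: box_mid Ax Ay _ => // i; have := xyz (lshift k i); rewrite !mxE.
case: (splitP i) => j ij.
  rewrite (_ : lsubmx _ = lsubmx x + h *: delta_mx 0 j); first exact: box_up.
  apply/rowP => l; rewrite !mxE !eqxx /= -!val_eqE /= ij; congr (_ + _ * _).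
rewrite (_ : lsubmx _ = lsubmx x) //; apply/rowP => l; rewrite !mxE eqxx /=.
rewrite -val_eqE /= ij (_ : (val l == n + j)%N = false) ?mulr0 ?addr0 //.
by apply/negbTE; rewrite neq_ltn (leq_trans (ltn_ord l)) // leq_addr.
Qed.

Lemma row_mx_split (a : 'rV[R]_n) (b : 'rV[R]_k) (i : 'I_(n + k)) :
  row_mx a b 0 i = match fintype.split i with inl j => a 0 j | inr j => b 0 j end.
Proof. by rewrite mxE. Qed.

Lemma lsubmx_norm (x : 'rV[R]_(n + k)) : `|lsubmx x| <= `|x|.
Proof. by apply: rV_norm_le => // i; rewrite mxE rV_norm_coord. Qed.

Lemma prod_image_ropen (D S : set 'rV[R]_n) : ropen D S ->
  ropen [set x : 'rV[R]_(n + k) | D (lsubmx x)] [set x | S (lsubmx x)].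
Proof.
move=> [SD oS]; split=> [x /= /SD //|x /= /oS /near_distP[d d0 dP]].
apply/near_distP; exists d => // y yd /=; apply: dP.
by apply: le_lt_trans yd; rewrite -linearB lsubmx_norm.
Qed.

Lemma prod_diff c q z : dom P c z -> dom P q z ->
  isdiffv (model P) (chart P q \o chart_inv P c) (chart P c z)
    (block_mx (chg A c.1 q.1 z.1) 0 0 1%:M).
Proof.
move=> cz qz j; have Pz : model P (chart P c z).
  by rewrite /= row_mxKl; exact: charted_model.
case: (splitP j) => l jl.
  have H := chg_isdiff chA (p := c.1) (q := q.1) (z := z.1) cz qz l.
  rewrite -(row_mxKl (chart A c.1 z.1) z.2) in H.
  have H2 : isdiff (model P) _ (chart P c z) _ := isdiff_lsub H.
  apply: isdiff_near (eq_isdiff _ H2).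
    by apply: near_all => y _; rewrite /= (_ : j = lshift k l) ?row_mxEl //; exact: val_inj.
  have -> : j = lshift k l by exact: val_inj.
  move=> i; case: (splitP i) => i' ii'.
    by rewrite (_ : i = lshift k i') ?block_mxEul //; exact: val_inj.
  by rewrite (_ : i = rshift n i') ?block_mxEdl ?mxE //; exact: val_inj.
have -> : j = rshift n l by exact: val_inj.
apply: isdiff_near (eq_isdiff _ (isdiff_coord (rshift n l) Pz)).
  by apply: near_all => y _; rewrite /= row_mxEr mxE.
move=> i; case: (splitP i) => i' ii'.
  rewrite (_ : i = lshift k i'); last exact: val_inj.
  by rewrite block_mxEur mxE eq_lrshift.
rewrite (_ : i = rshift n i'); last exact: val_inj.
by rewrite block_mxEdr mxE (inj_eq (@rshift_inj _ _)).
Qed.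

Lemma prod_charted : charted P.
Proof.
split; first exact: prod_box.
- by move=> p; exact: (charted_self chA).
- by move=> p z; rewrite inE => pz; rewrite /= row_mxKl row_mxKr charted_invK //; case: z pz.
- move=> p q; have := prod_image_ropen (charted_open chA p.1 q.1).
  rewrite (_ : [set x | (chart A p.1 @` (dom A p.1 `&` dom A q.1)) (lsubmx x)]
    = chart P p @` (dom P p `&` dom P q)) //.
  apply/seteqP; split=> [x /= [z [pz qz] zx]|x /= [z [pz qz] <-]].
    by exists (z, rsubmx x) => //=; rewrite zx hsubmxK.
  by exists z.1 => //; rewrite row_mxKl.
- by move=> p q z j pz qz; eexists; exact: prod_diff pz qz j.
Qed.

Lemma prod_chg c q z : dom P c z -> dom P q z ->
  chg P c q z = block_mx (chg A c.1 q.1 z.1) 0 0 1%:M.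
Proof.
move=> cz qz; apply: (isdiffv_unique prod_box); last exact: prod_diff.
exact: chg_isdiff prod_charted _ _ _ cz qz.
Qed.

End ProductCharts.
Section MatrixForms.
Context {R : realType}.

Lemma mulmx_inner p m n (E : 'M[R]_(p, n)) (E' : 'M[R]_(m, n)) (G : 'M[R]_n) i j :
  (E *m G *m E'^T) i j = inner G (row i E) (row j E').
Proof.
rewrite /inner tr_row -row_mul [LHS]mxE [RHS]mxE; apply: eq_bigr => l _.
by rewrite [row _ _ _ _]mxE [col _ _ _ _]mxE.
Qed.

Lemma inner_summ n I (r : seq I) (M : I -> 'M[R]_n) u v :
  inner (\sum_(i <- r) M i) u v = \sum_(i <- r) inner (M i) u v.
Proof. by rewrite /inner mulmx_sumr mulmx_suml summxE. Qed.

Lemma invmx_uniq n (B C : 'M[R]_n) : B *m C = 1%:M -> invmx B = C.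
Proof.
move=> BC; have [uB _] := mulmx1_unit BC.
by rewrite -[LHS]mulmx1 -BC mulKmx.
Qed.

(** The divergence is independent of the frame: [J] cancels by cyclicity of the trace. This moves it
    from the chart centred at the point to a fixed chart. *)
Lemma div_on_change m n (G : 'M[R]_n) (J : 'M[R]_m) (E W : 'M[R]_(m, n)) :
  J \in unitmx -> E *m G *m E^T \in unitmx ->
  div_on G (J *m E) (J *m W) = \tr (invmx (E *m G *m E^T) *m (W *m G *m E^T)).
Proof.
move=> uJ uh; rewrite /div_on trmx_mul; set h := E *m G *m E^T in uh *.
have uJT : J^T \in unitmx by rewrite unitmx_tr.
have -> : J *m E *m G *m (E^T *m J^T) = J *m h *m J^T by rewrite /h !mulmxA.
rewrite (@invmx_uniq _ (J *m h *m J^T) (invmx J^T *m invmx h *m invmx J)); last first.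
  rewrite [_ *m (invmx J^T *m _ *m _)]mulmxA [_ *m (invmx J^T *m _)]mulmxA.
  by rewrite mulmxK // mulmxK // mulmxV.
have -> : J *m W *m G *m (E^T *m J^T) = J *m (W *m G *m E^T) *m J^T by rewrite !mulmxA.
rewrite mxtrace_mulC !mulmxA mulmxK // -!mulmxA mxtrace_mulC !mulmxA.
by rewrite mulmxKV // mxtrace_mulC !mulmxA.
Qed.

End MatrixForms.

Section BilinearDerivative.
Context {R : realType} {m n : nat} (D : set 'rV[R]_m).

Lemma isdiff_inner (K : 'rV[R]_m -> 'M[R]_n) (P Q : 'rV[R]_m -> 'rV[R]_n) x
    (K' : 'I_m -> 'M[R]_n) (P' Q' : 'I_m -> 'rV[R]_n) : D x ->
  (forall a b, isdiff D (fun y => K y a b) x (fun i => K' i a b)) ->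
  (forall j, isdiff D (fun y => P y 0 j) x (fun i => P' i 0 j)) ->
  (forall j, isdiff D (fun y => Q y 0 j) x (fun i => Q' i 0 j)) ->
  isdiff D (fun y => inner (K y) (P y) (Q y)) x (fun i =>
    inner (K x) (P' i) (Q x) + inner (K x) (P x) (Q' i)
    + inner (K' i) (P x) (Q x)).
Proof.
move=> Dx KK PP QQ.
have H := isdiff_sum (index_enum 'I_n) Dx (fun a =>
  isdiff_sum (index_enum 'I_n) Dx (fun b => isdiffM (isdiffM (PP a) (KK a b)) (QQ b))).
apply: isdiff_near (eq_isdiff _ H).
  by apply: near_all => y _; rewrite innerE.
move=> i; rewrite !innerE -!big_split /=; apply: eq_bigr => a _.
rewrite -!big_split /=; apply: eq_bigr => b _; ring.
Qed.

End BilinearDerivative.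

(** * Maps read in charts *)

Section ImmersionCharts.
Context {R : realType} {m n : nat} {S X : Type} (AS : atlas R m S) (A : atlas R n X).
Context (F : S -> X).
Hypothesis chS : charted AS.
Hypothesis chA : charted A.

Record charted_map : Prop := ChartedMap {
  charted_map_open : forall c q,
    ropen (model AS) (chart AS c @` (dom AS c `&` F @^-1` dom A q));
  charted_map_Cr : forall c q j r,
    Cr (model AS) r (chart AS c @` (dom AS c `&` F @^-1` dom A q))
      (fun x => chart A q (F (chart_inv AS c x)) 0 j)
}.

Hypothesis chF : charted_map.

Definition map_in c q (x : 'rV[R]_m) : 'rV[R]_n := chart A q (F (chart_inv AS c x)).
Definition map_jac c q x : 'M[R]_(m, n) := jac (model AS) (map_in c q) x.

Lemma map_image c q s : dom AS c s -> dom A q (F s) ->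
  (chart AS c @` (dom AS c `&` F @^-1` dom A q)) (chart AS c s).
Proof. by move=> cs qs; exists s. Qed.

Lemma map_near c q s : dom AS c s -> dom A q (F s) ->
  \forall x \near chart AS c s, model AS x ->
    exists s', [/\ dom AS c s', dom A q (F s') & x = chart AS c s'].
Proof.
move=> cs qs; have [_ H] := charted_map_open chF c q.
apply: filterS (H _ (map_image cs qs)) => y + Dy => /(_ Dy)[s' [cs' qs'] <-].
by exists s'.
Qed.

Lemma map_isdiff c q s : dom AS c s -> dom A q (F s) ->
  isdiffv (model AS) (map_in c q) (chart AS c s) (map_jac c q (chart AS c s)).
Proof.
move=> cs qs; apply: (isdiffv_refine (charted_box chS)) => j; eexists.
apply: (Cr1_isdiff (charted_box chS) (charted_map_open chF c q)).
  exact: charted_map_Cr.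
exact: map_image.
Qed.

(** [diff_at] uses the charts selected at [s] and [F s], which vary with [s]; this rule relates it
    to Jacobians in fixed charts. It is the chain rule for the local factorisation through the other
    charts. *)
Lemma map_jac_chg c c' q q' s : dom AS c s -> dom AS c' s ->
  dom A q (F s) -> dom A q' (F s) ->
  map_jac c q (chart AS c s)
  = chg AS c c' s *m map_jac c' q' (chart AS c' s) *m chg A q' q (F s).
Proof.
move=> cs cs' qs qs'.
apply: (isdiffv_unique (charted_box chS)); first exact: map_isdiff.
have sK := charted_invK chS.
have near2 := near_and (charted_near chS cs cs') (map_near cs qs').
have nearq := map_near cs' qs'.
apply: (isdiffv_near (f := (chart A q \o chart_inv A q') \o
   (map_in c' q' \o (chart AS c' \o chart_inv AS c)))).
  apply: filterS near2 => y [H1 H2] Dy.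
  have [s1 [cs1 cs1' E1]] := H1 Dy; have [s2 [cs2 qs2 E]] := H2 Dy.
  have E' : s1 = s2 by rewrite -(sK _ _ cs1) -E1 E sK.
  subst s2; rewrite E1 /= /map_in /= !sK //.
  by rewrite (charted_invK chA).
apply: (isdiffv_comp (E := model A)); first exact: charted_model.
- apply: (isdiffv_comp (E := model AS)); first exact: charted_model.
  + exact: chg_isdiff.
  + apply: filterS (charted_near chS cs cs') => y + Dy => /(_ Dy)[s1 [cs1 cs1' ->]].
    by rewrite /= sK //; exact: charted_model.
  + by rewrite /= sK //; exact: map_isdiff.
- apply: filterS near2 => y [H1 H2] Dy.
  have [s1 [cs1 cs1' E1]] := H1 Dy; have [s2 [cs2 qs2 E]] := H2 Dy.
  have E' : s1 = s2 by rewrite -(sK _ _ cs1) -E1 E sK.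
  subst s2; rewrite E1 /= /map_in sK // sK //.
  exact: charted_model.
by rewrite /= /map_in !sK //; exact: chg_isdiff.
Qed.

Lemma diff_at_map s : diff_at AS A F s = map_jac s (F s) (chart AS s s).
Proof. by []. Qed.

End ImmersionCharts.

(** * Gauss and Weingarten formulas *)

Section Geometry.
Context {R : realType} {m n : nat} {S X : Type} (AS : atlas R m S) (A : atlas R n X).
Context (g : X -> 'M[R]_n) (F : S -> X) (N : S -> 'rV[R]_n).
Hypothesis chS : charted AS.
Hypothesis chA : charted A.
Hypothesis chF : charted_map AS A F.

Record charted_metric : Prop := ChartedMetric {
  charted_metric_sym : forall p, (g p)^T = g p;
  charted_metric_pos : forall p, posdef (g p);
  charted_metric_diff : forall c z a b, dom A c z ->
    exists d, isdiff (model A) (fun x => gram A g c x a b) (chart A c z) d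
}.

Record unit_normal : Prop := UnitNormal {
  unit_normal_unit : forall s, inner (g (F s)) (N s) (N s) = 1;
  unit_normal_orth : forall s (v : 'rV[R]_m),
    inner (g (F s)) (v *m diff_at AS A F s) (N s) = 0;
  unit_normal_diff : forall c s q j, dom AS c s -> dom A q (F s) ->
    exists d, isdiff (model AS) (fun x => field_in A F N q (chart_inv AS c x) 0 j)
      (chart AS c s) d
}.

Hypothesis met : charted_metric.
Hypothesis nor : unit_normal.

Lemma gram_chart c z : dom A c z ->
  gram A g c (chart A c z) = chg A c z z *m g z *m (chg A c z z)^T.
Proof. by move=> cz; rewrite /gram charted_invK. Qed.

Lemma gram_center z : gram A g z (chart A z z) = g z.
Proof.
have zz := charted_self chA z.
by rewrite gram_chart // chg_id // mul1mx trmx1 mulmx1.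
Qed.

Lemma gram_sym c x : (gram A g c x)^T = gram A g c x.
Proof. by rewrite /gram !trmx_mul trmxK (charted_metric_sym met) mulmxA. Qed.

Definition first_form c s : 'M[R]_m :=
  let D := map_jac AS A F c (F s) (chart AS c s) in D *m g (F s) *m D^T.

(** [first_form] is written in the ambient chart at [F s], which moves with [s]; to differentiate
    it, the ambient chart [q] has to stay fixed. *)
Lemma first_form_chart c q s : dom AS c s -> dom A q (F s) ->
  first_form c s = let D := map_jac AS A F c q (chart AS c s) in
    D *m gram A g q (chart A q (F s)) *m D^T.
Proof.
move=> cs qs; have Fs := charted_self chA (F s); rewrite /first_form /= gram_chart //.
rewrite (map_jac_chg chS chA chF cs cs Fs qs) chg_id // mul1mx.
by rewrite trmx_mul !mulmxA.
Qed.

Lemma normal_chart c q s v : dom AS c s -> dom A q (F s) ->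
  inner (gram A g q (chart A q (F s))) (v *m map_jac AS A F c q (chart AS c s))
    (field_in A F N q s) = 0.
Proof.
move=> cs qs; have Fs := charted_self chA (F s); have ss := charted_self chS s.
rewrite gram_chart // (map_jac_chg chS chA chF cs ss qs Fs) /field_in /inner.
rewrite trmx_mul -!mulmxA; set B := (chg A (F s) q (F s)).
set C := chg A q (F s) (F s).
have BC : B *m C = 1%:M by exact: chg_inv.
have CB : C^T *m B^T = 1%:M by rewrite -trmx_mul BC trmx1.
rewrite [C^T *m _]mulmxA CB mul1mx [B *m _]mulmxA BC mul1mx.
have := unit_normal_orth nor s (v *m chg AS c s s).
by rewrite /inner diff_at_map !mulmxA.
Qed.

Lemma inner_mulVmx (G : 'M[R]_n) (u v : 'rV[R]_n) :
  G \in unitmx -> inner G (u *m invmx G) v = dot u v.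
Proof. by move=> uG; rewrite dotE /inner mulmxKV. Qed.

Lemma chris_aux (u y z p1 p2 p3 : R) : u * y / 2 * ((p1 + p2 - p3) * z) =
  2^-1 * (u * y * p1 * z + y * u * p2 * z - z * u * p3 * y).
Proof. by ring. Qed.

Lemma koszul_aux (s1 s2 s3 t1 t2 t3 : R) : s1 + 2^-1 * (t1 + t2 - t3) =
  2^-1 * (s1 + s2 + t1 + (s1 + s3 + t2) - (s2 + s3 + t3)).
Proof. by field. Qed.

Fact deriv_key : unit. Proof. by []. Qed.

Section AtPoint.
Context (c s : S).
Hypothesis cs : dom AS c s.
Let q := F s.
Let x0 := chart AS c s.
Let D := map_jac AS A F c q x0.
Let G := g q.

Let qs : dom A q (F s). Proof. exact: charted_self. Qed.

(* Locked, as unfolding second derivatives during unification is slow. *)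
Definition second_deriv : 'I_m -> 'I_m -> 'rV[R]_n := locked_with deriv_key (fun i j =>
  \row_a pd (model AS) i (pd (model AS) j (fun x => map_in AS A F c q x 0 a)) x0).

Definition gram_deriv : 'I_n -> 'M[R]_n := locked_with deriv_key (fun e =>
  \matrix_(a, b) pd (model A) e (fun y => gram A g q y a b) (chart A q q)).

Lemma second_derivE i j a : second_deriv i j 0 a =
  pd (model AS) i (pd (model AS) j (fun x => map_in AS A F c q x 0 a)) x0.
Proof. by rewrite /second_deriv locked_withE mxE. Qed.

Lemma gram_derivE e a b :
  gram_deriv e a b = pd (model A) e (fun y => gram A g q y a b) (chart A q q).
Proof. by rewrite /gram_deriv locked_withE mxE. Qed.

(* The derivative of the metric, [(d_U g)(Y, Z)]. *)
Definition trilin (U Y Z : 'rV[R]_n) := inner (\sum_e U 0 e *: gram_deriv e) Y Z.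

Definition normal_deriv : 'M[R]_(m, n) := \matrix_(i, a)
  pd (model AS) i (fun x => field_in A F N q (chart_inv AS c x) 0 a) x0.

(* By the Koszul formula, the scalar product with Z of the covariant derivative,
   in direction i, of the j-th coordinate vector field of the hypersurface. *)
Definition kform i j Z := inner G (second_deriv i j) Z + 2^-1 *
  (trilin (row i D) (row j D) Z + trilin (row j D) (row i D) Z
   - trilin Z (row i D) (row j D)).

Lemma gram_deriv_sym e : (gram_deriv e)^T = gram_deriv e.
Proof.
apply/matrixP => a b; rewrite mxE !gram_derivE; congr (pd _ _ _ _).
apply/funext => y.
by have := congr1 (fun B : 'M[R]_n => B a b) (gram_sym q y); rewrite mxE.
Qed.

Lemma trilinC U Y Z : trilin U Y Z = trilin U Z Y.
Proof.
apply: inner_sym; rewrite linear_sum /=; apply: eq_bigr => e _.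
by rewrite linearZ /= gram_deriv_sym.
Qed.

Lemma trilinDl U U' Y Z : trilin (U + U') Y Z = trilin U Y Z + trilin U' Y Z.
Proof.
rewrite /trilin -innerDm; congr (inner _ _ _).
by rewrite -big_split; apply: eq_bigr => e _; rewrite mxE scalerDl.
Qed.

Lemma trilinZl (a : R) U Y Z : trilin (a *: U) Y Z = a * trilin U Y Z.
Proof.
rewrite /trilin -innerZm scaler_sumr; congr (inner _ _ _).
by apply: eq_bigr => e _; rewrite mxE scalerA.
Qed.

Lemma kformD i j Z Z' : kform i j (Z + Z') = kform i j Z + kform i j Z'.
Proof. rewrite /kform innerDr /trilin !innerDr -!/(trilin _ _ _) trilinDl; ring. Qed.

Lemma kformZ i j (a : R) Z : kform i j (a *: Z) = a * kform i j Z.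
Proof. rewrite /kform innerZr /trilin !innerZr -!/(trilin _ _ _) trilinZl; ring. Qed.

Lemma kform_sum i j (I : finType) (w : I -> R) (Z : I -> 'rV[R]_n) :
  kform i j (\sum_l w l *: Z l) = \sum_l w l * kform i j (Z l).
Proof.
have k0 : kform i j 0 = 0 by rewrite -(scale0r 0) kformZ mul0r.
rewrite (big_morph (kform i j) (kformD i j) k0).
by apply: eq_bigr => l _; rewrite kformZ.
Qed.

Lemma gram_comp_isdiff a b : isdiff (model AS)
  (fun x => gram A g q (map_in AS A F c q x) a b) x0
  (fun i => (\sum_e row i D 0 e *: gram_deriv e) a b).
Proof.
have [d /(isdiff_refine (charted_box chA)) H] := charted_metric_diff met a b qs.
have xq : map_in AS A F c q x0 = chart A q (F s) by rewrite /map_in /x0 charted_invK.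
rewrite -xq in H.
apply: eq_isdiff (isdiff_comp (charted_model chS cs) (map_isdiff chS chF cs qs) _ H).
  move=> i; rewrite summxE; apply: eq_bigr => e _.
  by rewrite [RHS]mxE [row i D 0 e]mxE gram_derivE xq.
apply: filterS (map_near chF cs qs) => y + Dy => /(_ Dy)[s1 [cs1 qs1 ->]].
by rewrite /map_in charted_invK //; exact: charted_model.
Qed.

Lemma gram_at : gram A g q (map_in AS A F c q x0) = G.
Proof. by rewrite /map_in /x0 charted_invK // gram_center. Qed.

Lemma row_map_jac_isdiff j a : isdiff (model AS)
  (fun x => row j (map_jac AS A F c q x) 0 a) x0 (fun i => second_deriv i j 0 a).
Proof.
have H := charted_map_Cr chF c q a 2.
have H2 := Cr_pd_isdiff j (charted_box chS) (charted_map_open chF c q) H (map_image cs qs).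
apply: isdiff_near (eq_isdiff _ H2); last first.
  by move=> i; rewrite second_derivE.
by apply: near_all => y _; rewrite !mxE.
Qed.

Lemma second_deriv_sym i j : second_deriv i j = second_deriv j i.
Proof.
apply/rowP => a; rewrite (second_derivE i j) (second_derivE j i).
exact: (schwarz i j (charted_box chS) (charted_map_open chF c q)
  (charted_map_Cr chF c q a 2) (map_image cs qs)).
Qed.

Lemma first_form_isdiff j l : isdiff (model AS)
  (fun x => first_form c (chart_inv AS c x) j l) x0
  (fun i => inner G (second_deriv i j) (row l D) + inner G (row j D) (second_deriv i l)
     + trilin (row i D) (row j D) (row l D)).
Proof.
have H := isdiff_inner (charted_model chS cs) gram_comp_isdiff
  (row_map_jac_isdiff j) (row_map_jac_isdiff l).
apply: isdiff_near (eq_isdiff _ H).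
  apply: filterS (map_near chF cs qs) => y + Dy => /(_ Dy)[s1 [cs1 qs1 ->]].
  by rewrite charted_invK // (first_form_chart cs1 qs1) /= mulmx_inner /map_in charted_invK.
by move=> i; rewrite gram_at.
Qed.

Lemma field_in_center : field_in A F N q s = N s.
Proof. by rewrite /field_in chg_id // mulmx1. Qed.

Lemma normal_isdiff j : isdiff (model AS)
  (fun x => field_in A F N q (chart_inv AS c x) 0 j) x0
  (fun i => row i normal_deriv 0 j).
Proof.
have [d H] := unit_normal_diff nor j cs qs.
by apply: eq_isdiff (isdiff_refine (charted_box chS) H) => i; rewrite [RHS]mxE mxE.
Qed.

(** The derivative in direction [i] of the identity [<d_j F, N> = 0], which [normal_chart] provides
    at all nearby points. *)
Lemma normal_orth_deriv i j :
  inner G (second_deriv i j) (N s) + inner G (row j D) (row i normal_deriv)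
  + trilin (row i D) (row j D) (N s) = 0.
Proof.
have H := isdiff_inner (charted_model chS cs) gram_comp_isdiff
  (row_map_jac_isdiff j) normal_isdiff.
have H0 : isdiff (model AS) (fun=> 0 : R) x0 (fun=> 0).
  by apply: isdiff_cst; exact: charted_model.
have bS := charted_box chS.
have near0 : \forall y \near x0, model AS y -> 0 =
    inner (gram A g q (map_in AS A F c q y)) (row j (map_jac AS A F c q y))
      (field_in A F N q (chart_inv AS c y)) :> R; last first.
  have := isdiff_unique i bS H (isdiff_near near0 H0).
  by rewrite gram_at charted_invK // field_in_center.
apply: filterS (map_near chF cs qs) => y + Dy => /(_ Dy)[s1 [cs1 qs1 ->]].
by rewrite /map_in charted_invK // rowE normal_chart.
Qed.

Definition chris (U Y : 'rV[R]_n) : 'rV[R]_n :=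
  \row_l \sum_a \sum_b U 0 a * Y 0 b * christoffel A g q (chart A q q) l a b.

Lemma trilinE U Y Z : trilin U Y Z =
  \sum_a \sum_b \sum_e U 0 a * Y 0 b * gram_deriv a b e * Z 0 e.
Proof.
rewrite /trilin inner_summ; apply: eq_bigr => a _; rewrite innerZm innerE mulr_sumr.
apply: eq_bigr => b _; rewrite mulr_sumr; apply: eq_bigr => e _; ring.
Qed.

(** Pairing with [G] cancels the inverse metric in [christoffel], leaving the symbols of the first
    kind. *)
Lemma inner_chris U Y Z : inner G (chris U Y) Z =
  2^-1 * (trilin U Y Z + trilin Y U Z - trilin Z U Y).
Proof.
pose C a b : 'rV[R]_n :=
  \row_e (gram_deriv a b e + gram_deriv b a e - gram_deriv e a b).
have uG : G \in unitmx := posdef_unit (charted_metric_pos met q).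
have -> : chris U Y =
    \sum_a \sum_b (U 0 a * Y 0 b * 2^-1) *: (C a b *m invmx G).
  apply/rowP => l; rewrite mxE summxE; apply: eq_bigr => a _.
  rewrite summxE; apply: eq_bigr => b _; rewrite mxE /christoffel gram_center -mulrA.
  rewrite -!mulrA; congr (_ * (_ * (_ * _))); rewrite mxE; apply: eq_bigr => e _.
  rewrite [C a b 0 e]mxE !gram_derivE mulrC; congr (_ * _).
  by rewrite -[in LHS](charted_metric_sym met q) -trmx_inv mxE.
rewrite inner_suml (trilinE U) (trilinE Y) (trilinE Z) [X in _ + X - _]exchange_big /=.
rewrite -big_split [X in _ - X]exchange_big -sumrB mulr_sumr /=; apply: eq_bigr => a _.
rewrite [X in _ - X]exchange_big -big_split -sumrB mulr_sumr inner_suml /=.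
apply: eq_bigr => b _; rewrite innerZl inner_mulVmx // /dot -big_split -sumrB /=.
rewrite !mulr_sumr; apply: eq_bigr => e _; rewrite [C a b 0 e]mxE.
exact: chris_aux.
Qed.

Definition normal_covd : 'M[R]_(m, n) :=
  \matrix_(i, l) (normal_deriv i l + chris (row i D) (N s) 0 l).

Lemma row_normal_covd i :
  row i normal_covd = row i normal_deriv + chris (row i D) (N s).
Proof. by apply/rowP => l; rewrite [LHS]mxE [LHS]mxE [RHS]mxE [in RHS]mxE. Qed.

(** Weingarten's equation: by [normal_orth_deriv], the derivative of the normal is minus the second
    fundamental form on tangent vectors. *)
Lemma inner_normal_covd i j :
  inner G (row i normal_covd) (row j D) = - kform i j (N s).
Proof.
rewrite row_normal_covd innerDl inner_chris /kform.
have sG : G^T = G := charted_metric_sym met q.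
have := normal_orth_deriv i j; rewrite (inner_sym _ (row i normal_deriv) sG).
rewrite (trilinC (row i D) (N s)) (trilinC (row j D) (row i D)) => E.
lra.
Qed.

(** The covariant derivative is linear in the direction, so a change of the chart of the
    hypersurface only multiplies it by the transition matrix. *)
Lemma covd_chart : covd AS A g F N s = chg AS s c s *m normal_covd.
Proof.
have ss := charted_self chS s; have bS := charted_box chS.
have DE : diff_at AS A F s = chg AS s c s *m D.
  by rewrite diff_at_map (map_jac_chg chS chA chF ss cs qs qs) chg_id // mulmx1.
apply/matrixP => i l; rewrite mxE [RHS]mxE.
have H : isdiff (model AS) (fun y => field_in A F N q (chart_inv AS s y) 0 l)
    (chart AS s s) (fun i => \sum_j chg AS s c s i j * row j normal_deriv 0 l).
  have sK := charted_invK chS.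
  have xq : (chart AS c \o chart_inv AS s) (chart AS s s) = x0 by rewrite /= sK.
  have H1 := normal_isdiff l; rewrite -xq in H1.
  apply: isdiff_near (isdiff_comp (E := model AS) (charted_model chS ss)
    (chg_isdiff chS ss cs) _ H1).
    apply: filterS (charted_near chS ss cs) => y + Dy => /(_ Dy)[s1 [ss1 cs1 ->]].
    by rewrite /= !sK.
  apply: filterS (charted_near chS ss cs) => y + Dy => /(_ Dy)[s1 [ss1 cs1 ->]].
  by rewrite /= sK //; exact: charted_model.
rewrite (isdiff_pd i bS H) DE.
have E j : normal_covd j l = row j normal_deriv 0 l + chris (row j D) (N s) 0 l.
  by rewrite [LHS]mxE [row j normal_deriv 0 l]mxE.
under [RHS]eq_bigr do rewrite E mulrDr.
rewrite big_split /=; congr (_ + _).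
transitivity (\sum_j \sum_a \sum_b chg AS s c s i j *
    (D j a * N s 0 b * christoffel A g q (chart A q q) l a b)).
  rewrite [RHS]exchange_big; apply: eq_bigr => a _ /=.
  rewrite [RHS]exchange_big; apply: eq_bigr => b _ /=; rewrite [(_ *m _) i a]mxE !mulr_suml.
  by apply: eq_bigr => j _; rewrite !mulrA.
apply: eq_bigr => j _; rewrite [chris _ _ _ _]mxE mulr_sumr; apply: eq_bigr => a _.
by rewrite mulr_sumr; apply: eq_bigr => b _; rewrite [row j D 0 a]mxE.
Qed.

(** The tangential part of the covariant derivative depends on the induced metric alone: in the
    alternating sum of derivatives of [first_form], the second derivatives of the immersion cancel
    by Schwarz's theorem except for the one in [kform]. *)
Lemma kform_first_form i j l :
  kform i j (row l D) = 2^-1 * (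
    pd (model AS) i (fun x => first_form c (chart_inv AS c x) j l) x0
    + pd (model AS) j (fun x => first_form c (chart_inv AS c x) i l) x0
    - pd (model AS) l (fun x => first_form c (chart_inv AS c x) i j) x0).
Proof.
have bS := charted_box chS; have sG : G^T = G := charted_metric_sym met q.
rewrite (isdiff_pd i bS (first_form_isdiff j l)) (isdiff_pd j bS (first_form_isdiff i l)).
rewrite (isdiff_pd l bS (first_form_isdiff i j)) /kform.
rewrite (second_deriv_sym l i) (second_deriv_sym l j) (second_deriv_sym j i).
rewrite ![inner G (row _ D) _]inner_sym //.
exact: koszul_aux.
Qed.

End AtPoint.
End Geometry.
(** * Hypersurfaces of the product with Euclidean space *)

Section Projection.
Context {R : realType} {m n : nat}.
Context (E : 'M[R]_(m, n)) (G : 'M[R]_n) (N : 'rV[R]_n).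
Hypothesis mn : m.+1 = n.
Hypothesis freeE : row_free E.
Hypothesis symG : G^T = G.
Hypothesis posG : posdef G.
Hypothesis unitN : inner G N N = 1.
Hypothesis orthN : forall v, inner G (v *m E) N = 0.
Local Notation h := (E *m G *m E^T).

Lemma form_sym : h^T = h.
Proof. by rewrite !trmx_mul trmxK symG mulmxA. Qed.

Lemma form_posdef : posdef h.
Proof.
move=> v v0; have : v *m E != 0.
  by apply: contraNneq v0; rewrite -(mul0mx 1 E) => /(row_free_inj freeE) ->.
by move=> /posG; rewrite /inner trmx_mul !mulmxA.
Qed.

(** The rows of [E] and [N] are independent, and [m.+1 = n] makes them a basis. *)
Lemma frame_complete v : exists w (b : R), v = w *m E + b *: N.
Proof.
have comb (u : 'rV[R]_(m + 1)) :
    u *m col_mx E N = lsubmx u *m E + rsubmx u 0 0 *: N.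
  rewrite -[u in LHS]hsubmxK mul_row_col; congr (_ + _).
  by rewrite {1}[rsubmx u]mx11_scalar mul_scalar_mx.
have free : row_free (col_mx E N).
  rewrite -kermx_eq0; apply/rowV0P => u /sub_kermxP; rewrite comb => u0.
  have b0 : rsubmx u 0 0 = 0.
    have : inner G (lsubmx u *m E + rsubmx u 0 0 *: N) N = 0.
      by rewrite u0 /inner !mul0mx mxE.
    by rewrite innerDl orthN add0r innerZl unitN mulr1.
  move: u0; rewrite b0 scale0r addr0 => a0.
  rewrite -[u]hsubmxK; have -> : lsubmx u = 0.
    by apply: (row_free_inj freeE); rewrite a0 mul0mx.
  have -> : rsubmx u = 0 by rewrite [LHS]mx11_scalar b0 raddf0.
  exact: row_mx0.
have full : row_full (col_mx E N).
  by move: free; rewrite /row_free /row_full => /eqP ->; rewrite addn1 mn.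
have /submxP[u ->] := submx_full v full.
by exists (lsubmx u), (rsubmx u 0 0); exact: comb.
Qed.

Lemma frame_decomp v :
  v = v *m G *m E^T *m invmx h *m E + inner G v N *: N.
Proof.
have [w [b vE]] := frame_complete v.
have uh := posdef_unit form_posdef.
have bE : inner G v N = b.
  by rewrite vE innerDl orthN add0r innerZl unitN mulr1.
have NE : N *m G *m E^T = 0.
  apply/rowP => i; rewrite [RHS]mxE mulmx_inner.
  have -> : row 0 N = N by apply/rowP => j; rewrite mxE.
  by rewrite inner_sym // rowE orthN.
rewrite bE {1}vE; congr (_ *m _ + _).
rewrite {1}vE !mulmxDl -!scalemxAl NE mul0mx scaler0 addr0.
by rewrite (_ : w *m E *m G *m E^T = w *m h) ?mulmxK // !mulmxA.
Qed.

(** The tangential and normal projections add up to the identity; with an index raised this becomes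
    the inverse metric. *)
Lemma frame_projection : E^T *m invmx h *m E + N^T *m N = invmx G.
Proof.
apply/esym/invmx_uniq; apply/row_matrixP => i; rewrite row1.
rewrite [RHS](frame_decomp (delta_mx 0 i)) rowE mulmxA mulmxDr !mulmxA.
by congr (_ + _); rewrite [_ *m N^T]mx11_scalar mul_scalar_mx.
Qed.

End Projection.

(** * The product metric *)

Section ProductMetric.
Context {R : realType} {n k : nat} {M : Type} (A : atlas R n M) (g : M -> 'M[R]_n).
Hypothesis chA : charted A.
Hypothesis met : charted_metric A g.
Local Notation P := (prod_atlas k A).
Local Notation gP := (prod_metric (k := k) g).
Implicit Types (z c q : M * 'rV[R]_k).

Let mx0E a b (i : 'I_a) (j : 'I_b) : (0 : 'M[R]_(a, b)) i j = 0.
Proof. by rewrite mxE. Qed.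

Lemma inner_prod z (x : 'rV[R]_n) t y t' :
  inner (gP z) (row_mx x t) (row_mx y t') = inner (g z.1) x y + dot t t'.
Proof.
rewrite /prod_metric inner_block !mulmx0 !mul0mx mulmx1 dotE /inner.
by rewrite !mx0E addr0 add0r.
Qed.

Lemma inner_prod_V z (x : 'rV[R]_(n + k)) :
  inner (gP z) x (Vfield n z) = dot (rsubmx x) z.2.
Proof.
rewrite -[x in LHS]hsubmxK inner_prod /inner trmx0 mulmx0.
by rewrite mx0E add0r.
Qed.

Lemma prod_metric_sym z : (gP z)^T = gP z.
Proof. by rewrite /prod_metric tr_block_mx !trmx0 trmx1 (charted_metric_sym met). Qed.

Lemma prod_metric_posdef z : posdef (gP z).
Proof.
move=> v v0; rewrite -[v]hsubmxK inner_prod.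
have [l0|l0] := eqVneq (lsubmx v) 0; last first.
  rewrite ltr_pwDl //; first exact: (charted_metric_pos met).
  by rewrite dotE -sqE sq_ge0.
rewrite l0 /inner mul0mx mul0mx mxE add0r dotE -sqE lt_neqAle sq_ge0 andbT.
apply: contraNneq v0 => /esym/sq_eq0 r0.
by rewrite -[v]hsubmxK l0 r0 row_mx0.
Qed.

Lemma prod_gram q z : dom P q z ->
  gram P gP q (chart P q z) = block_mx (gram A g q.1 (chart A q.1 z.1)) 0 0 1%:M.
Proof.
move=> qz; have zz : dom P z z := charted_self (prod_charted chA) z.
rewrite (gram_chart gP (prod_charted chA) qz) (prod_chg chA qz zz) /prod_metric.
rewrite tr_block_mx !trmx0 trmx1 !mulmx_block !mulmx0 !mul0mx !addr0 !add0r.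
by rewrite !mulmx1 !mul0mx (gram_chart g chA qz).
Qed.

Lemma block_split (B : 'M[R]_n) (a b : 'I_(n + k)) :
  block_mx B 0 0 (1%:M : 'M[R]_k) a b =
  match fintype.split a, fintype.split b with
  | inl a', inl b' => B a' b' | inr a', inr b' => (a' == b')%:R | _, _ => 0 end.
Proof.
rewrite mxE; case: (fintype.split a) => a'; rewrite mxE;
  by case: (fintype.split b) => b'; rewrite ?mxE.
Qed.

Lemma prod_gram_isdiff q z (a b : 'I_(n + k)) : dom P q z ->
  isdiff (model P) (fun x => gram P gP q x a b) (chart P q z)
    (fun e => match fintype.split e, fintype.split a, fintype.split b with
      | inl e', inl a', inl b' =>
          pd (model A) e' (fun x => gram A g q.1 x a' b') (chart A q.1 z.1)
      | _, _, _ => 0 end).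
Proof.
move=> qz; have Pz := charted_model (prod_charted chA) qz.
have near_block (f : 'rV[R]_(n + k) -> R) :
    (forall y, f y = block_mx (gram A g q.1 (lsubmx y)) 0 0 1%:M a b) ->
    \forall y \near chart P q z, model P y -> f y = gram P gP q y a b.
  move=> fE; apply: filterS (charted_near (prod_charted chA) qz qz) => y + Dy.
  move=> /(_ Dy)[z' [qz' _ ->]]; rewrite fE (prod_gram qz').
  have -> : lsubmx (chart P q z') = chart A q.1 z'.1 := row_mxKl _ _.
  by [].
have cst (r : R) : (forall y : 'rV[R]_(n + k), r = block_mx (gram A g q.1 (lsubmx y)) 0 0 1%:M a b) ->
    isdiff (model P) (fun x => gram P gP q x a b) (chart P q z) (fun=> 0).
  by move=> rE; apply: isdiff_near (near_block _ rE) (isdiff_cst r Pz).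
have bE y := block_split (gram A g q.1 y) a b.
case Ea : (fintype.split a) (bE) => [a'|a'] aE; case Eb : (fintype.split b) (aE) => [b'|b'] abE.
- have [d H] := charted_metric_diff met a' b' (qz : dom A q.1 z.1).
  have {}H := isdiff_refine (charted_box chA) H.
  have H1 : isdiff (model A) (fun x => gram A g q.1 x a' b')
      (lsubmx (row_mx (chart A q.1 z.1) z.2))
      (fun i => pd (model A) i (fun x => gram A g q.1 x a' b') (chart A q.1 z.1)).
    by rewrite row_mxKl.
  have H2 : isdiff (model P) _ (chart P q z) _ := isdiff_lsub H1.
  by apply: isdiff_near H2; apply: near_block => y; rewrite abE.
- apply: eq_isdiff (cst 0 _) => [e|y]; last by rewrite abE.
  by case: (fintype.split e).
- apply: eq_isdiff (cst 0 _) => [e|y]; last by rewrite abE.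
  by case: (fintype.split e).
- apply: eq_isdiff (cst (a' == b')%:R _) => [e|y]; last by rewrite abE.
  by case: (fintype.split e).
Qed.

Lemma prod_charted_metric : charted_metric P gP.
Proof.
split; [exact: prod_metric_sym | exact: prod_metric_posdef | move=> c z a b cz].
by eexists; exact: prod_gram_isdiff.
Qed.

Lemma prod_gram_pd q e (a b : 'I_(n + k)) :
  pd (model P) e (fun x => gram P gP q x a b) (chart P q q) =
  match fintype.split e, fintype.split a, fintype.split b with
      | inl e', inl a', inl b' =>
          pd (model A) e' (fun x => gram A g q.1 x a' b') (chart A q.1 q.1)
      | _, _, _ => 0 end.
Proof.
have qq : dom P q q := charted_self (prod_charted chA) q.
by rewrite (isdiff_pd e (prod_box chA) (prod_gram_isdiff a b qq)).
Qed.

Lemma inv_prod_metric z : invmx (gP z) = block_mx (invmx (g z.1)) 0 0 1%:M.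
Proof.
apply: invmx_uniq; rewrite /prod_metric mulmx_block !mulmx0 !mul0mx !addr0 !add0r mulmx1.
rewrite mulmxV ?scalar_mx_block //; exact: posdef_unit (charted_metric_pos met _).
Qed.

Definition vert_proj : 'M[R]_(n + k) := block_mx 0 0 0 1%:M.

(** The trace over the tangent space of the projection to R^k is the full trace [k] minus the
    contribution of the normal, by [frame_projection]. It yields [k - |N_2|^2] on the hypersurface
    and [k - 1] on a cylinder. *)
Lemma vert_trace p (E : 'M[R]_(p, n + k)) (N : 'rV[R]_(n + k)) z :
  p.+1 = (n + k)%N -> row_free E -> inner (gP z) N N = 1 ->
  (forall v, inner (gP z) (v *m E) N = 0) ->
  \tr (invmx (E *m gP z *m E^T) *m (E *m vert_proj *m gP z *m E^T))
  = k%:R - sq (rsubmx N).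
Proof.
move=> pn freeE unitN orthN.
have PG : vert_proj *m gP z = vert_proj.
  by rewrite /vert_proj /prod_metric mulmx_block !mulmx0 !mul0mx !addr0 add0r mulmx1.
rewrite -[E *m _ *m gP z]mulmxA PG -[E *m _ *m _]mulmxA mulmxA mxtrace_mulC.
rewrite -!mulmxA mxtrace_mulC -mulmxA.
have := frame_projection pn freeE (prod_metric_sym z) (prod_metric_posdef z)
  unitN orthN.
move=> /(canRL (addrK _)); rewrite -!mulmxA => ->.
rewrite mulmxBr linearB /= inv_prod_metric; congr (_ - _).
  rewrite /vert_proj mulmx_block !mulmx0 !mul0mx !addr0 add0r mulmx1.
  by rewrite mxtrace_block !mxtrace0 add0r mxtrace1.
have NT : N^T = col_mx (lsubmx N)^T (rsubmx N)^T by rewrite -tr_row_mx hsubmxK.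
rewrite mulmxA mxtrace_mulC trace_mx11 NT -[N in N *m _]hsubmxK /vert_proj.
by rewrite mul_block_col !mul0mx mul1mx !add0r mul_row_col mulmx0 add0r sqE.
Qed.

Section Trilin.
Context {S : Type} (F : S -> M * 'rV[R]_k) (s : S).
Implicit Types (t : 'rV[R]_k) (X Y Z : 'rV[R]_(n + k)).

(** The product metric does not depend on the Euclidean coordinates, and its blocks involving R^k
    are constant; hence a vertical vector in any slot annihilates its derivative. *)
Lemma trilin_vert_l t Y Z : trilin P gP F s (row_mx 0 t) Y Z = 0.
Proof.
rewrite trilinE big1 // => a _; apply: big1 => b _; apply: big1 => e _.
rewrite gram_derivE prod_gram_pd row_mx_split; case: (fintype.split a) => a'.
  by rewrite mxE !mul0r.
by rewrite mulr0 mul0r.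
Qed.

Lemma trilin_vert_r t X Y : trilin P gP F s X Y (row_mx 0 t) = 0.
Proof.
rewrite trilinE big1 // => a _; apply: big1 => b _; apply: big1 => e _.
rewrite gram_derivE prod_gram_pd row_mx_split; case: (fintype.split e) => e'.
  by rewrite mxE mulr0.
by case: (fintype.split a); case: (fintype.split b); rewrite mulr0 mul0r.
Qed.

End Trilin.

End ProductMetric.

(** * The drift Laplacian of |t|^2/2 *)

Section CylinderFunction.
Context {R : realType} {m n k : nat} {S M : Type}.
Context (AS : atlas R m S) (A : atlas R n M) (g : M -> 'M[R]_n).
Context (F : S -> M * 'rV[R]_k) (N : S -> 'rV[R]_(n + k)).
Context (psi : M * 'rV[R]_k -> R).
Local Notation P := (prod_atlas k A).
Local Notation gP := (prod_metric (k := k) g).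
Hypothesis chS : charted AS.
Hypothesis chA : charted A.
Hypothesis met : charted_metric A g.
Hypothesis chF : charted_map AS P F.
Hypothesis nor : unit_normal AS P gP F N.
Hypothesis mn : m.+1 = (n + k)%N.
Hypothesis freeF : forall s, row_free (diff_at AS P F s).
Hypothesis psiP : forall q z, dom P q z ->
  exists d, isdiff (model P) (psi \o chart_inv P q) (chart P q z) d.

Let chP := prod_charted (k := k) chA.
Let metP := prod_charted_metric (k := k) chA met.
Let bS := charted_box chS.

Definition vert c l (x : 'rV[R]_m) : R := (F (chart_inv AS c x)).2 0 l.
Definition half_sq c (x : 'rV[R]_m) : R := 2^-1 * sq (F (chart_inv AS c x)).2.
Definition weight_in c (x : 'rV[R]_m) : R := psi (F (chart_inv AS c x)).

Lemma vert_map_in c q l : vert c l = (fun x => map_in AS P F c q x 0 (rshift n l)).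
Proof. by apply/funext => x; rewrite /map_in /= row_mxEr. Qed.

Lemma vert_isdiff c s l : dom AS c s ->
  isdiff (model AS) (vert c l) (chart AS c s)
    (fun i => pd (model AS) i (vert c l) (chart AS c s)) /\
  forall i, isdiff (model AS) (pd (model AS) i (vert c l)) (chart AS c s)
    (fun j => pd (model AS) j (pd (model AS) i (vert c l)) (chart AS c s)).
Proof.
move=> cs; have Fs : dom P (F s) (F s) := charted_self chP (F s).
have H := charted_map_Cr chF c (F s) (rshift n l) 2.
rewrite -[X in Cr _ _ _ X]/(fun x => map_in AS P F c (F s) x 0 (rshift n l)) in H.
rewrite -vert_map_in in H.
have im := map_image (A := P) cs Fs; have op := charted_map_open chF c (F s).
split=> [|i]; first exact: Cr_isdiff bS op H im.
exact: Cr_pd_isdiff bS op H im.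
Qed.

Lemma half_sq_isdiff c s : dom AS c s ->
  isdiff (model AS) (half_sq c) (chart AS c s)
    (fun i => \sum_l vert c l (chart AS c s) * pd (model AS) i (vert c l) (chart AS c s)).
Proof.
move=> cs; have Dx := charted_model chS cs.
have tt l := isdiffM (vert_isdiff l cs).1 (vert_isdiff l cs).1.
have H := isdiffZ 2^-1 (isdiff_sum (index_enum 'I_k) Dx tt).
apply: isdiff_near (eq_isdiff _ H).
  by apply: near_all => y _; rewrite /half_sq /sq; congr (_ * _).
move=> i; rewrite mulr_sumr; apply: eq_bigr => l _.
by rewrite [X in X + _]mulrC -mulr2n mulrnAr -mulr_natl mulrA mulfV ?mul1r ?pnatr_eq0.
Qed.

Lemma half_sq_pd c s i : dom AS c s -> pd (model AS) i (half_sq c) (chart AS c s) =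
  \sum_l vert c l (chart AS c s) * pd (model AS) i (vert c l) (chart AS c s).
Proof. by move=> cs; rewrite (isdiff_pd i bS (half_sq_isdiff cs)). Qed.

Lemma half_sq_isdiff2 c s i : dom AS c s ->
  isdiff (model AS) (pd (model AS) i (half_sq c)) (chart AS c s) (fun j => \sum_l
    (pd (model AS) j (vert c l) (chart AS c s) * pd (model AS) i (vert c l) (chart AS c s)
     + vert c l (chart AS c s) * pd (model AS) j (pd (model AS) i (vert c l)) (chart AS c s))).
Proof.
move=> cs; have Dx := charted_model chS cs.
have tt l := isdiffM (vert_isdiff l cs).1 ((vert_isdiff l cs).2 i).
apply: isdiff_near (isdiff_sum (index_enum 'I_k) Dx tt).
apply: filterS (charted_near chS cs cs) => y + Dy => /(_ Dy)[s' [cs' _ ->]].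
by rewrite half_sq_pd.
Qed.

Lemma half_sq_twice_diff c : twice_diff (model AS) (chart AS c @` dom AS c) (half_sq c).
Proof.
move=> x [s cs <-]; split=> [|i]; first exact: isdiff_refine (half_sq_isdiff cs).
exact: isdiff_refine (half_sq_isdiff2 i cs).
Qed.

Section AtPoint.
Context (c s : S).
Hypothesis cs : dom AS c s.
Let x0 := chart AS c s.
Let D := map_jac AS P F c (F s) x0.
Let G := gP (F s).
Let V := Vfield n (F s).
Let h := first_form AS P gP F c s.
Let Fs : dom P (F s) (F s) := charted_self chP (F s).
Let ss : dom AS s s := charted_self chS s.

Lemma jac_chg : D = chg AS c s s *m diff_at AS P F s.
Proof.
by rewrite /D (map_jac_chg chS chP chF cs ss Fs Fs) (chg_id chP Fs) mulmx1 diff_at_map.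
Qed.

Lemma diff_at_chg : diff_at AS P F s = chg AS s c s *m D.
Proof. by rewrite jac_chg mulmxA (chg_inv chS ss cs) mul1mx. Qed.

Lemma chg_unit : chg AS s c s \in unitmx.
Proof. by have [] := mulmx1_unit (chg_inv chS ss cs). Qed.

Lemma jac_free : row_free D.
Proof.
have uJ : chg AS c s s \in unitmx by have [] := mulmx1_unit (chg_inv chS cs ss).
by rewrite jac_chg /row_free mxrankMfree // mxrank_unit.
Qed.

Lemma jac_orth v : inner G (v *m D) (N s) = 0.
Proof. by rewrite jac_chg mulmxA (unit_normal_orth nor). Qed.

Lemma first_form_sym : h^T = h.
Proof. exact: (form_sym D (charted_metric_sym metP (F s))). Qed.

Lemma first_form_posdef : posdef h.
Proof. exact: (form_posdef jac_free (charted_metric_pos metP (F s))). Qed.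

Lemma vert_jac i l : rsubmx (row i D) 0 l = pd (model AS) i (vert c l) x0.
Proof. by rewrite mxE mxE [D _ _]mxE (vert_map_in c (F s)). Qed.

Lemma vert_second_deriv i j l : rsubmx (second_deriv AS P F c s i j) 0 l =
  pd (model AS) i (pd (model AS) j (vert c l)) x0.
Proof. by rewrite mxE second_derivE (vert_map_in c (F s)). Qed.

Lemma vertE l : vert c l x0 = (F s).2 0 l.
Proof. by rewrite /vert (charted_invK chS). Qed.

Lemma half_sq_grad i : pd (model AS) i (half_sq c) x0 = inner G (row i D) V.
Proof.
rewrite /V /G inner_prod_V half_sq_pd //; apply: eq_bigr => l _.
by rewrite vert_jac vertE mulrC.
Qed.

(** The product rule for [t_l^2 / 2] gives the two terms. The second is a plain second derivative
    paired with [V], and equals [kform] because [V] is vertical and the metric terms vanish. *)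
Lemma half_sq_hess i j : pd (model AS) j (pd (model AS) i (half_sq c)) x0 =
  dot (rsubmx (row j D)) (rsubmx (row i D))
  + kform AS P gP F c s j i V.
Proof.
rewrite (isdiff_pd j bS (half_sq_isdiff2 i cs)) big_split /=; congr (_ + _).
  by apply: eq_bigr => l _; rewrite !vert_jac.
rewrite /kform /V /Vfield (trilin_vert_l chA met) !(trilin_vert_r chA met).
rewrite addr0 subr0 mulr0 addr0 -/(Vfield n (F s)) inner_prod_V.
by apply: eq_bigr => l _; rewrite vert_second_deriv -vertE mulrC.
Qed.

Lemma weight_grad i : pd (model AS) i (weight_in c) x0 =
  inner G (grad P gP psi (F s)) (row i D).
Proof.
have [d H] := psiP Fs; have {}H := isdiff_refine (charted_box chP) H.
have xq : map_in AS P F c (F s) x0 = chart P (F s) (F s).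
  by rewrite /map_in /x0 (charted_invK chS cs).
rewrite -xq in H.
have nm : \forall y \near x0, model AS y -> model P (map_in AS P F c (F s) y).
  apply: filterS (map_near chF cs Fs) => y + Dy => /(_ Dy)[s1 [cs1 qs1 ->]].
  rewrite /map_in (charted_invK chS cs1); exact: (charted_model chP qs1).
have H2 := isdiff_comp (charted_model chS cs) (map_isdiff chS chF cs Fs) nm H.
have near1 : \forall y \near x0, model AS y ->
    ((psi \o chart_inv P (F s)) \o map_in AS P F c (F s)) y = weight_in c y.
  apply: filterS (map_near chF cs Fs) => y + Dy => /(_ Dy)[s1 [cs1 qs1 ->]].
  rewrite /weight_in /map_in /comp (charted_invK chS cs1).
  by rewrite (charted_invK chP qs1).
rewrite (isdiff_pd i bS (isdiff_near near1 H2)) /grad.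
have uG : G \in unitmx := posdef_unit (charted_metric_pos metP (F s)).
rewrite inner_mulVmx // dotC; apply: eq_bigr => a _.
by rewrite [row i D 0 a]mxE mxE xq.
Qed.

Lemma frame_trace : \sum_i \sum_j invmx h i j * dot (rsubmx (row j D)) (rsubmx (row i D))
  = k%:R - sq (rsubmx (N s)).
Proof.
rewrite -(vert_trace met mn jac_free (unit_normal_unit nor s) jac_orth).
apply: eq_bigr => i _; rewrite mxE; apply: eq_bigr => j _; congr (_ * _).
rewrite mulmx_inner row_mul -[row j D in RHS]hsubmxK /vert_proj mul_row_block.
rewrite !mulmx0 mulmx1 addr0 add0r -[row i D in RHS]hsubmxK inner_prod /inner.
by rewrite !mul0mx [X in _ = X + _]mxE add0r.
Qed.

(* Christoffel symbols of the first kind of the induced metric. *)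
Definition gauss_coef (i j l : 'I_m) : R := 2^-1 * (
    pd (model AS) i (fun x => first_form AS P gP F c (chart_inv AS c x) j l) x0
    + pd (model AS) j (fun x => first_form AS P gP F c (chart_inv AS c x) i l) x0
    - pd (model AS) l (fun x => first_form AS P gP F c (chart_inv AS c x) i j) x0).

(** First-order coefficients of the drift Laplacian with the index lowered: the weight, minus the
    trace of the induced Christoffel symbols. *)
Definition hess_drift (l : 'I_m) : R :=
  pd (model AS) l (weight_in c) x0 - \sum_i \sum_j invmx h i j * gauss_coef j i l.

Lemma drift_aux (kk b0 b1 b phi gN : R) :
  kk + (b0 + phi * b1) + (b - b0) = kk + phi * (- - b1 - gN) + (b + phi * gN).
Proof. by ring. Qed.

(* The left-hand side is the drift Laplacian of [|t|^2/2] on the hypersurface. *)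
Lemma drift_laplacian :
  \sum_i \sum_j invmx h i j * pd (model AS) j (pd (model AS) i (half_sq c)) x0
  + \sum_i (\sum_l invmx h i l * hess_drift l) * pd (model AS) i (half_sq c) x0
  = k%:R - sq (rsubmx (N s)) + inner G V (N s) * H_psi AS P gP psi F N s
    + inner G (grad P gP psi (F s)) V.
Proof.
have symG := charted_metric_sym metP (F s); have posG := charted_metric_pos metP (F s).
(* [w] holds the coordinates of the tangential part of [V]. As [V] is the ambient gradient of
   [|t|^2/2], it is also the gradient of this function on the hypersurface, which is [wE]. *)
pose phi := inner G V (N s); pose w := V *m G *m D^T *m invmx h.
pose K i j := kform AS P gP F c s i j.
have uh : h \in unitmx := posdef_unit first_form_posdef.
have Vdec : V = \sum_l w 0 l *: row l D + phi *: N s.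
  by rewrite -mulmx_sum_row; exact: (frame_decomp mn jac_free symG posG
    (unit_normal_unit nor s) jac_orth).
have wE l : w 0 l = \sum_i invmx h i l * pd (model AS) i (half_sq c) x0.
  rewrite mxE; apply: eq_bigr => i _; rewrite mulrC; congr (_ * _).
  rewrite half_sq_grad mulmx_inner inner_sym //; congr (inner _ _ _).
  by apply/rowP => j; rewrite mxE.
(* The tangential part of [V] meets only the induced Christoffel symbols, the normal part only the
   second fundamental form, whose trace is the divergence of [N]. *)
have KV i j : K i j V = \sum_l w 0 l * gauss_coef i j l + phi * K i j (N s).
  rewrite {1}Vdec /K kformD kform_sum kformZ; congr (_ + _).
  apply: eq_bigr => l _; congr (_ * _).
  exact: (kform_first_form chS chP chF metP cs).
have divE : div_on G (diff_at AS P F s) (covd AS P gP F N s)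
    = - \sum_i \sum_j invmx h i j * K j i (N s).
  rewrite (covd_chart chS chP chF nor cs) diff_at_chg div_on_change ?chg_unit //.
  rewrite -sumrN /mxtrace; apply: eq_bigr => i _; rewrite mxE -sumrN.
  apply: eq_bigr => j _; rewrite mulmx_inner.
  by rewrite (inner_normal_covd chS chP chF metP nor cs) mulrN.
have gradV : inner G (grad P gP psi (F s)) V =
    \sum_l w 0 l * pd (model AS) l (weight_in c) x0
    + phi * inner G (grad P gP psi (F s)) (N s).
  rewrite {1}Vdec innerDr inner_sumr innerZr; congr (_ + _).
  by apply: eq_bigr => l _; rewrite innerZr weight_grad.
have hessE : \sum_i \sum_j invmx h i j * pd (model AS) j (pd (model AS) i (half_sq c)) x0
    = (k%:R - sq (rsubmx (N s)))
      + (\sum_l w 0 l * (\sum_i \sum_j invmx h i j * gauss_coef j i l)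
         + phi * \sum_i \sum_j invmx h i j * K j i (N s)).
  rewrite -frame_trace mulr_sumr.
  under [X in _ = _ + (X + _)]eq_bigr do rewrite mulr_sumr.
  rewrite [X in _ = _ + (X + _)]exchange_big /= -!big_split /=.
  apply: eq_bigr => i _; rewrite mulr_sumr.
  under [X in _ = _ + (X + _)]eq_bigr do rewrite mulr_sumr.
  rewrite [X in _ = _ + (X + _)]exchange_big /= -!big_split /=.
  apply: eq_bigr => j _; rewrite half_sq_hess -/(K j i V) KV mulrDr; congr (_ + _).
  rewrite mulrDr; congr (_ + _); last exact: mulrCA.
  by rewrite mulr_sumr; apply: eq_bigr => l _; rewrite mulrCA.
(* The Christoffel term is the opposite of the one in [hessE], so the two cancel in the sum. *)
have driftE : \sum_i (\sum_l invmx h i l * hess_drift l) * pd (model AS) i (half_sq c) x0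
    = \sum_l w 0 l * pd (model AS) l (weight_in c) x0
      - \sum_l w 0 l * (\sum_i \sum_j invmx h i j * gauss_coef j i l).
  rewrite -sumrB; under eq_bigr do rewrite mulr_suml.
  rewrite exchange_big /=; apply: eq_bigr => l _; rewrite -mulrBr -/(hess_drift l) wE.
  by rewrite mulr_suml; apply: eq_bigr => i _; rewrite mulrAC.
rewrite hessE driftE gradV /H_psi /psi_mean_curvature -/G divE -/phi.
exact: drift_aux.
Qed.

End AtPoint.

End CylinderFunction.
(** * Local ellipticity bounds *)

Section Tame.
Context {R : realType} {n : nat} (D : set 'rV[R]_n).
Hypothesis bD : boxlike D.
Implicit Types (f h : 'rV[R]_n -> R) (x y : 'rV[R]_n).

(** Contains the C^1 functions and is closed under sums, products, determinants and composition,
    while recording just the bounds that the coefficients need. *)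
Definition tame x f := [/\ D x,
  \forall y \near x, D y -> exists a, isdiff D f y a
  & forall i, locbdd D x (pd D i f)].

Lemma tame_isdiff x f : tame x f -> isdiff D f x (fun i => pd D i f x).
Proof. by move=> [Dx /nbhs_singleton/(_ Dx)[a /(isdiff_refine bD)]]. Qed.

Lemma tame_locbdd x f : tame x f -> locbdd D x f.
Proof. by move/tame_isdiff/locbdd_isdiff. Qed.

Lemma tame_intro x f (a : 'I_n -> 'rV[R]_n -> R) : D x ->
  (\forall y \near x, D y -> isdiff D f y (a^~ y)) ->
  (forall i, locbdd D x (a i)) -> tame x f.
Proof.
move=> Dx fa ab; split=> // [|i].
  by apply: filterS fa => y + Dy => /(_ Dy) H; exists (a^~ y).
apply: locbdd_near (ab i); apply: filterS fa => y + Dy => /(_ Dy) H.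
by rewrite (isdiff_pd i bD H).
Qed.

Lemma tame_near x f h : (\forall y \near x, D y -> f y = h y) ->
  tame x f -> tame x h.
Proof.
move=> /near_join fh [Dx fd fb]; apply: (tame_intro (a := fun i => pd D i f)) => //.
apply: filterS2 fh fd => y fhy + Dy => /(_ Dy)[a fa].
by apply: isdiff_near fhy _; exact: isdiff_refine fa.
Qed.

Lemma Cr_tame S x f : ropen D S -> Cr D 1 S f -> S x -> tame x f.
Proof.
move=> oS f1 Sx; have [SD oS'] := oS.
apply: (tame_intro (a := fun i => pd D i f)); first exact: SD.
  apply: filterS (oS' x Sx) => y + Dy => /(_ Dy) Sy; exact: Cr_isdiff f1 Sy.
by move=> i; have [_ /(_ i)[_ fc]] := f1; exact: locbdd_within fc.
Qed.

Lemma tame_cst x (c : R) : D x -> tame x (fun=> c).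
Proof.
move=> Dx; apply: (tame_intro (a := fun=> fun=> 0)) => // [|i].
  by apply: near_all => y; exact: isdiff_cst.
exact: locbdd_cst.
Qed.

Lemma tameD x f h : tame x f -> tame x h -> tame x (fun y => f y + h y).
Proof.
move=> [Dx fd fb] [_ hd hb].
apply: (tame_intro (a := fun i y => pd D i f y + pd D i h y)) => // [|i].
  apply: filterS2 fd hd => y + + Dy => /(_ Dy)[a fa] /(_ Dy)[b gb].
  by apply: isdiffD; [exact: isdiff_refine fa | exact: isdiff_refine gb].
exact: locbddD.
Qed.

Lemma tameM x f h : tame x f -> tame x h -> tame x (fun y => f y * h y).
Proof.
move=> ft ht; have [Dx fd fb] := ft; have [_ hd hb] := ht.
apply: (tame_intro (a := fun i y => pd D i f y * h y + f y * pd D i h y)) => // [|i].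
  apply: filterS2 fd hd => y + + Dy => /(_ Dy)[a fa] /(_ Dy)[b gb].
  by apply: isdiffM; [exact: isdiff_refine fa | exact: isdiff_refine gb].
by apply: locbddD; apply: locbddM => //; exact: tame_locbdd.
Qed.

Lemma tame_sum (I : Type) (r : seq I) x (f : I -> 'rV[R]_n -> R) : D x ->
  (forall i, tame x (f i)) -> tame x (fun y => \sum_(i <- r) f i y).
Proof.
move=> Dx ft; elim: r => [|i r IH].
  by apply: tame_near (tame_cst 0 Dx); apply: near_all => y _; rewrite big_nil.
by apply: tame_near (tameD (ft i) IH); apply: near_all => y _; rewrite big_cons.
Qed.

Lemma tame_prod (I : Type) (r : seq I) x (f : I -> 'rV[R]_n -> R) : D x ->
  (forall i, tame x (f i)) -> tame x (fun y => \prod_(i <- r) f i y).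
Proof.
move=> Dx ft; elim: r => [|i r IH].
  by apply: tame_near (tame_cst 1 Dx); apply: near_all => y _; rewrite big_nil.
by apply: tame_near (tameM (ft i) IH); apply: near_all => y _; rewrite big_cons.
Qed.

Lemma tame_det p x (h : 'rV[R]_n -> 'M[R]_p) : D x ->
  (forall i j, tame x (fun y => h y i j)) -> tame x (fun y => \det (h y)).
Proof.
move=> Dx ht; apply: tame_sum => // s; apply: tameM; first exact: tame_cst.
by apply: tame_prod => // i; exact: ht.
Qed.

Lemma locbdd_inv x f : tame x f -> f x != 0 -> locbdd D x (fun y => (f y)^-1).
Proof.
move=> ft fx0; have f2 : 0 < `|f x| / 2 by rewrite divr_gt0 ?normr_gt0.
exists (`|f x| / 2)^-1; apply: filterS (isdiff_cont (tame_isdiff ft) f2) => y + Dy.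
move=> /(_ Dy) fy; have fy2 : `|f x| / 2 <= `|f y|.
  have := lerB_dist (f x) (f y); rewrite distrC => H; lra.
by rewrite normfV lef_pV2 ?posrE //; apply: lt_le_trans fy2.
Qed.

(** Cramer's rule: the cofactors are tame, hence bounded, and the determinant stays away from 0 near
    [x]. *)
Lemma locbdd_invmx p x (h : 'rV[R]_n -> 'M[R]_p) i j : D x ->
  (forall i j, tame x (fun y => h y i j)) -> h x \in unitmx ->
  (\forall y \near x, D y -> h y \in unitmx) ->
  locbdd D x (fun y => invmx (h y) i j).
Proof.
move=> Dx ht ux uy; apply: (@locbdd_near _ _ _ _ (fun y => (\det (h y))^-1 * cofactor (h y) j i)).
  by apply: filterS uy => y + Dy => /(_ Dy) u; rewrite /invmx u mxE mxE.
apply: locbddM.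
  by apply: locbdd_inv; [exact: tame_det | rewrite -unitfE -unitmxE].
apply: locbddM; first exact: locbdd_cst.
apply: tame_locbdd; apply: tame_det => // a b.
by apply: tame_near (ht _ _); apply: near_all => y _; rewrite !mxE.
Qed.

Lemma locbdd_fin (I : finType) x (f : I -> 'rV[R]_n -> R) :
  (forall i, locbdd D x (f i)) ->
  exists2 C : R, 0 < C & \forall y \near x, D y -> forall i, `|f i y| <= C.
Proof.
move=> /boolp.choice[C Cf]; exists (1 + \sum_i `|C i|).
  by rewrite ltr_wpDr // sumr_ge0.
apply: filterS (near_forall Cf) => y H Dy i; apply: le_trans (H i Dy) _.
apply: le_trans (ler_norm _) _; rewrite (bigD1 i) //= addrCA lerDl.
by rewrite addr_ge0 // sumr_ge0.
Qed.

End Tame.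

Section TameComposition.
Context {R : realType} {n d : nat} (D : set 'rV[R]_n) (E : set 'rV[R]_d).
Hypotheses (bD : boxlike D) (bE : boxlike E).
Context (c : 'rV[R]_n -> 'rV[R]_d) (x : 'rV[R]_n).
Hypothesis ct : forall j, tame D x (fun y => c y 0 j).
Hypothesis cE : \forall y \near x, D y -> E (c y).

Lemma near_preimage (Q : set 'rV[R]_d) :
  (\forall z \near c x, E z -> Q z) -> \forall y \near x, D y -> Q (c y).
Proof.
move=> /near_distP[e e0 eQ]; have e2 : 0 < e / 2 by rewrite divr_gt0.
have H : \forall y \near x, forall j, D y -> `|c y 0 j - c x 0 j| <= e / 2.
  by apply: near_forall => j; exact: isdiff_cont (tame_isdiff bD (ct j)) _ e2.
apply: filterS2 H cE => y Hy Ey Dy; apply: eQ; last exact: Ey.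
apply: le_lt_trans (_ : e / 2 < e); last by lra.
by apply: rV_norm_le => [|j]; [exact: ltW | rewrite !mxE; exact: Hy].
Qed.

Lemma locbdd_pull f : locbdd E (c x) f -> locbdd D x (f \o c).
Proof. by move=> [C fC]; exists C; exact: near_preimage fC. Qed.

Lemma tame_comp f : D x -> tame E (c x) f -> tame D x (f \o c).
Proof.
move=> Dx [Ex fd fb].
apply: (tame_intro bD (a := fun i y =>
  \sum_j pd D i (fun z => c z 0 j) y * pd E j f (c y))) => // [|i]; last first.
  apply: locbdd_sum => j; apply: locbddM; first by have [] := ct j.
  exact: locbdd_pull.
have cd : \forall y \near x, forall j, D y -> exists a, isdiff D (fun z => c z 0 j) y a.
  by apply: near_forall => j; have [] := ct j.
apply: filterS2 (near_and cd (near_join cE)) (near_preimage fd) => y [cdy cEy] + Dy.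
move=> /(_ Dy)[b fb']; apply: (isdiff_comp (E := E) (J := fun i j => pd D i (fun z => c z 0 j) y)).
- exact: Dy.
- by move=> j; have [a /(isdiff_refine bD)] := cdy j Dy.
- exact: cEy.
exact: isdiff_refine fb'.
Qed.

End TameComposition.

Lemma tame_lsub {R : realType} n k (D : set 'rV[R]_n) f (x : 'rV[R]_(n + k)) :
  boxlike D -> boxlike [set y : 'rV[R]_(n + k) | D (lsubmx y)] ->
  tame D (lsubmx x) f -> tame [set y | D (lsubmx y)] x (f \o lsubmx).
Proof.
move=> bD bE [Dx fd fb].
have pull (Q : set 'rV[R]_n) : (\forall z \near lsubmx x, Q z) ->
    \forall y \near x, Q (lsubmx y).
  move=> /near_distP[e e0 eQ]; apply/near_distP; exists e => // y yx; apply: eQ.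
  by apply: le_lt_trans yx; rewrite -linearB lsubmx_norm.
apply: (tame_intro bE (a := fun i y =>
    match fintype.split i with inl i' => pd D i' f (lsubmx y) | inr _ => 0 end)) => //.
  apply: filterS (pull _ fd) => y + Dy => /(_ Dy)[a /(isdiff_refine bD)/isdiff_lsub].
  by apply: eq_isdiff => i.
move=> i; case: (fintype.split i) => [i'|_]; last exact: locbdd_cst.
by have [C /pull fC] := fb i'; exists C.
Qed.
Section EllipticityBounds.
Context {R : realType} {m : nat}.

Lemma inner_le_sq (h : 'M[R]_m) (C : R) w : 0 <= C -> (forall i j, `|h i j| <= C) ->
  inner h w w <= C * m%:R * sq w.
Proof.
move=> C0 hC; rewrite innerE.
have step i j : w 0 i * h i j * w 0 j <= C * (2^-1 * (w 0 i ^+ 2 + w 0 j ^+ 2)).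
  apply: le_trans (ler_norm _) _; rewrite mulrAC normrM mulrC.
  apply: ler_pM => //; rewrite normrM -(real_normK (num_real (w 0 i))).
  rewrite -(real_normK (num_real (w 0 j))).
  have := sqr_ge0 (`|w 0 i| - `|w 0 j|); lra.
apply: le_trans (ler_sum _ (fun i _ => ler_sum _ (fun j _ => step i j))) _.
under eq_bigr do rewrite -mulr_sumr -mulr_sumr big_split /= sumr_const card_ord.
rewrite -mulr_sumr -mulr_sumr big_split /= sumr_const card_ord sumrMnl -/(sq w).
by rewrite -mulr_natl; lra.
Qed.

End EllipticityBounds.

(** * The height as a uniformly elliptic subsolution *)

Section Subharmonic.
Context {R : realType} {m n k : nat} {S M : Type}.
Context (AS : atlas R m S) (A : atlas R n M) (g : M -> 'M[R]_n).
Context (F : S -> M * 'rV[R]_k) (N : S -> 'rV[R]_(n + k)).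
Context (psi : M * 'rV[R]_k -> R).
Local Notation P := (prod_atlas k A).
Local Notation gP := (prod_metric (k := k) g).
Hypothesis chS : charted AS.
Hypothesis chA : charted A.
Hypothesis met : charted_metric A g.
Hypothesis metT : forall q z a b, dom A q z ->
  tame (model A) (chart A q z) (fun x => gram A g q x a b).
Hypothesis chF : charted_map AS P F.
Hypothesis nor : unit_normal AS P gP F N.
Hypothesis mn : m.+1 = (n + k)%N.
Hypothesis freeF : forall s, row_free (diff_at AS P F s).
Hypothesis psiT : forall q z, dom P q z ->
  tame (model P) (chart P q z) (psi \o chart_inv P q).
Hypothesis modelS : model AS = halfspace R m.

Let chP := prod_charted (k := k) chA.
Let metP := prod_charted_metric (k := k) chA met.
Let bS := charted_box chS.
Let bP := charted_box chP.

Let psiP q z : dom P q z ->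
  exists d, isdiff (model P) (psi \o chart_inv P q) (chart P q z) d.
Proof. by move=> /psiT /(tame_isdiff bP) H; eexists; exact: H. Qed.

Lemma prod_gram_tame q z a b : dom P q z ->
  tame (model P) (chart P q z) (fun x => gram P gP q x a b).
Proof.
move=> qz; have Pz := charted_model chP qz.
apply: (@tame_near _ _ _ bP _
    (fun y => block_mx (gram A g q.1 (lsubmx y)) 0 0 1%:M a b)).
  apply: filterS (charted_near chP qz qz) => y + Dy => /(_ Dy)[z' [qz' _ ->]].
  rewrite (prod_gram g chA qz').
  have -> : lsubmx (chart P q z') = chart A q.1 z'.1 := row_mxKl _ _.
  by [].
have bE (y : 'rV[R]_(n + k)) := block_split (gram A g q.1 (lsubmx y)) a b.
have eqf f : (fun y : 'rV[R]_(n + k) => block_mx (gram A g q.1 (lsubmx y)) 0 0 1%:M a b) = f ->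
    tame (model P) (chart P q z) f -> tame (model P) (chart P q z)
      (fun y => block_mx (gram A g q.1 (lsubmx y)) 0 0 1%:M a b) by move=> ->.
have /eqf : (fun y : 'rV[R]_(n + k) => block_mx (gram A g q.1 (lsubmx y)) 0 0 1%:M a b) =
  (fun y : 'rV[R]_(n + k) => match fintype.split a, fintype.split b with
  | inl a', inl b' => gram A g q.1 (lsubmx y) a' b'
  | inr a', inr b' => (a' == b')%:R | _, _ => 0 end) by apply/funext => y; exact: bE.
apply; case: (fintype.split a) => a'; case: (fintype.split b) => b'; try exact: tame_cst.
have := metT a' b' (qz : dom A q.1 z.1).
rewrite -[chart A q.1 z.1](row_mxKl _ z.2); apply: tame_lsub.
  exact: charted_box chA.
exact: bP.
Qed.

Section Near.
Context (c s1 : S).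
Hypothesis cs1 : dom AS c s1.
Let q := F s1.
Let x1 := chart AS c s1.
Let qs1 : dom P q (F s1) := charted_self chP q.
Let Dx1 : model AS x1 := charted_model chS cs1.
Let op := charted_map_open chF c q.
Let im := map_image (A := P) cs1 qs1.
Let hx x := first_form AS P gP F c (chart_inv AS c x).

Let mapT j : tame (model AS) x1 (fun x => map_in AS P F c q x 0 j).
Proof. by apply: (Cr_tame bS op _ im); exact: charted_map_Cr. Qed.

Let jacT i j : tame (model AS) x1 (fun x => map_jac AS P F c q x i j).
Proof.
have [_ /(_ i)[_ H]] := charted_map_Cr chF c q j 2.
by apply: tame_near (Cr_tame bS op H im) => //; apply: near_all => y _; rewrite mxE.
Qed.

Let modelP_near : \forall x \near x1, model AS x -> model P (map_in AS P F c q x).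
Proof.
apply: filterS (map_near chF cs1 qs1) => y + Dy => /(_ Dy)[s [cs qs ->]].
rewrite /map_in (charted_invK chS cs); exact: (charted_model chP qs).
Qed.

Let map_at : map_in AS P F c q x1 = chart P q (F s1).
Proof. by rewrite /map_in /x1 (charted_invK chS cs1). Qed.

Lemma first_form_tame i j : tame (model AS) x1 (fun x => hx x i j).
Proof.
apply: (@tame_near _ _ _ bS _ (fun x => \sum_a \sum_b map_jac AS P F c q x i a
    * gram P gP q (map_in AS P F c q x) a b * map_jac AS P F c q x j b)).
  apply: filterS (map_near chF cs1 qs1) => y + Dy => /(_ Dy)[s [cs qs ->]].
  rewrite /hx (charted_invK chS cs) (first_form_chart gP chS chP chF cs qs) /=.
  rewrite mulmx_inner innerE /map_in (charted_invK chS cs).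
  by apply: eq_bigr => a _; apply: eq_bigr => b _; rewrite !mxE.
apply: tame_sum => // a; apply: tame_sum => // b; apply: tameM => //; apply: tameM => //.
apply: (tame_comp bS bP mapT modelP_near (f := fun z => gram P gP q z a b)) => //.
by rewrite map_at; exact: prod_gram_tame.
Qed.

Lemma weight_tame : tame (model AS) x1 (weight_in AS F psi c).
Proof.
apply: (@tame_near _ _ _ bS _ ((psi \o chart_inv P q) \o map_in AS P F c q)).
  apply: filterS (map_near chF cs1 qs1) => y + Dy => /(_ Dy)[s [cs qs ->]].
  by rewrite /weight_in /map_in /comp (charted_invK chS cs) (charted_invK chP qs).
apply: (tame_comp bS bP mapT modelP_near) => //.
by rewrite map_at; exact: psiT.
Qed.

Let chart_near : \forall x \near x1, model AS x -> exists2 s, dom AS c s & x = chart AS c s.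
Proof.
apply: filterS (charted_near chS cs1 cs1) => y + Dy => /(_ Dy)[s [cs _ ->]].
by exists s.
Qed.

Lemma inv_first_form_locbdd i j : locbdd (model AS) x1 (fun x => invmx (hx x) i j).
Proof.
have u s : dom AS c s -> hx (chart AS c s) \in unitmx.
  move=> cs; rewrite /hx (charted_invK chS cs).
  exact: posdef_unit (first_form_posdef chS chA met chF freeF cs).
apply: (locbdd_invmx bS) => //; [exact: first_form_tame | exact: u |].
by apply: filterS chart_near => y + Dy => /(_ Dy)[s cs ->]; exact: u.
Qed.

(** [hess_drift] as a function of the coordinates instead of the point, so that it can be bounded
    near [x1]. *)
Let driftx l x : R := pd (model AS) l (weight_in AS F psi c) x
  - \sum_i \sum_j invmx (hx x) i j * (2^-1 * (
    pd (model AS) j (fun y => hx y i l) x + pd (model AS) i (fun y => hx y j l) x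
    - pd (model AS) l (fun y => hx y j i) x)).

Let driftx_locbdd l : locbdd (model AS) x1 (driftx l).
Proof.
apply: locbddD; first by have [] := weight_tame.
apply: locbddN; apply: locbdd_sum => i; apply: locbdd_sum => j.
apply: locbddM; first exact: inv_first_form_locbdd.
apply: locbddM; first exact: locbdd_cst.
apply: locbddD; last by apply: locbddN; have [] := first_form_tame j i.
by apply: locbddD; [have [] := first_form_tame i l | have [] := first_form_tame j l].
Qed.

Lemma subharmonic_near (mu : R) :
  (forall s, 2^-1 * sq (F s).2 <= mu) ->
  (forall s, 0 <= k%:R - sq (rsubmx (N s)) + inner (gP (F s)) (Vfield n (F s)) (N s)
      * H_psi AS P gP psi F N s + inner (gP (F s)) (grad P gP psi (F s)) (Vfield n (F s))) ->
  exists th ta be, [/\ 0 < th, 0 <= ta, 0 <= be &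
    subsolution_near (chart AS c @` dom AS c) (half_sq AS F c) mu th ta be x1].
Proof.
move=> umu rhs.
have [C1 C10 hC1] := locbdd_fin (fun ij : 'I_m * 'I_m =>
  tame_locbdd bS (first_form_tame ij.1 ij.2)).
have [C2 C20 hC2] := locbdd_fin (fun ij : 'I_m * 'I_m =>
  inv_first_form_locbdd ij.1 ij.2).
have [C3 C30 hC3] := locbdd_fin (fun i : 'I_m => locbdd_sum (index_enum 'I_m) predT
  (fun l => locbddM (inv_first_form_locbdd i l) (driftx_locbdd l))).
(* [C1 * m] bounds the quadratic form of the metric, so [inner_inv_ge] makes [L^-1] an ellipticity
   constant of its inverse; the [1] keeps [L] positive. *)
pose L := C1 * m%:R + 1; have L0 : 0 < L by rewrite ltr_wpDl // mulr_ge0 // ltW.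
exists L^-1, (C2 * m%:R), C3; split; [by rewrite invr_gt0 | | exact: ltW |].
  by rewrite mulr_ge0 // ltW.
rewrite /subsolution_near -modelS.
apply: filterS2 (near_and hC1 hC2) (near_and hC3 chart_near) => y [H1 H2] [H3 H4] Dy.
have {H4}[s cs yE] := H4 Dy; split; first by exists s.
  by rewrite yE /half_sq (charted_invK chS cs).
move=> _; have hxE : hx y = first_form AS P gP F c s.
  by rewrite /hx yE (charted_invK chS cs).
have symh := first_form_sym AS F chA met c s; have posh := first_form_posdef chS chA met chF freeF cs.
have dE l : hess_drift AS A g F psi c s l = driftx l y.
  by rewrite yE /driftx /hess_drift /hx (charted_invK chS cs).
exists (invmx (first_form AS P gP F c s)),
  (fun i => \sum_l invmx (hx y) i l * hess_drift AS A g F psi c s l).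
split.
- by split; [rewrite trmx_inv symh | exact: posdef_inv].
- move=> v; apply: inner_inv_ge => // w; rewrite -hxE.
  have Ci : (forall i j, `|hx y i j| <= C1) by move=> i j; exact: (H1 Dy (i, j)).
  apply: le_trans (inner_le_sq w (ltW C10) Ci) _.
  by rewrite ler_wpM2r ?sq_ge0 // lerDl.
- rewrite -hxE mulrC mulr_natl -[X in _ *+ X]card_ord -sumr_const; apply: ler_sum => i _.
  by apply: le_trans (ler_norm _) _; exact: (H2 Dy (i, i)).
- move=> i; rewrite (eq_bigr (fun l => invmx (hx y) i l * driftx l y)); first exact: (H3 Dy i).
  by move=> l _; rewrite dE.
have := drift_laplacian chS chA met chF nor mn freeF psiP cs.
rewrite -yE -hxE => ->; exact: rhs.
Qed.

End Near.
End Subharmonic.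
(** * The cylinders *)

Section CylinderCurvature.
Context {R : realType} {n k : nat} {M : Type} (A : atlas R n M) (g : M -> 'M[R]_n).
Context (psi : M * 'rV[R]_k -> R).
Local Notation P := (prod_atlas k A).
Local Notation gP := (prod_metric (k := k) g).
Hypothesis chA : charted A.
Hypothesis met : charted_metric A g.
Implicit Types (z : M * 'rV[R]_k) (r : R).

Let chP := prod_charted (k := k) chA.
Let metP := prod_charted_metric (k := k) chA met.

(** By [inner_chris] its product with any vector is a combination of [trilin] terms with a vertical
    argument, all zero; pairing it with itself concludes. *)
Lemma chris_vert {T : Type} (F : T -> M * 'rV[R]_k) s U t :
  chris P gP F s U (row_mx 0 t) = 0.
Proof.
apply/eqP/negPn/negP => c0; have := charted_metric_pos metP (F s) c0.
rewrite (inner_chris F chP metP) (trilin_vert_l chA met) trilinC //.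
rewrite !(@trilin_vert_r _ _ _ _ _ _ chA met _ F s t).
by rewrite addr0 subr0 mulr0 ltxx.
Qed.

Lemma cylinder_normal_isdiff r z l :
  isdiff (model P)
    (fun y => field_in P id (cylinder_normal n r) z (chart_inv P z y) 0 l) (chart P z z)
    (fun i => (block_mx 0 0 0 (- r^-1)%:M : 'M[R]_(n + k)) i l).
Proof.
have zz := charted_self chP z; have Dz := charted_model chP zz.
have near1 (f : 'rV[R]_(n + k) -> R) :
    (forall y, f y = row_mx (0 : 'rV[R]_n) (- (r^-1 *: rsubmx y)) 0 l) ->
    \forall y \near chart P z z, model P y ->
      f y = field_in P id (cylinder_normal n r) z (chart_inv P z y) 0 l.
  move=> fE; apply: filterS (charted_near chP zz zz) => y + Dy.
  move=> /(_ Dy)[z' [zz' _ ->]]; rewrite fE (charted_invK chP zz').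
  rewrite /field_in (prod_chg chA (charted_self chP z') zz') /cylinder_normal.
  by rewrite mul_row_block !mulmx0 mul0mx mulmx1 addr0 add0r row_mxKr.
case: (splitP l) => j jl.
  have lE : l = lshift k j by exact: val_inj.
  apply: isdiff_near (eq_isdiff _ (isdiff_cst 0 Dz)).
    by apply: near1 => y; rewrite lE row_mxEl mxE.
  by move=> i; rewrite lE -(splitK i); case: (fintype.split i) => i' /=;
    rewrite ?block_mxEul ?block_mxEdl mxE.
have lE : l = rshift n j by exact: val_inj.
apply: isdiff_near (eq_isdiff _ (isdiffZ (- r^-1) (isdiff_coord (rshift n j) Dz))).
  by apply: near1 => y; rewrite lE row_mxEr !mxE mulNr.
move=> i; rewrite lE -(splitK i); case: (fintype.split i) => i' /=.
  by rewrite block_mxEur mxE eq_lrshift mulr0.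
by rewrite block_mxEdr mxE eq_rshift mulr_natr.
Qed.

Lemma covd_cylinder_normal r z :
  covd P P gP id (cylinder_normal n r) z = block_mx 0 0 0 (- r^-1)%:M.
Proof.
apply/matrixP => i l; rewrite mxE.
rewrite (isdiff_pd i (charted_box chP) (cylinder_normal_isdiff r z l)).
have := congr1 (fun v : 'rV_(n + k) => v 0 l)
  (chris_vert id z (row i (diff_at P P id z)) (- (r^-1 *: z.2))).
rewrite [X in X = _]mxE [X in _ = X]mxE => c0.
rewrite -[RHS]addr0 -[in RHS]c0; congr (_ + _); apply: eq_bigr => a _; apply: eq_bigr => b _.
by rewrite [row _ _ _ _]mxE.
Qed.

Section AtPoint.
Context (r : R) (z : M * 'rV[R]_k).
Hypothesis r0 : 0 < r.
Hypothesis zr : cylinder M k r z.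
Let E := cylinder_frame n z.
Let NN : 'rV[R]_(n + k) := cylinder_normal n r z.

Lemma cylinder_sq : sq z.2 = r ^+ 2.
Proof. by rewrite -zr sqr_sqrtr // sq_ge0. Qed.

(** Off the axis [(0, t)] is nonzero, so the kernel spanned by the frame has codimension one, as
    [vert_trace] requires. *)
Lemma cylinder_frame_codim : (\rank (kermx (col_mx (0 : 'cV[R]_n) (z.2)^T))).+1 = (n + k)%N.
Proof.
have z0 : z.2 != 0.
  apply/eqP => z0; have := cylinder_sq; rewrite z0 /sq big1 => [|i _]; last by rewrite mxE expr0n.
  by move/esym/eqP; rewrite sqrf_eq0 gt_eqF.
have row0 : row_mx (0 : 'rV[R]_n) z.2 != 0.
  by apply: contraNneq z0 => /(congr1 rsubmx); rewrite row_mxKr => ->; rewrite linear0.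
have -> : col_mx (0 : 'cV[R]_n) (z.2)^T = (row_mx 0 z.2)^T by rewrite tr_row_mx trmx0.
have := rank_leq_col (row_mx (0 : 'rV[R]_n) z.2).
by rewrite mxrank_ker mxrank_tr rank_rV row0 => nk; rewrite subn1 prednK.
Qed.

Lemma cylinder_frame_orth v : inner (gP z) (v *m E) NN = 0.
Proof.
have NE : NN = - r^-1 *: Vfield n z.
  by rewrite /NN /cylinder_normal /Vfield scale_row_mx scaler0 scaleNr.
rewrite NE innerZr inner_prod_V dotE.
have : (v *m E <= kermx (col_mx (0 : 'cV[R]_n) (z.2)^T))%MS.
  by apply: submx_trans (submxMl _ _) _; rewrite eq_row_base.
move/sub_kermxP; rewrite -[v *m E in X in X -> _]hsubmxK mul_row_col mulmx0 add0r => ->.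
by rewrite mxE mulr0.
Qed.

Lemma cylinder_normal_unit : inner (gP z) NN NN = 1.
Proof.
rewrite /NN /cylinder_normal inner_prod /inner mul0mx mul0mx mxE add0r.
rewrite /dot; under eq_bigr do rewrite mxE mxE mulrNN mulrACA -!expr2.
by rewrite -mulr_sumr -/(sq z.2) cylinder_sq exprVn mulVf // expf_neq0 // gt_eqF.
Qed.

(** The derivative of the normal is [- r^-1] times the projection to R^k; since the normal is
    vertical of length 1, [vert_trace] gives [k - 1]. *)
Lemma cylinder_div : div_on (gP z) E (E *m covd P P gP id (cylinder_normal n r) z)
  = - r^-1 * (k%:R - 1).
Proof.
rewrite covd_cylinder_normal.
have -> : block_mx 0 0 0 (- r^-1)%:M = - r^-1 *: vert_proj :> 'M[R]_(n + k).
  by rewrite /vert_proj scale_block_mx !scaler0 scale_scalar_mx mulr1.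
rewrite -scalemxAr /div_on -!scalemxAl -scalemxAr linearZ /=; congr (_ * _).
rewrite (vert_trace met cylinder_frame_codim (row_base_free _) cylinder_normal_unit
  cylinder_frame_orth).
congr (_ - _); rewrite -[RHS]cylinder_normal_unit /NN /cylinder_normal inner_prod.
by rewrite /inner !mul0mx mxE add0r row_mxKr dotE -sqE.
Qed.

Lemma H_psi_rE : H_psi_r A g psi r z =
  r^-1 * (k%:R - 1 + inner (gP z) (grad P gP psi z) (Vfield n z)).
Proof.
rewrite /H_psi_r /psi_mean_curvature cylinder_div.
have -> : cylinder_normal n r z = - r^-1 *: Vfield n z.
  by rewrite /cylinder_normal /Vfield scale_row_mx scaler0 scaleNr.
by rewrite innerZr; ring.
Qed.

End AtPoint.
End CylinderCurvature.
(** * The maximum of |t|^2/2 *)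

Section ManifoldMaximum.
Context {R : realType} {m : nat} {S : topologicalType} (AS : atlas R m S).
Hypothesis mS : smooth_manifold AS.
Context (u : S -> R) (mu : R).
Local Notation local_u c := (fun x => u (chart_inv AS c x)).
Hypothesis u2 : forall c, twice_diff (model AS) (chart AS c @` dom AS c) (local_u c).
Hypothesis usub : forall c s, dom AS c s -> exists th ta be,
  [/\ 0 < th, 0 <= ta, 0 <= be &
    subsolution_near (chart AS c @` dom AS c) (local_u c) mu th ta be (chart AS c s)].

Let chS := manifold_charted mS.

Lemma chart_near c s (Q : set 'rV[R]_m) : dom AS c s ->
  (\forall x \near chart AS c s, model AS x -> Q x) ->
  \forall s' \near s, dom AS c s' /\ Q (chart AS c s').
Proof.
move=> cs xQ; have od := dom_open mS c.
have /subspace_continuousP/(_ _ cs) H := chart_continuous mS (p := c).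
have nd : \forall s' \near s, dom AS c s' by exact: open_nbhs_nbhs.
have nQ : \forall s' \near s, dom AS c s' -> model AS (chart AS c s') -> Q (chart AS c s').
  exact: (H _ xQ).
by apply: filterS2 nd nQ => s' cs' Qs'; split=> //; apply: Qs' => //; exact: charted_model.
Qed.

Lemma chart_inv_near c s (Q : set S) : dom AS c s -> (\forall s' \near s, Q s') ->
  \forall x \near chart AS c s, model AS x ->
    (chart AS c @` dom AS c) x /\ Q (chart_inv AS c x).
Proof.
move=> cs sQ; have [_ H] := manifold_image_ropen mS c (open_interior Q).
have im : (chart AS c @` (dom AS c `&` Q°)) (chart AS c s) by exists s.
apply: filterS (H _ im) => x + Dx => /(_ Dx)[s' [cs' Ws'] <-]; split; first by exists s'.
by rewrite (charted_invK chS cs'); exact: interior_subset.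
Qed.

Let op c : ropen (model AS) (chart AS c @` dom AS c).
Proof. by have := charted_open chS c c; rewrite setIid. Qed.

Lemma level_near c s : dom AS c s ->
  (\forall x \near chart AS c s, model AS x -> u (chart_inv AS c x) = mu) ->
  \forall s' \near s, u s' = mu.
Proof.
move=> cs /(chart_near cs); apply: filterS => s' [cs'].
by rewrite (charted_invK chS cs').
Qed.

Lemma level_open s : ~ boundary AS s -> u s = mu -> \forall s' \near s, u s' = mu.
Proof.
move=> ns us; have ss := charted_self chS s; apply: (level_near ss).
have [th [ta [be [th0 ta0 be0 sub]]]] := usub ss.
have op' := op s; have u2' := @u2 s; rewrite (manifold_model mS) in op' u2'.
have hs : hpos (chart AS s s).
  move=> i i0; rewrite lt_neqAle; apply/andP; split.
    by apply: contra_notN ns => /eqP si; exists i.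
  by have := charted_model chS ss; rewrite (manifold_model mS); exact.
have := interior_max op' u2' th0 ta0 be0 sub hs.
rewrite (charted_invK chS ss) => /(_ us).
by apply: filterS => x ux _.
Qed.

(** A nonnegative inward derivative lets [boundary_max] find interior points of the level set
    arbitrarily near, from which [halfspace_max] fills a neighbourhood. *)
Lemma level_boundary s : boundary AS s -> u s = mu ->
  (forall i : 'I_m, val i = 0%N ->
    0 <= pd (model AS) i (local_u s) (chart AS s s)) ->
  \forall s' \near s, u s' = mu.
Proof.
move=> [i i0 si] us du; have ss := charted_self chS s; apply: (level_near ss).
have [th [ta [be [th0 ta0 be0 sub]]]] := usub ss.
have op' := op s; have u2' := @u2 s; have du' := du i i0.
rewrite (manifold_model mS) in op' u2' du' *.
apply: (halfspace_max op' u2' th0 ta0 be0 sub).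
apply: (boundary_max op' u2' th0 ta0 be0 sub i0 si _ du').
by rewrite (charted_invK chS ss).
Qed.

Lemma hpos_approx (x : 'rV[R]_m) (d : R) (Q : set 'rV[R]_m) : model AS x -> 0 < d ->
  (\forall y \near x, model AS y -> Q y) ->
  exists y, [/\ `|y - x| < d, hpos y & Q y].
Proof.
rewrite (manifold_model mS) => Dx d0 /near_distP[e e0 eQ].
pose h := Num.min d e / 2; have de : 0 < Num.min d e by rewrite lt_min d0.
have h0 : 0 < h by rewrite divr_gt0.
have hde : h < Num.min d e by rewrite ltr_pdivrMr // ltr_pMr // ltr1n.
have hd : h < d by apply: lt_le_trans hde _; rewrite ge_min lexx.
have he : h < e by apply: lt_le_trans hde _; rewrite ge_min lexx orbT.
have yx : `|x + const_mx h - x| <= h.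
  rewrite addrAC subrr add0r; apply: rV_norm_le => [|i]; first exact: ltW.
  by rewrite mxE gtr0_norm.
have hy : hpos (x + const_mx h) by move=> i i0; rewrite !mxE ltr_wpDl // Dx.
exists (x + const_mx h); split=> //; first exact: le_lt_trans yx _.
by apply: eQ; [exact: le_lt_trans yx _ | exact: hpos_dom].
Qed.

(** Near [s] there is an open piece of the level set, and it contains points off the boundary of the
    manifold; so [halfspace_max] applies even if [s] is a boundary point. *)
Lemma level_closed s : closure [set s | u s = mu]° s -> \forall s' \near s, u s' = mu.
Proof.
move=> cls; have ss := charted_self chS s; apply: (level_near ss).
have [th [ta [be [th0 ta0 be0 sub]]]] := usub ss.
have op' := op s; have u2' := @u2 s; rewrite (manifold_model mS) in op' u2' *.
apply: (halfspace_max op' u2' th0 ta0 be0 sub) => d d0.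
have d2 : 0 < d / 2 by rewrite divr_gt0.
have [s2 [us2 [ss2 sd]]] := cls _ (chart_near ss (filterS (fun x H _ => H) (near_distW (chart AS s s) d2))).
have [y [yd hy [_ uy]]] := hpos_approx (charted_model chS ss2) d2 (chart_inv_near ss2 us2).
exists y; split=> //.
rewrite -(subrK (chart AS s s2) y) -addrA; apply: le_lt_trans (ler_normD _ _) _.
by rewrite [ltRHS](splitr d); apply: ltr_leD.
Qed.

Lemma level_full (s0 : S) : connected [set: S] -> (\forall s \near s0, u s = mu) ->
  forall s : S, u s = mu.
Proof.
move=> conn near0 s; pose Z := [set s | u s = mu]°.
have ZT : Z = [set: S].
  apply: conn; first by exists s0.
  - by exists Z; [exact: open_interior | rewrite setTI].
  exists (closure Z); first exact: closed_closure.
  by rewrite setTI; apply/seteqP; split; [exact: subset_closure | move=> s1 /level_closed].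
have : Z s by rewrite ZT.
exact: interior_subset.
Qed.

End ManifoldMaximum.

(** Both directions along coordinate [i] are allowed, so a maximum is critical in it. This concerns
    directions tangent to the boundary. *)
Lemma isdiff_max_coord {R : realType} n (D : set 'rV[R]_n) f x a i : isdiff D f x a ->
  (forall h, D (x + h *: delta_mx 0 i)) -> (forall y, D y -> f y <= f x) -> a i = 0.
Proof.
move=> [Dx fa] Dh fmax; apply/eqP; rewrite -normr_le0; apply/ler_addgt0Pr => e e0.
have /near_distP[d d0 dP] := fa e e0; rewrite add0r.
pose h := d / 2; have h0 : 0 < h by rewrite divr_gt0.
have hd : h < d by rewrite ltr_pdivrMr // ltr_pMr // ltr1n.
have step (t : R) : `|t| = h -> t * a i <= e * h.
  move=> th; have xt : x + t *: delta_mx 0 i - x = t *: delta_mx 0 i.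
    by rewrite addrAC subrr add0r.
  have nt : `|x + t *: delta_mx 0 i - x| = h by rewrite xt normrZ rV_norm_delta mulr1.
  have := dP (x + t *: delta_mx 0 i); rewrite nt => /(_ hd (Dh t)).
  rewrite xt (bigD1 i) //= big1 => [|j ji]; last first.
    by rewrite mxE delta_coord (negbTE ji) mulr0 mul0r.
  rewrite addr0 mxE delta_coord eqxx mulr1 ler_norml => /andP[H _].
  have := fmax _ (Dh t); lra.
have := step h (gtr0_norm h0); have := step (- h); rewrite normrN => /(_ (gtr0_norm h0)).
rewrite mulNr ler_norml => H1 H2; apply/andP; split; rewrite -(ler_pM2l h0); lra.
Qed.
(** Cauchy-Schwarz, from the nonnegativity of [|v + t w|^2] at [t = r] and [t = - r]. *)
Lemma dot_le_radius {R : realType} n (v w : 'rV[R]_n) (r : R) : 0 < r ->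
  sq v = r ^+ 2 -> sq w <= 1 -> `|dot v w| <= r.
Proof.
move=> r0 vr w1; rewrite ler_norml.
have H (t : R) : t ^+ 2 = r ^+ 2 -> 0 <= r ^+ 2 + t * dot v w.
  move=> tr; have := sq_ge0 (v + t *: w).
  rewrite sq_line vr tr dotC => H; have : r ^+ 2 * sq w <= r ^+ 2.
    by rewrite -[leRHS]mulr1 ler_wpM2l // sqr_ge0.
  by lra.
have := H (- r) (sqrrN r); have := H r erefl => H1 H2.
apply/andP; split; rewrite -(ler_pM2l r0); lra.
Qed.

(** * Sign of the drift Laplacian *)

Section RightHandSide.
Context {R : realType} {m n k : nat} {S M : Type}.
Context (AS : atlas R m S) (A : atlas R n M) (g : M -> 'M[R]_n).
Context (F : S -> M * 'rV[R]_k) (N : S -> 'rV[R]_(n + k)).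
Context (psi : M * 'rV[R]_k -> R) (lambda : R).
Local Notation P := (prod_atlas k A).
Local Notation gP := (prod_metric (k := k) g).
Hypothesis k2 : (2 <= k)%N.
Hypothesis chA : charted A.
Hypothesis met : charted_metric A g.
Hypothesis unitN : forall s, inner (gP (F s)) (N s) (N s) = 1.
Hypothesis cylH : forall r, 0 < r -> forall z, cylinder M k r z ->
  lambda <= H_psi_r A g psi r z.
Hypothesis absH : forall s, `|H_psi AS P gP psi F N s| <= lambda.

Definition drift_rhs s : R := k%:R - sq (rsubmx (N s))
  + inner (gP (F s)) (Vfield n (F s)) (N s) * H_psi AS P gP psi F N s
  + inner (gP (F s)) (grad P gP psi (F s)) (Vfield n (F s)).

Lemma sq_vert_normal s : sq (rsubmx (N s)) <= 1.
Proof.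
have := unitN s; rewrite -[N s]hsubmxK inner_prod row_mxKr dotE -sqE => <-.
by rewrite lerDr posdef_ge0 //; exact: (charted_metric_pos met).
Qed.

(* The difference is [(1 - |N_2|^2) + (r lambda + <V,N> H_psi)], and |<V,N>| <= r. *)
Lemma drift_rhs_pos s (r : R) : 0 < r -> enorm (F s).2 = r ->
  r * (H_psi_r A g psi r (F s) - lambda) <= drift_rhs s.
Proof.
move=> r0 zr; rewrite (H_psi_rE psi chA met r0 zr) mulrBr mulVKf ?gt_eqF // /drift_rhs.
have := sq_vert_normal s.
have -> : inner (gP (F s)) (Vfield n (F s)) (N s) = dot (F s).2 (rsubmx (N s)).
  by rewrite inner_sym ?(prod_metric_sym met) // inner_prod_V dotC.
have vr : sq (F s).2 = r ^+ 2 := cylinder_sq zr.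
have dotr := dot_le_radius r0 vr (sq_vert_normal s).
have : `|dot (F s).2 (rsubmx (N s)) * H_psi AS P gP psi F N s| <= r * lambda.
  by rewrite normrM ler_pM.
by rewrite ler_norml => /andP[H _]; lra.
Qed.

(** On the axis [V = 0], and what remains is [k - |N_2|^2 >= k - 1], positive as [k >= 2]. No
    cylinder passes there, hence the separate case. *)
Lemma drift_rhs_axis s : (F s).2 = 0 -> 0 < drift_rhs s.
Proof.
move=> z0; rewrite /drift_rhs /Vfield z0 row_mx0 /inner mul0mx mul0mx mxE mul0r addr0.
rewrite trmx0 mulmx0 mxE addr0 subr_gt0; apply: le_lt_trans (sq_vert_normal s) _.
by rewrite ltr1n.
Qed.

Lemma enorm_eq0 (t : 'rV[R]_k) : enorm t = 0 -> t = 0.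
Proof.
by move/eqP; rewrite sqrtr_eq0 => t0; apply/sq_eq0/eqP; rewrite eq_le t0 sq_ge0.
Qed.

Lemma drift_rhs_ge0 s : 0 <= drift_rhs s.
Proof.
have [/enorm_eq0 z0|z0] := eqVneq (enorm (F s).2) 0; first exact: ltW (drift_rhs_axis z0).
have r0 : 0 < enorm (F s).2 by rewrite lt_neqAle eq_sym z0 sqrtr_ge0.
apply: le_trans (drift_rhs_pos r0 erefl); rewrite mulr_ge0 ?(ltW r0) // subr_ge0.
exact: cylH.
Qed.

Lemma drift_rhs_eq0 s : drift_rhs s = 0 ->
  0 < enorm (F s).2 /\ H_psi_r A g psi (enorm (F s).2) (F s) = lambda.
Proof.
move=> rhs0; have [/enorm_eq0 z0|z0] := eqVneq (enorm (F s).2) 0.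
  by have := drift_rhs_axis z0; rewrite rhs0 ltxx.
have r0 : 0 < enorm (F s).2 by rewrite lt_neqAle eq_sym z0 sqrtr_ge0.
split=> //; apply/eqP; rewrite eq_le cylH // andbT.
by have := drift_rhs_pos r0 erefl; rewrite rhs0 pmulr_rle0 // subr_le0.
Qed.

End RightHandSide.

(** * From the data of the theorem to the local hypotheses *)

Section FromStatement.
Context {R : realType} {m n k : nat} {S M : topologicalType}.
Context (AS : atlas R m S) (AM : atlas R n M) (g : M -> 'M[R]_n).
Context (F : S -> M * 'rV[R]_k) (N : S -> 'rV[R]_(n + k)).
Context (psi : M * 'rV[R]_k -> R).
Local Notation P := (prod_atlas k AM).
Local Notation gP := (prod_metric (k := k) g).
Hypothesis mM : smooth_manifold AM.
Hypothesis riem : riemannian AM g.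
Hypothesis psi1 : Cr_fun P 1 psi.
Hypothesis hyp : two_sided_hypersurface AS P gP F N.

Let chA : charted AM := manifold_charted mM.
Let chS : charted AS := manifold_charted (hyp_manifold hyp).

Lemma chart_image_ropen {p : nat} {X : Type} (B : atlas R p X) c : charted B ->
  ropen (model B) (chart B c @` dom B c).
Proof. by move=> chB; have := charted_open chB c c; rewrite setIid. Qed.

Lemma riemannian_tame q z a b : dom AM q z ->
  tame (model AM) (chart AM q z) (fun x => gram AM g q x a b).
Proof.
move=> qz; apply: (Cr_tame (charted_box chA) (chart_image_ropen q chA)).
  exact: metric_smooth.
by exists z.
Qed.

Lemma riemannian_charted : charted_metric AM g.
Proof.
split; [exact: (Defs.metric_sym riem) | by move=> p v; exact: (metric_pos riem) |].
move=> c z a b cz; have H := tame_isdiff (charted_box chA) (riemannian_tame a b cz).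
by eexists; exact: H.
Qed.

Lemma psi_tame q z : dom P q z ->
  tame (model P) (chart P q z) (psi \o chart_inv P q).
Proof.
move=> qz; have chP := prod_charted (k := k) chA.
apply: (Cr_tame (charted_box chP) (chart_image_ropen q chP)); first exact: psi1.
by exists z.
Qed.

Lemma hypersurface_open c q :
  ropen (model AS) (chart AS c @` (dom AS c `&` F @^-1` dom P q)).
Proof.
apply: (manifold_image_ropen (hyp_manifold hyp)).
apply: (open_comp (f := fst \o F)); last exact: (dom_open mM).
by move=> s _; apply: continuous_comp; [exact: (hyp_continuous hyp) | exact: cvg_fst].
Qed.

Lemma hypersurface_charted : charted_map AS P F.
Proof. by split; [exact: hypersurface_open | move=> c q j r; exact: (hyp_smooth hyp)]. Qed.

Lemma hypersurface_normal : unit_normal AS P gP F N.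
Proof.
split; [exact: (normal_unit hyp) | exact: (normal_orth hyp) |].
move=> c s q j cs qs; eexists.
apply: (Cr1_isdiff (charted_box chS) (hypersurface_open c q)).
  exact: (normal_smooth hyp).
by exists s.
Qed.

Let met := riemannian_charted.
Let mn : m.+1 = (n + k)%N := hyp_codim hyp.
Let freeF := hyp_immersion hyp.
Let chF := hypersurface_charted.
Let nor := hypersurface_normal.

Definition height s : R := 2^-1 * sq (F s).2.

Lemma sq_continuous p : continuous (@sq R p).
Proof.
apply/continuous_subspace_setT; apply: (@isdiff_within _ _ setT) => // x _.
have [a H] := @isdiff_sq R p setT x 0 I; exists a.
by apply: isdiff_near H; apply: near_all => y _; rewrite subr0.
Qed.

Lemma height_continuous : continuous height.
Proof.
move=> s; apply: cvgM; first exact: cvg_cst.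
apply: (@cvg_comp _ _ _ (snd \o F) (@sq R k)); last exact: sq_continuous.
by apply: continuous_comp; [exact: (hyp_continuous hyp) | exact: cvg_snd].
Qed.

Lemma height_max : compact [set: S] -> S -> exists sM, forall s, height s <= height sM.
Proof.
move=> cS s0; have [] := @compact_EVT_max S R height setT _ cS.
- by exists s0.
- by apply: continuous_subspaceT; exact: height_continuous.
by move=> sM _ H; exists sM => s; apply: H; rewrite inE.
Qed.

Let psiP q z : dom P q z ->
  exists d, isdiff (model P) (psi \o chart_inv P q) (chart P q z) d.
Proof.
have bP := charted_box (prod_charted (k := k) chA).
by move=> /psi_tame /(tame_isdiff bP) H; eexists; exact: H.
Qed.

Lemma height_const (mu : R) s : (forall s, height s = mu) ->
  drift_rhs AS AM g F N psi s = 0.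
Proof.
move=> hmu; have ss := charted_self chS s; have bS := charted_box chS.
have Dx := charted_model chS ss.
have hE : half_sq AS F s = fun=> mu by apply/funext => x; exact: hmu.
have pd0 i x : model AS x -> pd (model AS) i (half_sq AS F s) x = 0.
  by move=> Dx'; rewrite hE (isdiff_pd i bS (isdiff_cst mu Dx')).
have pd00 i j : pd (model AS) j (pd (model AS) i (half_sq AS F s)) (chart AS s s) = 0.
  have H : isdiff (model AS) (pd (model AS) i (half_sq AS F s)) (chart AS s s) (fun=> 0).
    apply: isdiff_near (isdiff_cst 0 Dx).
    by apply: near_all => y Dy; rewrite pd0.
  by rewrite (isdiff_pd j bS H).
rewrite /drift_rhs -(drift_laplacian chS chA met chF nor mn freeF psiP ss).
rewrite big1 ?add0r => [|i _]; last by apply: big1 => j _; rewrite pd00 mulr0.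
by rewrite big1 // => i _; rewrite pd0 // mulr0.
Qed.

(** At a boundary maximum the derivatives tangent to the boundary vanish, so [<V,nu>] is the
    derivative in the transverse coordinate times the corresponding component of [nu], which is
    positive as [nu] points inwards. *)
Lemma height_conormal s nu : boundary AS s -> (forall s', height s' <= height s) ->
  inner_unit_conormal AS P gP F s nu -> 0 <= inner (gP (F s)) (Vfield n (F s)) nu ->
  forall i : 'I_m, val i = 0%N -> 0 <= pd (model AS) i (half_sq AS F s) (chart AS s s).
Proof.
move=> _ smax [_ [v -> v0] _] + i i0.
have ss := charted_self chS s; have bS := charted_box chS.
have hd := isdiff_refine bS (half_sq_isdiff chS chA chF ss).
have pd0 j : j != i -> pd (model AS) j (half_sq AS F s) (chart AS s s) = 0.
  move=> ji; apply: (isdiff_max_coord hd) => [h|y _]; last first.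
    by rewrite /half_sq (charted_invK chS ss); exact: smax.
  have := charted_model chS ss; rewrite (manifold_model (hyp_manifold hyp)) => Dx l l0.
  have li : l = i by apply: val_inj; rewrite l0 i0.
  by rewrite !mxE eqxx li eq_sym (negbTE ji) mulr0 addr0 -li; exact: Dx.
rewrite mulmx_sum_row inner_sumr (bigD1 i) //= big1 ?addr0 => [|j ji]; last first.
  rewrite innerZr inner_sym ?(prod_metric_sym met) //.
  by rewrite -(half_sq_grad g chS chA chF ss) pd0 // mulr0.
rewrite innerZr inner_sym ?(prod_metric_sym met) // -(half_sq_grad g chS chA chF ss).
by rewrite pmulr_rge0 //; exact: v0.
Qed.

Lemma height_sub (mu : R) c s : (forall s, height s <= mu) ->
  (forall s, 0 <= drift_rhs AS AM g F N psi s) -> dom AS c s ->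
  exists th ta be, [/\ 0 < th, 0 <= ta, 0 <= be &
    subsolution_near (chart AS c @` dom AS c) (half_sq AS F c) mu th ta be (chart AS c s)].
Proof.
move=> hmu rhs cs; apply: (subharmonic_near chS chA met riemannian_tame chF nor mn freeF
  psi_tame (manifold_model (hyp_manifold hyp)) cs) => //; exact: rhs.
Qed.

End FromStatement.

Lemma height_enorm {R : realType} k (M S : topologicalType) (F : S -> M * 'rV[R]_k) s :
  enorm (F s).2 = Num.sqrt (2 * height F s).
Proof. by rewrite /height mulVKf // pnatr_eq0. Qed.
Theorem proposition5p7 (R : realType) (n k m : nat)
  (M : topologicalType) (AM : atlas R n M) (o : M -> bool) (g : M -> 'M[R]_n)
  (psi : M * 'rV[R]_k -> R) (lambda : R)
  (Sigma : topologicalType) (AS : atlas R m Sigma) (F : Sigma -> M * 'rV[R]_k)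
  (N nu : Sigma -> 'rV[R]_(n + k)) (r0 : R) :
  let P := prod_atlas k AM in
  let gP := prod_metric (k := k) g in
  (2 <= k)%N ->
  smooth_manifold AM -> connected [set: M] -> orientation AM o ->
  riemannian AM g ->
  Cr_fun P 1 psi ->
  0 <= lambda ->
  (forall r, 0 < r -> forall z, cylinder M k r z ->
    lambda <= H_psi_r AM g psi r z) ->
  two_sided_hypersurface AS P gP F N ->
  compact [set: Sigma] -> connected [set: Sigma] ->
  boundary AS !=set0 ->
  (forall s, boundary AS s -> inner_unit_conormal AS P gP F s (nu s)) ->
  (forall s, `|H_psi AS P gP psi F N s| <= lambda) ->
  0 < r0 ->
  F @` boundary AS `<=` solid_cylinder M k r0 ->
  range F `<=` solid_cylinder M k r0 /\
  ((range F `\` F @` boundary AS) `&` cylinder M k r0 !=set0 \/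
   (forall s, boundary AS s -> 0 <= inner (gP (F s)) (Vfield n (F s)) (nu s)) ->
   exists r, [/\ 0 < r, range F `<=` cylinder M k r
     & forall z, range F z -> H_psi_r AM g psi r z = lambda]).
Proof.
move=> P gP k2 mM _ _ riem psi1 l0 cylH hyp compS connS [s0 bs0] nuP absH r00 Fb.
have mS := hyp_manifold hyp.
have chA := manifold_charted mM; have chS := manifold_charted mS.
have met := riemannian_charted mM riem.
have chF := hypersurface_charted mM hyp.
have [sM smax] := height_max hyp compS s0; pose mu := height F sM.
have rhs0 := drift_rhs_ge0 k2 chA met (normal_unit hyp) cylH absH.
have u2 c := half_sq_twice_diff chS chA chF (c := c).
have usub c s := height_sub mM riem psi1 hyp smax rhs0 (c := c) (s := s).
have fromK (s : Sigma) : (\forall s' \near s, height F s' = mu) -> forall s', height F s' = mu.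
  exact: (level_full mS (u := height F) u2 usub connS).
have bdry s : boundary AS s -> height F s <= 2^-1 * r0 ^+ 2.
  move=> bs; have : solid_cylinder M k r0 (F s) by apply: Fb; exists s.
  rewrite /solid_cylinder /= (height_enorm F) => Hs.
  have := lerXn2r 2 (sqrtr_ge0 _) (ltW r00) Hs.
  rewrite sqr_sqrtr ?mulr_ge0 ?sq_ge0 ?invr_ge0 //; lra.
have muLe : mu <= 2^-1 * r0 ^+ 2.
  (* A maximum above [r0^2 / 2] is attained off the boundary, so the height is constant; the
     boundary point [s0] excludes this. *)
  rewrite leNgt; apply/negP => muGt.
  have nb : ~ boundary AS sM by move/bdry; rewrite leNgt muGt.
  have /fromK all : \forall s' \near sM, height F s' = mu.
    exact: (level_open mS (u := height F) u2 usub nb).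
  by have := bdry s0 bs0; rewrite all leNgt muGt.
have enorm_le s : enorm (F s).2 <= r0.
  rewrite (height_enorm F) -[leRHS]ger0_norm ?(ltW r00) // -sqrtr_sqr ler_sqrt ?sqr_ge0 //.
  by have := smax s; rewrite -/mu; lra.
split=> [_ [s _ <-]|touch]; first exact: enorm_le.
have all : forall s', height F s' = mu.
  (* A contact point has height [r0^2 / 2 >= mu], so it is a maximum off the boundary. In the other
     case a maximum point is either off the boundary or subject to the conormal condition. *)
  case: touch => [[z [[[s _ <-] ns] zr]]|nuV].
    apply: (fromK s); apply: (level_open mS (u := height F) u2 usub).
      by move=> bs; apply: ns; exists s.
    apply/le_anti/andP; split; first exact: smax.
    apply: le_trans muLe _; move: zr; rewrite /cylinder /= => <-.
    by rewrite sqr_sqrtr // sq_ge0.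
  have [bM|nM] := pselect (boundary AS sM); last first.
    by apply: (fromK sM); exact: (level_open mS (u := height F) u2 usub nM).
  apply: (fromK sM); apply: (level_boundary mS (u := height F) u2 usub bM) => // i i0.
  exact: (height_conormal mM riem hyp bM smax (nuP _ bM) (nuV _ bM)).
(* That [r] is positive comes from the equality case: the drift Laplacian vanishes, and it is
   positive on the axis. *)
pose r := Num.sqrt (2 * mu).
have cyl s : enorm (F s).2 = r by rewrite (height_enorm F) all.
have rhsE s := drift_rhs_eq0 k2 chA met (normal_unit hyp) cylH absH
  (height_const mM riem psi1 hyp s all).
exists r; split.
- by rewrite -(cyl sM); have [] := rhsE sM.
- by move=> _ [s _ <-]; exact: cyl.
by move=> _ [s _ <-]; rewrite -(cyl s); have [] := rhsE s.
Qed.
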